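(* Consider the Gaussian covert communication setting with causal CSI at the transmitter described in the context, and define $\gamma^*=\min\{1,\frac{P}{2T}\}$, $T^*=(1-\gamma^* )^2T$, $P^*=T-T^*$. If $$R_K>\frac12\log\Big(1+\frac{P^*}{T^*+\sigma^2}\Big)-\frac12\log\Big(1+\frac{P^*}{T^*+1}\Big),$$ then the covert capacity with causal CSI satisfies $$C_{\mathrm{c}}\geq \frac12\log\Big(1+\frac{P^*}{T^*+1}\Big).$$
   Context: Gaussian channel with state: at each time $i$, the receiver observes $Y_i=X_i+S_i+N_{Y,i}$ and the warden observes $Z_i=X_i+S_i+N_{Z,i}$, where $X_i\in\mathbb{R}$ is the channel input, $S_i\sim\mathcal{N}(0,T)$ with $T>0$, $N_{Y,i}\sim\mathcal{N}(0,1)$, $N_{Z,i}\sim\mathcal{N}(0,\sigma^2)$ with $\sigma^2>0$, and all of $(S_i),(N_{Y,i}),(N_{Z,i})$ are IID over time and mutually independent, and independent of the message and key. The state is known to the transmitter (causally: $X_i$ depends on $(M,K,S^i)$ and possibly private randomness; noncausally: $X^n$ depends on $(M,K,S^n)$ and possibly private randomness), but not to the receiver or the warden. A secret key $K$ uniform on $[1:2^{nR_K}]$ and message $M$ uniform on $[1:2^{nR}]$ are independent; the decoder maps $(Y^n,K)$ to $\hat M$. The input power constraint is $\limsup_n \mathrm{E}[\frac1n\sum_{i=1}^n X_i^2]\leq P$ with $P>0$. The no-input symbol is $0$, so with no transmission the warden sees $Z^n\sim Q_0^{\times n}$ with $Q_0=\mathcal{N}(0,T+\sigma^2)$. A rate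 $R$ is achievable if there exist codes satisfying the power constraint with $P(\hat M\neq M)\to 0$ and $D(\widehat{P}_{Z^n}\|Q_0^{\times n})\to0$, where $\widehat{P}_{Z^n}$ is the warden's output distribution induced by the code; the covert capacities $C_{\mathrm{c}}$ (causal CSI) and $C_{\mathrm{nc}}$ (noncausal CSI) are the suprema of achievable rates. *)

(* Defs.v *)
From HB Require Import structures.
From mathcomp Require Import all_boot all_order all_algebra.
From mathcomp Require Import all_classical all_reals all_analysis.
Set Implicit Arguments.
Unset Strict Implicit.
Unset Printing Implicit Defensive.
Import Order.TTheory GRing.Theory Num.Theory.
Import numFieldNormedType.Exports.
Local Open Scope classical_set_scope.
Local Open Scope ring_scope.

(* logarithm in base 2 (rates are in bits: message set of size 2^{nR}) *)
Definition log2 {R : realType} (x : R) : R := ln x / ln 2.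

Definition msize {R : realType} (n : nat) (r : R) : nat :=
  `| Num.ceil (2 `^ (n%:R * r)) |%N.

Definition has_density {d} {T : measurableType d} {R : realType}
  (P Q : set T -> \bar R) (f : T -> R) : Prop :=
  [/\ measurable_fun [set: T] f, (forall x, 0 <= f x) &
      forall A, measurable A -> P A = (\int[Q]_(x in A) (f x)%:E)%E].

Definition KL {d} {T : measurableType d} {R : realType}
  (P Q : set T -> \bar R) : \bar R :=
  match pselect (exists f, has_density P Q f) with
  | left H => (\int[P]_x (ln (projT1 (cid H) x))%:E)%E
  | right _ => +oo%E
  end.

(* A probabilistic model of one block of length n of the Gaussian channel with
   state, with message set 'I_a (uniform), key set 'I_b (uniform), private
   randomness W ~ Unif[0,1] of the encoder, states S_i ~ N(0,T), receiver
   noises NY_i ~ N(0,1), warden noises NZ_i ~ N(0,sig2), all mutually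
   independent. *)
Record gmodel (R : realType) (T sig2 : R) (n a b : nat) := GModel {
  gd : measure_display;
  gO : measurableType gd;
  gP : probability gO R;
  gM : gO -> 'I_a;
  gK : gO -> 'I_b;
  gW : gO -> R;
  gS : 'I_n -> gO -> R;
  gNY : 'I_n -> gO -> R;
  gNZ : 'I_n -> gO -> R;
  gM_meas : forall m, measurable (gM @^-1` [set m]);
  gK_meas : forall k, measurable (gK @^-1` [set k]);
  gW_meas : measurable_fun [set: gO] gW;
  gS_meas : forall i, measurable_fun [set: gO] (gS i);
  gNY_meas : forall i, measurable_fun [set: gO] (gNY i);
  gNZ_meas : forall i, measurable_fun [set: gO] (gNZ i);
  gM_law : forall m, gP (gM @^-1` [set m]) = ((a%:R)^-1)%:E;
  gK_law : forall k, gP (gK @^-1` [set k]) = ((b%:R)^-1)%:E;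
  gW_law : forall A, measurable A ->
    gP (gW @^-1` A) = lebesgue_measure (A `&` `[0, 1]);
  gS_law : forall i A, measurable A ->
    gP (gS i @^-1` A) = normal_prob 0 (Num.sqrt T) A;
  gNY_law : forall i A, measurable A ->
    gP (gNY i @^-1` A) = normal_prob 0 1 A;
  gNZ_law : forall i A, measurable A ->
    gP (gNZ i @^-1` A) = normal_prob 0 (Num.sqrt sig2) A;
  g_indep : forall (Am : set 'I_a) (Ak : set 'I_b) (Aw : set R)
      (As Ay Az : 'I_n -> set R),
    measurable Aw -> (forall i, measurable (As i)) ->
    (forall i, measurable (Ay i)) -> (forall i, measurable (Az i)) ->
    gP (gM @^-1` Am `&` gK @^-1` Ak `&` gW @^-1` Aw
        `&` (\bigcap_i (gS i @^-1` As i))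
        `&` (\bigcap_i (gNY i @^-1` Ay i))
        `&` (\bigcap_i (gNZ i @^-1` Az i)))
    = (gP (gM @^-1` Am) * gP (gK @^-1` Ak) * gP (gW @^-1` Aw)
       * (\prod_(i < n) gP (gS i @^-1` As i))
       * (\prod_(i < n) gP (gNY i @^-1` Ay i))
       * (\prod_(i < n) gP (gNZ i @^-1` Az i)))%E }.

Record ccode (R : realType) (n a b : nat) := CCode {
  enc : 'I_n -> 'I_a -> 'I_b -> n.-tuple R -> R -> R;
  dec : n.-tuple R -> 'I_b -> 'I_a;
  enc_causal : forall (i : 'I_n) (m : 'I_a) (k : 'I_b) (s s' : n.-tuple R) (w : R),
    (forall j : 'I_n, (j <= i)%N -> tnth s j = tnth s' j) ->
    enc i m k s w = enc i m k s' w;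
  enc_meas : forall i m k,
    measurable_fun [set: n.-tuple R * R] (fun p => enc i m k p.1 p.2);
  dec_meas : forall k m, measurable [set y | dec y k = m] }.

Arguments gd {R T sig2 n a b} g.
Arguments gO {R T sig2 n a b} g.
Arguments gP {R T sig2 n a b} g.
Arguments gM {R T sig2 n a b} g _.
Arguments gK {R T sig2 n a b} g _.
Arguments gW {R T sig2 n a b} g _.
Arguments gS {R T sig2 n a b} g _ _.
Arguments gNY {R T sig2 n a b} g _ _.
Arguments gNZ {R T sig2 n a b} g _ _.
Arguments enc {R n a b} c _ _ _ _ _.
Arguments dec {R n a b} c _ _.
Section code_quantities.
Context (R : realType) (T sig2 : R) (n a b : nat)
  (c : ccode R n a b) (md : gmodel T sig2 n a b).

Definition cX (i : 'I_n) (w : gO md) : R :=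
  enc c i (gM md w) (gK md w) [tuple gS md j w | j < n] (gW md w).
Definition cY (w : gO md) : n.-tuple R :=
  [tuple cX i w + gS md i w + gNY md i w | i < n].
Definition cZ (w : gO md) : n.-tuple R :=
  [tuple cX i w + gS md i w + gNZ md i w | i < n].
(* warden output with no transmission (input symbol 0): law Q_0^{x n} *)
Definition cZ0 (w : gO md) : n.-tuple R :=
  [tuple gS md i w + gNZ md i w | i < n].

Definition code_perr : \bar R :=
  gP md [set w | dec c (cY w) (gK md w) != gM md w].
Definition code_power : \bar R :=
  (\int[gP md]_w ((n%:R)^-1 * \sum_(i < n) cX i w ^+ 2)%:E)%E.
Definition code_warden : set (n.-tuple R) -> \bar R := pushforward (gP md) cZ.
Definition code_Q0n : set (n.-tuple R) -> \bar R := pushforward (gP md) cZ0.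
Definition code_covertness : \bar R := KL code_warden code_Q0n.
End code_quantities.

Definition achievable_c (R : realType) (T sig2 Pw RK r : R) : Prop :=
  exists c : forall n, ccode R n (msize n r) (msize n RK),
  forall md : forall n, gmodel T sig2 n (msize n r) (msize n RK),
  [/\ (limn_esup (fun n => code_power (c n) (md n)) <= Pw%:E)%E,
      (fun n => code_perr (c n) (md n)) @ \oo --> 0%E &
      (fun n => code_covertness (c n) (md n)) @ \oo --> 0%E].

Definition covert_capacity_c (R : realType) (T sig2 Pw RK : R) : \bar R :=
  ereal_sup [set r%:E | r in [set r | achievable_c T sig2 Pw RK r]].

(* Main.v *)
Require Import Defs.
From HB Require Import structures.
From mathcomp Require Import all_boot all_order all_algebra.
From mathcomp Require Import all_classical all_reals all_analysis.
From mathcomp Require Import measurable_realfun measurable_fun_approximation.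
From mathcomp Require Import simple_functions ring lra.
Set Implicit Arguments.
Unset Strict Implicit.
Unset Printing Implicit Defensive.
Import Order.TTheory GRing.Theory Num.Theory.
Import numFieldNormedType.Exports.
Local Open Scope classical_set_scope.
Local Open Scope ring_scope.

(** The transmitter sends [X_i = U_i - gam * S_i], with [U] drawn from a Gaussian
    random codebook of variance [Ps]: this spends [2 * gam * T <= Pw] of power and
    leaves an interference of variance [Ts], so that with [vY = Ts + 1] and
    [vZ = Ts + sig2] both outputs have exactly the idle variances [Ps + vY] and
    [Ps + vZ].  Everything is expressed through the likelihood ratio [L (u, y)] of
    the output given [u] against the idle output.  The receiver's error probability
    and the divergence at the warden are bounded by the integrals of [L] to the
    powers [1 - s] and [1 + s] for a small [s > 0]; these are exponential in [n]
    with the two mutual informations as rates, up to a term of order [s ^+ 2].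
    All these costs are sums over pairs of codewords, so codewords achieving the
    mean can be picked one at a time, without a measure on codebooks. *)

(** * Integration and powers of a probability measure *)

(** One codebook must meet three requirements with different tolerances. Error and divergence only
    have to vanish, but the power must be right in the limit, with no slack at all when
    [Pw <= 2 * T], so the energy of the chosen words may exceed its mean only by a vanishing factor,
    for which Markov's inequality is too coarse. The other two costs are therefore given the weight
    [k], the inverse of [x ^+ n], against the energy, where [x < 1] and their mean excess is of
    order [x ^+ (2 * n)]; every excess then has order [x ^+ n].

    Message and key together index the codebook. The receiver knows the key, so only words sharing
    it compete: the message rate must stay below the receiver's information. The warden sees the
    average over all words: the total rate must exceed the warden's information. The difference is
    the condition on [RK].

    [achievable_c] fixes the code before the probability space, so codebooks are judged by integrals
    against fixed Gaussian product laws. [KL] uses an arbitrary density supplied by choice, so the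
    explicit density, kept strictly positive, has to be matched with it almost everywhere. *)

Section density.
Context d (T : measurableType d) (R : realType).
Local Open Scope ereal_scope.
Import HBNNSimple.

(** Change of measure. Monotone convergence reduces it to simple functions, for which [PQ] is used
    on each level set. *)
Lemma ge0_integral_density (P Q : {measure set T -> \bar R}) (f : T -> R)
    (g : T -> \bar R) :
  measurable_fun [set: T] f -> (forall x, (0 <= f x)%R) ->
  (forall A, measurable A -> P A = \int[Q]_(x in A) (f x)%:E) ->
  measurable_fun [set: T] g -> (forall x, 0 <= g x) ->
  \int[P]_x g x = \int[Q]_x (g x * (f x)%:E).
Proof.
move=> mf f0 PQ mg g0.
pose h := nnsfun_approx measurableT mg.
have hg x : (h n x)%:E @[n --> \oo] --> g x.
  by apply: cvg_nnsfun_approx => // ? _; exact: g0.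
have hnd x m n : (m <= n)%N -> ((h m x)%:E <= (h n x)%:E).
  by move=> mn; rewrite lee_fin; exact/lefP/nd_nnsfun_approx.
have -> : \int[P]_x g x = limn (fun n => \int[P]_x (h n x)%:E).
  rewrite -monotone_convergence//.
  - by apply: eq_integral => x _; apply/esym/cvg_lim => //; exact: hg.
  - by move=> n; exact/measurable_EFinP.
  - by move=> n x _; rewrite lee_fin.
  - by move=> x _ m n mn; exact: hnd.
have -> : \int[Q]_x (g x * (f x)%:E) =
    limn (fun n => \int[Q]_x ((h n x)%:E * (f x)%:E)).
  rewrite -monotone_convergence//.
  - apply: eq_integral => x _; apply/esym/cvg_lim => //.
    by apply: cvgeZr => //; exact: hg.
  - move=> n; apply: emeasurable_funM; exact/measurable_EFinP.
  - by move=> n x _; rewrite mule_ge0 ?lee_fin.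
  - by move=> x _ m n mn; rewrite lee_wpmul2r ?lee_fin//; exact: hnd.
congr (limn _); apply/funext => n.
under eq_integral do rewrite fimfunE -fsumEFin//.
rewrite ge0_integral_fsum//; last 2 first.
- by move=> y; exact/measurable_EFinP/measurable_funM.
- by move=> y x _; rewrite nnfun_muleindic_ge0.
have hE z : (h n z)%:E * (f z)%:E = \sum_(y \in range (h n))
    (y * \1_(h n @^-1` [set y]) z)%:E * (f z)%:E.
  rewrite fimfunE -fsumEFin// ge0_mule_fsuml// => y.
  exact: nnfun_muleindic_ge0.
under [RHS]eq_integral do rewrite hE.
rewrite ge0_integral_fsum//; last 2 first.
- move=> y; apply: emeasurable_funM; last exact/measurable_EFinP.
  by exact/measurable_EFinP/measurable_funM.
- move=> y x _; apply: mule_ge0; last by rewrite lee_fin.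
  exact: nnfun_muleindic_ge0.
apply: eq_fsbigr => y /set_mem[x _ hxy].
have y0 : (0 <= y)%R by rewrite -hxy.
under eq_integral do rewrite EFinM.
rewrite ge0_integralZl//; last by apply/measurable_EFinP/measurable_indic.
rewrite integral_indic// setIT PQ//.
under [RHS]eq_integral do rewrite EFinM -muleA.
rewrite ge0_integralZl//; last 2 first.
- apply: emeasurable_funM; last exact/measurable_EFinP.
  exact/measurable_EFinP/measurable_indic.
- by move=> z _; rewrite mule_ge0 ?lee_fin.
congr (_ * _); rewrite [LHS]integral_mkcond; apply: eq_integral => z _.
by rewrite patchE indicE; case: ifPn; rewrite ?mul1e ?mul0e.
Qed.
End density.

Section power_probability.
Context d (T : measurableType d) (R : realType) (P : probability T R).
Local Open Scope ereal_scope.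

Definition tuple_cons n (p : T * n.-tuple T) : n.+1.-tuple T :=
  [tuple of p.1 :: p.2].

Lemma measurable_tuple_cons n : measurable_fun [set: T * n.-tuple T] (@tuple_cons n).
Proof. exact: measurable_cons. Qed.

HB.instance Definition _ n := isMeasurableFun.Build _ _ _ _ _
  (@measurable_tuple_cons n).

(** Defined by recursion on the length, as the law of [x :: t] for independent [x] and [t], so that
    Tonelli peels off one coordinate per step of an induction. *)
Fixpoint pow_prob n : probability (n.-tuple T) R :=
  match n with
  | 0 => dirac [tuple]
  | m.+1 => distribution (P \x pow_prob m) (@tuple_cons m)
  end.

Lemma ge0_integral_pow_prob0 (f : 0.-tuple T -> \bar R) :
  measurable_fun [set: 0.-tuple T] f ->
  \int[pow_prob 0]_t f t = f [tuple].
Proof.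
by move=> mf; rewrite integral_dirac//= diracT mul1e.
Qed.

Lemma ge0_integral_pow_probS n (f : n.+1.-tuple T -> \bar R) :
  measurable_fun [set: n.+1.-tuple T] f -> (forall t, 0 <= f t) ->
  \int[pow_prob n.+1]_t f t =
  \int[P]_x \int[pow_prob n]_t f (tuple_cons (x, t)).
Proof.
move=> mf f0; rewrite ge0_integral_distribution// fubini_tonelli1//.
  exact: measurableT_comp.
by move=> x; exact: f0.
Qed.

Lemma emeasurable_prod_tnth n (h : 'I_n -> T -> \bar R) :
  (forall i, measurable_fun [set: T] (h i)) ->
  measurable_fun [set: n.-tuple T] (fun t => \prod_(i < n) h i (tnth t i)).
Proof.
move=> mh; elim: (index_enum _) => [|i s IH].
  by under eq_fun do rewrite big_nil; exact: measurable_cst.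
under eq_fun do rewrite big_cons; apply: emeasurable_funM => //.
by apply: measurableT_comp => //; exact: measurable_tnth.
Qed.

Lemma ge0_integral_pow_prob_prod n (h : 'I_n -> T -> \bar R) :
  (forall i, measurable_fun [set: T] (h i)) -> (forall i x, 0 <= h i x) ->
  \int[pow_prob n]_t \prod_(i < n) h i (tnth t i) =
  \prod_(i < n) \int[P]_x h i x.
Proof.
elim: n h => [|n IH] h mh h0.
  rewrite ge0_integral_pow_prob0; last exact: emeasurable_prod_tnth.
  by rewrite !big_ord0.
rewrite ge0_integral_pow_probS; last 2 first.
- exact: emeasurable_prod_tnth.
- by move=> t; exact: prode_ge0.
rewrite big_ord_recl -ge0_integralZr//; last first.
  by apply: prode_ge0 => i _; exact: integral_ge0.
apply: eq_integral => x _; rewrite -IH// -ge0_integralZl//.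
- apply: eq_integral => t _; rewrite big_ord_recl.
  by congr (_ * _); apply: eq_bigr => i _; rewrite tnthS.
- by apply: (emeasurable_prod_tnth (h := fun i => h (lift ord0 i))).
- by move=> t _; exact: prode_ge0.
Qed.

Lemma ge0_integral_pow_prob_tnth n (f : T -> \bar R) (i : 'I_n) :
  measurable_fun [set: T] f -> (forall x, 0 <= f x) ->
  \int[pow_prob n]_t f (tnth t i) = \int[P]_x f x.
Proof.
move=> mf f0; pose h j := if j == i then f else cst 1.
transitivity (\int[pow_prob n]_t \prod_(j < n) h j (tnth t j)).
  apply: eq_integral => t _; rewrite (bigD1 i)//= big1 ?mule1 /h ?eqxx//.
  by move=> j /negbTE ->.
rewrite ge0_integral_pow_prob_prod.
- rewrite (bigD1 i)//= big1 ?mule1 /h ?eqxx// => j /negbTE ->.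
  by rewrite integral_cst// mul1e; exact: probability_setT.
- by move=> j; rewrite /h; case: ifP => _ //; exact: measurable_cst.
- by move=> j x; rewrite /h; case: ifP.
Qed.

End power_probability.

(** * Uniqueness of measures on tuples *)

Section tuple_boxes.
Context d (T : measurableType d) (G : set (set T)) (n : nat).
Hypothesis mG : @measurable _ T = <<s G >>.
Hypothesis GT : G [set: T].
Hypothesis GI : setI_closed G.

Definition box (A : 'I_n -> set T) : set (n.-tuple T) :=
  [set t | forall i, A i (tnth t i)].

Lemma measurable_box A : (forall i, measurable (A i)) -> measurable (box A).
Proof.
move=> mA; rewrite (_ : box A = \bigcap_(i in [set: 'I_n]) ((tnth (T:=T))^~ i @^-1` A i)).
  apply: fin_bigcap_measurable => // i _.
  by rewrite -[X in measurable X]setTI; exact: measurable_tnth.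
by apply/seteqP; split => t /= h i; [move=> _; exact: h|exact: h].
Qed.

Definition boxes := [set B | exists2 A, (forall i, G (A i)) & B = box A].

Lemma boxes_measurable : boxes `<=` measurable.
Proof.
move=> _ [A GA ->]; apply: measurable_box => i.
by rewrite mG; apply: sub_gen_smallest.
Qed.

Lemma boxesI : setI_closed boxes.
Proof.
move=> _ _ [A GA ->] [B GB ->]; exists (fun i => A i `&` B i).
  by move=> i; exact: GI.
apply/seteqP; split => [t [hA hB] i|t h]; first by split.
by split => i; have [] := h i.
Qed.

(** A box restricting only coordinate [i] is a preimage under the [i]-th projection, by [GT]. Hence
    every projection is measurable for the sigma-algebra generated by the boxes. *)
Lemma measurable_tupleE : @measurable _ (n.-tuple T) = <<s boxes >>.
Proof.
apply/seteqP; split; last first.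
  apply: smallest_sub; first exact: sigma_algebra_measurable.
  exact: boxes_measurable.
have mid : measurable_fun [set: g_sigma_algebraType boxes]
    (idfun : g_sigma_algebraType boxes -> n.-tuple T).
  apply/measurable_fun_tnthP => i.
  apply: (measurability G) => //.
  move=> _ [B GB <-]; rewrite setTI; apply: sub_gen_smallest.
  exists (fun j => if j == i then B else setT).
    by move=> j; case: ifP.
  apply/seteqP; split => [t Bt j|t /(_ i)]/=; last by rewrite eqxx.
  by case: ifPn => // /eqP ->.
by move=> A mA; have := mid measurableT _ mA; rewrite setTI.
Qed.

(** The form in which independence is exploited: boxes are a pi-system, so a finite measure is
    determined by them. The sides range over a generator [G] so that rectangles suffice when the
    coordinates are pairs. *)
Lemma tuple_measure_unique (R : realType)
    (m1 m2 : {measure set (n.-tuple T) -> \bar R}) :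
  (forall A, (forall i, G (A i)) -> m1 (box A) = m2 (box A)) ->
  (m1 setT < +oo)%E ->
  forall A, measurable A -> m1 A = m2 A.
Proof.
move=> m12 m1T; apply: (measure_unique boxes (fun=> setT)) => //.
- exact: measurable_tupleE.
- exact: boxesI.
- by move=> _; exists (fun=> setT) => //; apply/seteqP; split.
- by rewrite bigcup_const.
- by move=> _ [A GA ->]; exact: m12.
Qed.

End tuple_boxes.

Lemma pow_prob_box d (T : measurableType d) (R : realType) (P : probability T R)
    n (A : 'I_n -> set T) : (forall i, measurable (A i)) ->
  pow_prob P n (box A) = (\prod_(i < n) P (A i))%E.
Proof.
move=> mA; transitivity (\int[pow_prob P n]_t
    \prod_(i < n) (\1_(A i) (tnth t i) : R)%:E)%E; last first.
  rewrite (ge0_integral_pow_prob_prod P (h := fun i x => (\1_(A i) x)%:E))//.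
    by apply: eq_bigr => i _; rewrite integral_indic// setIT.
  by move=> i; exact/measurable_EFinP/measurable_indic.
transitivity (\int[pow_prob P n]_t (\1_(box A) t : R)%:E)%E.
  by rewrite integral_indic ?setIT//; exact: measurable_box.
apply: eq_integral => t _; rewrite indicE.
case: (pselect (box A t)) => [At|nAt].
  by rewrite mem_set// big1// => i _; rewrite indicE mem_set//; exact: At.
rewrite memNset//; move/existsNP : nAt => [i nAi].
by rewrite (bigD1 i)//= indicE memNset// mul0e.
Qed.

(** * One-shot random coding *)

Section selection.
Context d (T : measurableType d) (R : realType) (P : probability T R).
Local Open Scope ereal_scope.

Lemma integral_cst_probability (r : \bar R) : \int[P]__ r = r.
Proof.
by rewrite integral_cst// -[RHS]mule1; congr (_ * _); exact: probability_setT.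
Qed.

(** First-moment method. If [f] exceeded its mean everywhere, [f] minus the mean would be positive
    with integral 0, hence zero almost everywhere on a space of mass 1. *)
Lemma exists_le_integral (f : T -> \bar R) :
  measurable_fun [set: T] f -> (forall x, 0 <= f x) ->
  exists x, f x <= \int[P]_x f x.
Proof.
move=> mf f0; apply/not_existsP => h.
have {}h x : \int[P]_x f x < f x by rewrite ltNge; apply/negP.
have I0 : 0 <= \int[P]_x f x by apply: integral_ge0.
(* A point makes the mean finite, since it lies strictly below the value of [f] there. *)
have [pt] : exists x : T, True.
  apply: contrapT => /forallNP nT.
  have := probability_setT P; rewrite (_ : [set: T] = set0) ?measure0.
    by move=> /eqP; rewrite eqe eq_sym oner_eq0.
  by apply/seteqP; split => // x _; exact: (nT x).
move=> _; have [r cE] : exists r, \int[P]_x f x = r%:E.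
  apply/EFin_fin_numP; rewrite ge0_fin_numE// (lt_le_trans (h pt))//.
  exact: leey.
have intf : P.-integrable [set: T] f.
  apply/integrableP; split => //; under eq_integral do rewrite gee0_abs//.
  by rewrite cE ltry.
have /(ae_eq_integral_abs P measurableT) : \int[P]_x `|f x - r%:E| = 0.
  transitivity (\int[P]_x (f x - r%:E)).
    apply: eq_integral => x _; rewrite gee0_abs// sube_ge0 ?orbT// -cE.
    exact/ltW.
  rewrite integralB//; last exact: finite_measure_integrable_cst.
  by rewrite integral_cst_probability cE subee.
have mfr : measurable_fun [set: T] (fun x => f x - r%:E).
  exact: emeasurable_funB.
move=> /(_ mfr) ae0.
have PT : P [set: T] = 1 by exact: probability_setT.
have : P [set: T] = 0.
  apply/negligibleP => //; apply: negligibleS ae0 => x _ /= /(_ I) fr0.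
  by have := h x; rewrite cE -sube_gt0 fr0 ltxx.
by rewrite PT => /eqP; rewrite eqe oner_eq0.
Qed.

Lemma sum_pairs_cons (J : eqType) (x : J) (s : seq J) (H : J -> J -> \bar R) :
  x \notin s ->
  \sum_(j <- x :: s) \sum_(l <- x :: s | l != j) H j l =
  \sum_(l <- s) (H x l + H l x) + \sum_(j <- s) \sum_(l <- s | l != j) H j l.
Proof.
move=> xs; rewrite big_cons big_cons eqxx/=.
have -> : \sum_(l <- s | l != x) H x l = \sum_(l <- s) H x l.
  rewrite big_seq_cond [RHS]big_seq; apply: eq_bigl => l.
  by case: eqP => [->|_]; rewrite ?andbT// (negbTE xs).
rewrite big_split -addeA; congr (_ + _); rewrite -big_split/=.
apply: eq_big_seq => j js; rewrite big_cons; case: eqP => // xj.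
by move: xs; rewrite xj js.
Qed.

(* Induction on [s]: fixing the first codeword at a value no worse than average
   turns its pair costs into single costs of the remaining ones. *)
Lemma select_pairwise (J : eqType) (s : seq J) (F : J -> T -> \bar R)
    (H : J -> J -> T * T -> \bar R) : uniq s ->
  (forall j, measurable_fun [set: T] (F j)) -> (forall j x, 0 <= F j x) ->
  (forall j l, measurable_fun [set: T * T] (H j l)) ->
  (forall j l p, 0 <= H j l p) ->
  exists c : J -> T,
    \sum_(j <- s) F j (c j) +
      \sum_(j <- s) \sum_(l <- s | l != j) H j l (c j, c l) <=
    \sum_(j <- s) \int[P]_x F j x +
      \sum_(j <- s) \sum_(l <- s | l != j) \int[P]_x \int[P]_y H j l (x, y).
Proof.
move=> + mF F0 mH H0.
have mH1 j l x : measurable_fun [set: T] (fun y => H j l (x, y)).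
  exact: measurable_fun_pair2.
have mH2 j l y : measurable_fun [set: T] (fun x => H j l (x, y)).
  exact: measurable_fun_pair1.
have mI1 j l : measurable_fun [set: T] (fun x => \int[P]_y H j l (x, y)).
  exact: measurable_fun_fubini_tonelli_F.
have mI2 j l : measurable_fun [set: T] (fun y => \int[P]_x H j l (x, y)).
  exact: measurable_fun_fubini_tonelli_G.
elim: s F mF F0 => [|x s IH] F mF F0 /=.
  move=> _; have [a _] := @exists_le_integral (cst 0) (measurable_cst _) (fun=> lexx _).
  by exists (fun=> a); rewrite !big_nil.
move=> /andP[xs us].
(* Both orders of the pair are charged, since the costs [H] need not be symmetric in the two
   words. *)
pose K l a b := H x l (a, b) + H l x (b, a).
have K0 l a b : 0 <= K l a b by rewrite adde_ge0.
have mK l a : measurable_fun [set: T] (K l a) by exact: emeasurable_funD.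
have IKE l a : \int[P]_b K l a b =
    \int[P]_b H x l (a, b) + \int[P]_b H l x (b, a) by rewrite ge0_integralD.
have mIK l : measurable_fun [set: T] (fun a => \int[P]_b K l a b).
  by under eq_fun do rewrite IKE; exact: emeasurable_funD.
have [a ha] : exists a, F x a + \sum_(l <- s) \int[P]_b K l a b <=
    \int[P]_a F x a + \sum_(l <- s) \int[P]_a \int[P]_b K l a b.
  rewrite -ge0_integral_sum//; last by move=> l y _; exact: integral_ge0.
  rewrite -ge0_integralD//; last 2 first.
  - by move=> y _; apply: sume_ge0 => l _; exact: integral_ge0.
  - exact: emeasurable_sum.
  apply: exists_le_integral.
  - by apply: emeasurable_funD => //; exact: emeasurable_sum.
  - by move=> y; apply: adde_ge0 => //; apply: sume_ge0 => l _; exact: integral_ge0.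
pose F' l b := F l b + K l a b.
have [||c hc] := IH F' _ _ us.
- by move=> j; exact: emeasurable_funD.
- by move=> j y; rewrite adde_ge0.
pose cc j := if j == x then a else c j.
have ccx : cc x = a by rewrite /cc eqxx.
have ccE j : j \in s -> cc j = c j.
  by rewrite /cc; case: eqP => // jx js; move: xs; rewrite -jx js.
exists cc; rewrite !(sum_pairs_cons _ xs) !big_cons ccx.
have -> : \sum_(j <- s) F j (cc j) = \sum_(j <- s) F j (c j).
  by apply: eq_big_seq => j /ccE ->.
have -> : \sum_(l <- s) (H x l (a, cc l) + H l x (cc l, a)) =
    \sum_(l <- s) K l a (c l).
  by apply: eq_big_seq => j /ccE ->.
have -> : \sum_(j <- s) \sum_(l <- s | l != j) H j l (cc j, cc l) =
    \sum_(j <- s) \sum_(l <- s | l != j) H j l (c j, c l).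
  apply: eq_big_seq => j /ccE ->.
  rewrite big_seq_cond [RHS]big_seq_cond; apply: eq_bigr => l /andP[/ccE -> //].
have IIK l : \int[P]_y \int[P]_b K l y b =
    \int[P]_y \int[P]_b H x l (y, b) + \int[P]_y \int[P]_b H l x (y, b).
  under eq_integral do rewrite IKE.
  rewrite ge0_integralD//.
  - by congr (_ + _); rewrite -fubini_tonelli2// fubini_tonelli1.
  - by move=> y _; exact: integral_ge0.
  - by move=> y _; exact: integral_ge0.
under [X in _ <= _ + (X + _)]eq_bigr do rewrite -IIK.
have E1 : \sum_(j <- s) F' j (c j) =
    \sum_(j <- s) F j (c j) + \sum_(j <- s) K j a (c j) by rewrite -big_split.
have E2 : \sum_(j <- s) \int[P]_y F' j y =
    \sum_(j <- s) \int[P]_y F j y + \sum_(j <- s) \int[P]_y K j a y.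
  by rewrite -big_split; apply: eq_bigr => j _; rewrite ge0_integralD.
rewrite E1 E2 in hc.
move: hc ha.
move: (\sum_(j <- s) F j (c j)) (\sum_(j <- s) K j a (c j)).
move: (\sum_(j <- s) \int[P]_y F j y) (\sum_(j <- s) \int[P]_y K j a y).
move: (\sum_(j <- s) \sum_(l <- s | l != j) H j l (c j, c l)).
move: (\sum_(i <- s) \int[P]_y \int[P]_b K i y b) (F x a) (\int[P]_a F x a).
move=> IKK Fx IFx SH IF IK SF SK hc ha.
rewrite -[leLHS]addeA (addeA SF).
apply: (le_trans (leeD2l Fx hc)).
rewrite (addeC IF IK) -(addeA IK) (addeA Fx) [leRHS]addeACA.
exact: leeD2r.
Qed.
End selection.

(** * Inequalities between logarithms and powers *)

Section real_inequalities.
Context (R : realType).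
Implicit Types s x y : R.

Lemma powR_le_tangent s x : 0 <= s -> s <= 1 -> 0 < x -> x `^ s <= 1 - s + s * x.
Proof.
move=> s0 s1 x0; rewrite /powR gt_eqF//; set t := ln x.
have -> : x = expR t by rewrite lnK.
(* Adding [h1] with weight [s] to [h2] with weight [1 - s] cancels the terms in [t] and leaves
   [expR (s * t) <= 1 - s + s * expR t]. *)
have h1 : expR (s * t) * (1 + (1 - s) * t) <= expR t.
  rewrite [leRHS](_ : _ = expR (s * t) * expR ((1 - s) * t)).
    by rewrite ler_pM2l ?expR_gt0// expR_ge1Dx.
  by rewrite -expRD; congr expR; ring.
have h2 : expR (s * t) * (1 - s * t) <= 1.
  rewrite [leRHS](_ : _ = expR (s * t) * expR (- (s * t))).
    by rewrite ler_pM2l ?expR_gt0// expR_ge1Dx.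
  by rewrite -expRD subrr expR0.
have := expR_gt0 (s * t); move: h1 h2; move: (expR (s * t)) (expR t) => u v.
nra.
Qed.

Lemma ln_le_subr1 x : 0 < x -> ln x <= x - 1.
Proof.
move=> x0; have := expR_ge1Dx (ln x); rewrite lnK// => h.
by rewrite lerBrDl.
Qed.

Lemma xlnx_ge x : 0 < x -> x - 1 <= x * ln x.
Proof.
move=> x0; have := @ln_le_subr1 x^-1; rewrite invr_gt0 => /(_ x0).
rewrite lnV ?posrE// => h.
have : x * (1 - x^-1) <= x * ln x by rewrite ler_pM2l//; lra.
by rewrite mulrBr mulr1 divff// gt_eqF.
Qed.

Lemma ln_le_powR s x : 0 < s -> 0 < x -> ln x <= (x `^ s - 1) / s.
Proof.
move=> s0 x0; rewrite ler_pdivlMr// mulrC -ln_powR.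
by apply: ln_le_subr1; exact: powR_gt0.
Qed.

(* The split at [x = 1] replaces subadditivity of the power [s]. *)
Lemma ln_addr_le s x y : 0 < s -> s <= 1 -> 0 < x -> 0 <= y ->
  ln (x + y) + 1 <= x `^ s / s + y.
Proof.
move=> s0 s1 x0 y0; have s1' : 1 <= s^-1 by rewrite invf_ge1.
have [x1|/ltW x1] := leP x 1.
  have : ln (x + y) <= x + y - 1 by apply: ln_le_subr1; lra.
  have : x <= x `^ s.
    by rewrite ger1_powR// x0.
  have : x `^ s <= x `^ s / s by rewrite ler_peMr// powR_ge0.
  lra.
have -> : x + y = x * (1 + y / x) by field; rewrite gt_eqF.
have yx0 : 0 <= y / x by rewrite divr_ge0// ltW.
rewrite lnM ?posrE//; last lra.
have := ln_le_powR s0 x0.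
have : ln (1 + y / x) <= y / x.
  by have := @ln_le_subr1 (1 + y / x); lra.
have : y / x <= y by rewrite ler_piMr// invf_le1.
rewrite mulrBl mul1r; lra.
Qed.

(* [l = l `^ (1 - s) * l `^ s], and [l `^ s] lies below its tangent at [A]. *)
Lemma decoding_indicator_le s (A l T : R) : 0 <= s -> s <= 1 -> 0 < A -> 0 < l ->
  l <= T ->
  l <= (1 - s) * A `^ s * l `^ (1 - s) + s * A `^ (s - 1) * l `^ (1 - s) * T.
Proof.
move=> s0 s1 A0 l0 lT.
have lA0 : 0 < l / A by rewrite divr_gt0.
have p0 : 0 < A `^ s by exact: powR_gt0.
have r0 : 0 < l `^ (1 - s) by exact: powR_gt0.
have lE : l = A `^ s * l `^ (1 - s) * (l / A) `^ s.
  rewrite powRM ?invr_ge0 ?ltW// [X in _ * X]mulrC mulrACA -powRM ?invr_ge0 ?ltW//.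
  rewrite divff ?gt_eqF// powR1 mul1r -powRD ?subrK ?powRr1 ?ltW//.
  by rewrite gt_eqF ?implybT.
have pE : A `^ (s - 1) = A `^ s / A.
  rewrite powRB; last by rewrite (gt_eqF A0) implybT.
  by rewrite powRr1 ?ltW.
rewrite [leLHS]lE pE.
rewrite [leRHS](_ : _ = A `^ s * l `^ (1 - s) * (1 - s + s * (T / A))).
  rewrite ler_pM2l ?mulr_gt0//; apply: le_trans (powR_le_tangent s0 s1 lA0) _.
  by rewrite lerD2l ler_wpM2l// ler_pM2r ?invr_gt0.
by field; rewrite gt_eqF.
Qed.
End real_inequalities.

(** * Divergence bounds from an explicit density *)

Section divergence.
Context d (T : measurableType d) (R : realType).
Local Open Scope ereal_scope.

Lemma has_density_integralE (P Q : {measure set T -> \bar R}) (f g : T -> R) :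
  has_density P Q f -> measurable_fun [set: T] g ->
  \int[P]_x (g x)%:E = \int[Q]_x (f x * g x)%:E.
Proof.
move=> [mf f0 PQ] mg; rewrite integralE [RHS]integralE.
have mg' : measurable_fun [set: T] (fun x => (g x)%:E) by exact/measurable_EFinP.
rewrite !(ge0_integral_density mf f0 PQ)//; [|exact: measurable_funeneg|
  exact: measurable_funepos].
congr (_ - _); apply: eq_integral => x _.
  by rewrite !funeposE EFinM muleC maxe_pMr ?mule0 ?lee_fin.
by rewrite !funenegE EFinM -muleN muleC maxe_pMr ?mule0 ?lee_fin.
Qed.

(** The density chosen inside [KL] agrees with [f] almost everywhere for [Q], so the divergence is
    the integral of [f * ln f] against [Q]. It is nonnegative by [f * ln f >= f - 1], and at most
    the integral of [h] minus that of [f], which is 1; hence the budget [1 + c]. *)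
Lemma KL_bounds (P Q : {measure set T -> \bar R}) (f h : T -> R) (c : R) :
  P [set: T] = 1 -> Q [set: T] = 1 ->
  has_density P Q f -> (forall x, (0 < f x)%R) ->
  measurable_fun [set: T] h -> (forall x, (0 <= h x)%R) ->
  (forall x, (f x * ln (f x) + f x <= h x)%R) ->
  \int[Q]_x (h x)%:E <= (1 + c)%:E ->
  0 <= KL P Q <= c%:E.
Proof.
move=> P1 Q1 dPQ f0 mh h0 fh hc; rewrite /KL.
have [mf _ PQ] := dPQ.
case: pselect => [H|[]]; last by exists f.
case: cid => g /= [mg g0 gPQ].
have intf : Q.-integrable [set: T] (EFin \o f).
  apply/integrableP; split; first exact/measurable_EFinP.
  under eq_integral do rewrite /= ger0_norm ?ltW//.
  by rewrite -PQ// P1 ltry.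
have fg : ae_eq Q [set: T] (EFin \o f) (EFin \o g).
  apply: integral_ae_eq => //; first exact/measurable_EFinP.
  by move=> E _ mE; rewrite -PQ// -gPQ.
have mlnf : measurable_fun [set: T] (fun x => ln (f x)).
  by apply: measurableT_comp => //; exact: measurable_ln.
have mlng : measurable_fun [set: T] (fun x => ln (g x)).
  by apply: measurableT_comp => //; exact: measurable_ln.
have mk : measurable_fun [set: T] (fun x => f x * ln (f x))%R.
  exact: measurable_funM.
rewrite (has_density_integralE dPQ mlng).
have -> : \int[Q]_x (f x * ln (g x))%:E = \int[Q]_x (f x * ln (f x))%:E.
  apply: ae_eq_integral => //.
  - by apply/measurable_EFinP; exact: measurable_funM.
  - exact/measurable_EFinP.
  - by apply: filterS fg => x /= /(_ I) [] -> _.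
have inth : Q.-integrable [set: T] (EFin \o h).
  apply/integrableP; split; first exact/measurable_EFinP.
  under eq_integral do rewrite /= ger0_norm//.
  exact: le_lt_trans hc (ltry _).
have int1 : Q.-integrable [set: T] (EFin \o cst 1%R).
  apply/integrableP; split; first exact/measurable_EFinP.
  under eq_integral do rewrite /= normr1.
  by rewrite integral_cst// Q1 mule1 ltry.
(* [h + 1] dominates [f * ln f] in absolute value: from above by [fh], from below because
   [f * ln f >= f - 1 >= -1]. *)
have intk : Q.-integrable [set: T] (fun x => (f x * ln (f x))%:E).
  apply: (le_integrable measurableT _ _ (integrableD measurableT inth int1)).
    exact/measurable_EFinP.
  move=> x _; rewrite /= lee_fin ler_norml ger0_norm ?addr_ge0//.
  have := fh x; have := xlnx_ge (f0 x); have := f0 x; have := h0 x.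
  by move=> *; apply/andP; split; lra.
have If : \int[Q]_x (f x)%:E = 1 by rewrite -PQ.
apply/andP; split.
  have <- : \int[Q]_x ((f x)%:E - 1%:E) = 0.
    by rewrite integralB// If integral_cst// Q1 mule1 subee.
  apply: le_integral => //; first exact: integrableB.
  by move=> x _; rewrite /= lee_fin xlnx_ge.
apply: (@le_trans _ _ (\int[Q]_x ((h x)%:E - (f x)%:E))).
  apply: le_integral => //; first exact: integrableB.
  by move=> x _; rewrite /= lee_fin; have := fh x; lra.
by rewrite integralB// If leeBlDr// -EFinD addrC.
Qed.

End divergence.

Section likelihood_ratio.
Context dX dY (X : measurableType dX) (Y : measurableType dY) (R : realType).
Context (mu : probability X R) (Q : probability Y R).
Local Open Scope ereal_scope.

Lemma measurable_fun_pair_left (f : X * Y -> R) : measurable_fun [set: X * Y] f ->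
  measurable_fun [set: (X * X) * Y] (fun p => f (p.1.1, p.2)).
Proof.
move=> mf; apply: (measurableT_comp mf); apply: measurable_fun_pair => //=.
exact: (measurableT_comp measurable_fst measurable_fst).
Qed.

Lemma measurable_fun_pair_right (f : X * Y -> R) : measurable_fun [set: X * Y] f ->
  measurable_fun [set: (X * X) * Y] (fun p => f (p.1.2, p.2)).
Proof.
move=> mf; apply: (measurableT_comp mf); apply: measurable_fun_pair => //=.
exact: (measurableT_comp measurable_snd measurable_fst).
Qed.

(** Cost of a pair of words, the first being the one sent. Decoding takes [V] to be a power of
    [W = L], covering takes [V = W = L]. *)
Definition pair_integral (V W : X * Y -> R) (p : X * X) : \bar R :=
  \int[Q]_y (V (p.1, y) * W (p.2, y))%:E.

Context (V W : X * Y -> R).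
Hypothesis mV : measurable_fun [set: X * Y] V.
Hypothesis mW : measurable_fun [set: X * Y] W.
Hypothesis V0 : forall p, (0 <= V p)%R.
Hypothesis W0 : forall p, (0 <= W p)%R.

Lemma measurable_pair_integral : measurable_fun [set: X * X] (pair_integral V W).
Proof.
pose f (p : (X * X) * Y) := (V (p.1.1, p.2) * W (p.1.2, p.2))%:E.
apply: (@measurable_fun_fubini_tonelli_F _ _ _ _ R Q f).
- apply/measurable_EFinP; apply: measurable_funM.
  + exact: measurable_fun_pair_left.
  + exact: measurable_fun_pair_right.
- by move=> p; rewrite lee_fin mulr_ge0.
Qed.

Lemma pair_integral_ge0 p : 0 <= pair_integral V W p.
Proof. by apply: integral_ge0 => y _; rewrite lee_fin mulr_ge0. Qed.

(** For a fixed output [y], the second word, drawn independently of the first, contributes the mean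
    of [W (x', y)], which is 1; exchanging the integrals makes it disappear. *)
Lemma integral_pair_integral : (forall y, \int[mu]_x (W (x, y))%:E = 1) ->
  \int[mu]_x \int[mu]_x' pair_integral V W (x, x') =
  \int[mu]_x \int[Q]_y (V (x, y))%:E.
Proof.
move=> W1; apply: eq_integral => x _.
pose f (p : X * Y) := (V (x, p.2) * W p)%:E.
transitivity (\int[mu]_x' \int[Q]_y f (x', y)) => //.
rewrite fubini_tonelli; last 2 first.
- apply/measurable_EFinP; apply: measurable_funM => //.
  apply: (measurableT_comp (f := fun y => V (x, y))); last exact: measurable_snd.
  exact: measurable_fun_pair2.
- by move=> p; rewrite lee_fin mulr_ge0.
apply: eq_integral => y _; rewrite /f /=.
under eq_integral do rewrite EFinM.
rewrite ge0_integralZl ?W1 ?mule1//.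
- by apply/measurable_EFinP; exact: measurable_fun_pair1.
- by move=> *; rewrite lee_fin.
- by rewrite lee_fin.
Qed.

End likelihood_ratio.

(** * Errors of likelihood decoding *)

Section decoding.
Context dX dY (X : measurableType dX) (Y : measurableType dY) (R : realType).
Context (mu : probability X R) (Q : probability Y R) (L : X * Y -> R).
Hypothesis mL : measurable_fun [set: X * Y] L.
Hypothesis L0 : forall p, 0 < L p.
Context (s : R).
Hypothesis s0 : 0 < s.
Hypothesis s1 : s < 1.
Local Open Scope ereal_scope.

Lemma measurable_L_powR t : measurable_fun [set: X * Y] (fun p => (L p `^ t)%R).
Proof. exact: (measurableT_comp (measurable_powR t) mL). Qed.

(** Only words with the same key compete, since the receiver knows the key. Ties count as confusion,
    so the event covers the errors of likelihood decoding under any tie-breaking rule. *)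
Definition confused a b (c : 'I_a * 'I_b -> X) (j : 'I_a * 'I_b) : set Y :=
  [set y | exists2 m, m != j.1 & (L (c j, y) <= L (c (m, j.2), y))%R].

Lemma measurable_confused a b (c : 'I_a * 'I_b -> X) j :
  measurable (confused c j).
Proof.
rewrite (_ : confused c j = \bigcup_(m in [set m | m != j.1])
    [set y | (L (c j, y) <= L (c (m, j.2), y))%R]); last first.
  by apply/seteqP; split => y /= [m ? ?]; exists m.
apply: fin_bigcup_measurable => [|m _]; first exact: finite_finset.
have -> : [set y | (L (c j, y) <= L (c (m, j.2), y))%R] =
    (fun y => (L (c j, y) <= L (c (m, j.2), y))%R) @^-1` [set true].
  by apply/seteqP; split.
rewrite -[X in measurable X]setTI; apply: measurable_fun_ler => //;
  exact: measurable_fun_pair2.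
Qed.

(** On the confusion event the ratio of the sent word is at most the sum [T] of those of its
    competitors, so [decoding_indicator_le] turns the event into single and pairwise costs. The
    tangent point is [a] because fewer than [a] words compete and each has mean ratio 1: both terms
    then average to multiples of the same power of [a]. *)
Lemma decoding_cost_le a b (c : 'I_a * 'I_b -> X) j :
  \int[Q]_(y in confused c j) (L (c j, y))%:E <=
  ((1 - s) * a%:R `^ s)%:E * \int[Q]_y (L (c j, y) `^ (1 - s))%:E +
  \sum_(l : 'I_a * 'I_b | l != j) (if l.2 == j.2 then (s * a%:R `^ (s - 1))%:E *
     pair_integral Q (fun p => L p `^ (1 - s))%R L (c j, c l) else 0).
Proof.
have a0 : (0 < a%:R :> R)%R by rewrite ltr0n; case: a c j => // c [[]].
have mj x : measurable_fun [set: Y] (fun y => L (x, y)) by exact: measurable_fun_pair2.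
have mpj x t : measurable_fun [set: Y] (fun y => L (x, y) `^ t)%R.
  exact: (measurableT_comp (measurable_powR t) (mj x)).
rewrite -ge0_integralZl//; last 3 first.
- exact/measurable_EFinP.
- by move=> y _; rewrite lee_fin powR_ge0.
- by rewrite lee_fin mulr_ge0 ?powR_ge0 ?subr_ge0 ?ltW.
pose g l y := if (l != j) && (l.2 == j.2) then
  (s * a%:R `^ (s - 1) * L (c j, y) `^ (1 - s) * L (c l, y))%R else 0%R.
have mg l : measurable_fun [set: Y] (g l).
  rewrite /g; case: (_ && _); last exact: measurable_cst.
  by apply: measurable_funM => //; apply: measurable_funM.
have g0 l y : (0 <= g l y)%R.
  by rewrite /g; case: ifP => // _; rewrite !mulr_ge0 ?powR_ge0 ?ltW.
have gE l : (if l != j then if l.2 == j.2 then (s * a%:R `^ (s - 1))%:E *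
    pair_integral Q (fun p => L p `^ (1 - s))%R L (c j, c l) else 0 else 0) =
    \int[Q]_y (g l y)%:E.
  rewrite /g; case: (l != j); last by rewrite integral0.
  case: (l.2 == j.2) => /=; last by rewrite integral0.
  rewrite -ge0_integralZl//.
  - by apply: eq_integral => y _; rewrite -EFinM mulrA.
  - by apply/measurable_EFinP; exact: measurable_funM.
  - by move=> y _; rewrite lee_fin mulr_ge0 ?powR_ge0 ?ltW.
  - by rewrite lee_fin mulr_ge0 ?powR_ge0 ?ltW.
rewrite big_mkcond; under eq_bigr do rewrite gE.
rewrite -(@ge0_integral_sum _ _ _ Q _ measurableT _ (fun l y => (g l y)%:E))//; last 2 first.
- by move=> l; exact/measurable_EFinP.
- by move=> l y _; rewrite lee_fin.
rewrite -ge0_integralD//; last 4 first.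
- by move=> y _; rewrite -EFinM lee_fin !mulr_ge0 ?powR_ge0 ?subr_ge0 ?ltW.
- by apply/measurable_EFinP; exact: measurable_funM.
- by move=> y _; apply: sume_ge0 => l _; rewrite lee_fin.
- by apply: emeasurable_sum => l; exact/measurable_EFinP.
rewrite [leLHS]integral_mkcond.
apply: ge0_le_integral => //.
- by move=> y _; rewrite patchE; case: ifP => _ //; rewrite lee_fin ltW.
- apply/(measurable_restrictT _ _).1; first exact: measurable_confused.
  by apply/measurable_EFinP; exact: measurable_funTS.
- apply: emeasurable_funD.
    by apply/measurable_EFinP; exact: measurable_funM.
  by apply: emeasurable_sum => l; exact/measurable_EFinP.
move=> y _; rewrite patchE; case: ifPn; last first.
  move=> _; apply: adde_ge0; last by apply: sume_ge0 => l _; rewrite lee_fin.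
  by rewrite -EFinM lee_fin !mulr_ge0 ?powR_ge0 ?subr_ge0 ?ltW.
rewrite inE => -[m mj1 Lle]; rewrite sumEFin -EFinM -EFinD lee_fin.
pose T := (\sum_(l : 'I_a * 'I_b | (l != j) && (l.2 == j.2)) L (c l, y))%R.
have -> : (\sum_l g l y =
    s * a%:R `^ (s - 1) * L (c j, y) `^ (1 - s) * T)%R.
  by rewrite /T mulr_sumr [RHS]big_mkcond.
apply: decoding_indicator_le => //; [exact: ltW|exact: ltW|].
apply: le_trans Lle _.
rewrite /T (bigD1 (m, j.2))/= ?eqxx ?andbT; last first.
  by apply: contra mj1 => /eqP <-.
by rewrite lerDl sumr_ge0// => l _; exact: ltW.
Qed.

End decoding.

(** * Output statistics of a codebook *)

Section resolvability.
Context dX dY (X : measurableType dX) (Y : measurableType dY) (R : realType).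
Context (mu : probability X R) (Q : probability Y R) (L : X * Y -> R).
Hypothesis mL : measurable_fun [set: X * Y] L.
Hypothesis L0 : forall p, 0 < L p.
Hypothesis L1 : forall x, (\int[Q]_y (L (x, y))%:E = 1)%E.
Context (s : R).
Hypothesis s0 : 0 < s.
Hypothesis s1 : s < 1.
Context (J : finType) (c : J -> X).
Hypothesis J0 : (0 < #|J|)%N.

Let M : R := #|J|%:R.
Let M0 : 0 < M. Proof. by rewrite ltr0n. Qed.

Definition mixture (y : Y) : R := M^-1 * \sum_j L (c j, y).

(** Expand [mixture * (ln mixture + 1)] over the words and, for word [j], split the mixture inside
    the logarithm into the term of [j] and the rest: [ln_addr_le] gives this summand. Over random
    words the rest has mean just below 1, which is the unit subtracted in the divergence bound. *)
Definition covering_cost (y : Y) : R :=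
  M^-1 * \sum_j L (c j, y) *
    ((L (c j, y) / M) `^ s / s + M^-1 * \sum_(l | l != j) L (c l, y)).

Lemma mixture_gt0 y : 0 < mixture y.
Proof.
have /card_gt0P[j0 _] := J0.
rewrite mulr_gt0 ?invr_gt0// (bigD1 j0)//= ltr_wpDr//.
by apply: sumr_ge0 => j _; exact: ltW.
Qed.

Lemma measurable_mixture : measurable_fun [set: Y] mixture.
Proof.
apply: measurable_funM => //; apply: measurable_sum => j.
exact: measurable_fun_pair2.
Qed.

Lemma integral_mixture : (\int[Q]_y (mixture y)%:E = 1)%E.
Proof.
have mLx x : measurable_fun [set: Y] (fun y => (L (x, y))%:E).
  by apply/measurable_EFinP; exact: measurable_fun_pair2.
under eq_integral do rewrite EFinM -sumEFin.
rewrite ge0_integralZl//; last 3 first.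
- by apply: emeasurable_sum.
- by move=> y _; apply: sume_ge0 => j _; rewrite lee_fin ltW.
- by rewrite lee_fin invr_ge0 ltW.
rewrite ge0_integral_sum//; last by move=> j y _; rewrite lee_fin ltW.
under eq_bigr do rewrite L1.
by rewrite sumEFin sumr_const -EFinM mulVf// gt_eqF.
Qed.

Lemma mixture_le_covering_cost y :
  mixture y * ln (mixture y) + mixture y <= covering_cost y.
Proof.
rewrite -[X in _ + X]mulr1 -mulrDr {1}/mixture /covering_cost -mulrA.
rewrite ler_pM2l ?invr_gt0// mulr_suml; apply: ler_sum => j _.
rewrite ler_pM2l//.
have -> : mixture y = L (c j, y) / M + M^-1 * \sum_(l | l != j) L (c l, y).
  by rewrite /mixture (bigD1 j)//= mulrDr [_^-1 * _]mulrC.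
apply: ln_addr_le => //; first exact: ltW.
  by rewrite divr_gt0.
by rewrite mulr_ge0 ?invr_ge0 ?(ltW M0)//; apply: sumr_ge0 => l _; exact: ltW.
Qed.

Lemma covering_cost_ge0 y : 0 <= covering_cost y.
Proof.
rewrite mulr_ge0 ?invr_ge0 ?(ltW M0)//; apply: sumr_ge0 => j _.
rewrite mulr_ge0 ?(ltW (L0 _))// addr_ge0 ?divr_ge0 ?powR_ge0 ?(ltW s0)//.
by rewrite mulr_ge0 ?invr_ge0 ?(ltW M0)//; apply: sumr_ge0 => l _; exact: ltW.
Qed.

Lemma measurable_covering_cost : measurable_fun [set: Y] covering_cost.
Proof.
have mLx x : measurable_fun [set: Y] (fun y => L (x, y)).
  exact: measurable_fun_pair2.
apply: measurable_funM => //; apply: measurable_sum => j.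
apply: measurable_funM => //; apply: measurable_funD.
  apply: measurable_funM => //.
  apply: (measurableT_comp (measurable_powR s)).
  exact: measurable_funM.
by apply: measurable_funM => //; under eq_fun do rewrite big_mkcond;
  apply: measurable_sum => l; case: (l != j).
Qed.

(** Integrate [covering_cost + 1 >= 2 * mixture], which follows from [u * ln u >= u - 1]; the
    mixture has integral 1. Written with sums, the inequality has nonnegative integrands only. *)
Lemma covering_cost_ge1 : (1 <= \int[Q]_y (covering_cost y)%:E)%E.
Proof.
have mc : measurable_fun [set: Y] (fun y => (covering_cost y)%:E).
  by apply/measurable_EFinP; exact: measurable_covering_cost.
have mm : measurable_fun [set: Y] (fun y => (mixture y)%:E).
  by apply/measurable_EFinP; exact: measurable_mixture.
have m0 y : (0 <= (mixture y)%:E)%E by rewrite lee_fin ltW// mixture_gt0.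
have c0 y : (0 <= (covering_cost y)%:E)%E by rewrite lee_fin covering_cost_ge0.
have : (\int[Q]_y ((mixture y)%:E + (mixture y)%:E) <=
    \int[Q]_y ((covering_cost y)%:E + 1))%E.
  apply: ge0_le_integral => //.
  - by move=> y _; exact: adde_ge0.
  - exact: emeasurable_funD.
  - exact: emeasurable_funD.
  - move=> y _; rewrite -!EFinD lee_fin.
    have := mixture_le_covering_cost y; have := xlnx_ge (mixture_gt0 y).
    by move: (_ * ln _) => u; lra.
rewrite !ge0_integralD//.
by rewrite integral_mixture integral_cst_probability leeD2rE.
Qed.

(** Brings the cost into the shape that [select_pairwise] handles: single costs plus costs of
    ordered pairs. *)
Lemma integral_covering_cost : (\int[Q]_y (covering_cost y)%:E =
  (M^-1)%:E * \sum_j ((M `^ (- s) / s)%:E * \int[Q]_y (L (c j, y) `^ (1 + s))%:E +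
    \sum_(l | l != j) (M^-1)%:E * pair_integral Q L L (c j, c l)))%E.
Proof.
have mLx x : measurable_fun [set: Y] (fun y => L (x, y)).
  exact: measurable_fun_pair2.
have mpx x t : measurable_fun [set: Y] (fun y => L (x, y) `^ t).
  exact: (measurableT_comp (measurable_powR t)).
pose g j l y := if l != j then M^-1 * (L (c j, y) * L (c l, y)) else 0.
have mg j l : measurable_fun [set: Y] (g j l).
  rewrite /g; case: (l != j); last exact: measurable_cst.
  by apply: measurable_funM => //; apply: measurable_funM.
have g0 j l y : 0 <= g j l y.
  by rewrite /g; case: (l != j); rewrite// !mulr_ge0 ?invr_ge0 ?ltW.
have gE j l : ((if l != j then (M^-1)%:E * pair_integral Q L L (c j, c l)
    else 0) = \int[Q]_y (g j l y)%:E)%E.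
  rewrite /g; case: (l != j); last by rewrite integral0.
  rewrite -ge0_integralZl//.
  - by apply/measurable_EFinP; exact: measurable_funM.
  - by move=> y _; rewrite lee_fin mulr_ge0 ?ltW.
  - by rewrite lee_fin invr_ge0 ltW.
pose f j y := M `^ (- s) / s * L (c j, y) `^ (1 + s).
have mf j : measurable_fun [set: Y] (f j) by exact: measurable_funM.
have f0 j y : 0 <= f j y by rewrite !mulr_ge0 ?powR_ge0 ?invr_ge0 ?(ltW s0).
have fE j : ((M `^ (- s) / s)%:E * \int[Q]_y (L (c j, y) `^ (1 + s))%:E =
    \int[Q]_y (f j y)%:E)%E.
  rewrite -ge0_integralZl//.
  - exact/measurable_EFinP.
  - by move=> y _; rewrite lee_fin powR_ge0.
  - by rewrite lee_fin divr_ge0 ?powR_ge0 ?ltW.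
have fgE y : covering_cost y = M^-1 * \sum_j (f j y + \sum_l g j l y).
  congr (_ * _); apply: eq_bigr => j _; rewrite mulrDr; congr (_ + _).
    have Lp : L (c j, y) `^ (1 + s) = L (c j, y) * L (c j, y) `^ s.
      rewrite powRD; last by rewrite (gt_eqF (L0 _)) implybT.
      by rewrite powRr1// ltW.
    have Mp : M^-1 `^ s = M `^ (- s) by rewrite -powR_inv1 ?ltW// -powRrM mulN1r.
    by rewrite /f powRM ?invr_ge0 ?ltW// Lp Mp; ring.
  rewrite mulrCA !mulr_sumr big_mkcond; apply: eq_bigr => l _.
  by rewrite /g; case: ifP => _; rewrite ?mulr0.
under eq_integral do rewrite fgE EFinM.
have mfg j : measurable_fun [set: Y] (fun y => f j y + \sum_l g j l y).
  by apply: measurable_funD => //; exact: measurable_sum.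
have fg0 j y : 0 <= f j y + \sum_l g j l y by rewrite addr_ge0// sumr_ge0.
rewrite ge0_integralZl//; last 3 first.
- by apply/measurable_EFinP; exact: measurable_sum.
- by move=> y _; rewrite lee_fin sumr_ge0.
- by rewrite lee_fin invr_ge0 ltW.
congr (_ * _)%E; under eq_integral do rewrite -sumEFin.
rewrite ge0_integral_sum//; last 2 first.
- by move=> j; exact/measurable_EFinP.
- by move=> j y _; rewrite lee_fin.
apply: eq_bigr => j _; rewrite fE big_mkcond.
under [in RHS]eq_bigr do rewrite gE.
rewrite -(@ge0_integral_sum _ _ _ Q _ measurableT _ (fun l y => (g j l y)%:E))//;
  last 2 first.
- by move=> l; exact/measurable_EFinP.
- by move=> l y _; rewrite lee_fin.
rewrite -ge0_integralD//; last 4 first.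
- by move=> y _; rewrite lee_fin.
- exact/measurable_EFinP.
- by move=> y _; apply: sume_ge0 => l _; rewrite lee_fin.
- by apply: emeasurable_sum => l; exact/measurable_EFinP.
by apply: eq_integral => y _; rewrite EFinD -sumEFin.
Qed.

End resolvability.

(** * One codebook for energy, errors and divergence *)

Section random_coding.
Context dX dY dZ (X : measurableType dX) (Y : measurableType dY)
  (Z : measurableType dZ) (R : realType).
Context (mu : probability X R) (QY : probability Y R) (QZ : probability Z R).
Context (LY : X * Y -> R) (LZ : X * Z -> R).
Hypothesis mLY : measurable_fun [set: X * Y] LY.
Hypothesis mLZ : measurable_fun [set: X * Z] LZ.
Hypothesis LY0 : forall p, 0 < LY p.
Hypothesis LZ0 : forall p, 0 < LZ p.
Hypothesis LZ1 : forall x, (\int[QZ]_z (LZ (x, z))%:E = 1)%E.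
Hypothesis muLY : forall y, (\int[mu]_x (LY (x, y))%:E = 1)%E.
Hypothesis muLZ : forall z, (\int[mu]_x (LZ (x, z))%:E = 1)%E.
Context (e : X -> R).
Hypothesis me : measurable_fun [set: X] e.
Hypothesis e0 : forall x, 0 <= e x.
Hypothesis mue : (\int[mu]_x (e x)%:E <= 1)%E.
Context (s mY mZ : R).
Hypothesis s0 : 0 < s.
Hypothesis s1 : s < 1.
Hypothesis LYs :
  (\int[mu]_x \int[QY]_y (LY (x, y) `^ (1 - s))%:E <= mY%:E)%E.
Hypothesis LZs :
  (\int[mu]_x \int[QZ]_z (LZ (x, z) `^ (1 + s))%:E <= mZ%:E)%E.
Context (a b : nat).
Hypothesis a0 : (0 < a)%N.
Hypothesis b0 : (0 < b)%N.

Local Notation J := ('I_a * 'I_b)%type.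
Local Notation M := (#|{: J}|%:R : R).

Let cardJ : #|{: J}| = (a * b)%N. Proof. by rewrite card_prod !card_ord. Qed.
Let M0 : 0 < M. Proof. by rewrite ltr0n cardJ muln_gt0 a0. Qed.

(* The single functional to be selected is the energy plus [k] times the other two
   costs; the covering cost has mean at least 1, so its excess is also controlled. *)
Lemma random_coding (k : R) : 0 < k ->
  let eps := a%:R `^ s * mY + M `^ (- s) / s * mZ in
  exists c : J -> X,
  [/\ M^-1 * \sum_j e (c j) <= 1 + k * eps,
      ((M^-1)%:E * \sum_j \int[QY]_(y in confused LY c j) (LY (c j, y))%:E <=
        (k^-1 + eps)%:E)%E &
      (\int[QZ]_z (covering_cost LZ s c z)%:E <= (1 + (k^-1 + eps))%:E)%E].
Proof.
move=> k0 eps.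
have Mi0 : 0 < M^-1 by rewrite invr_gt0.
have a0' : 0 < a%:R :> R by rewrite ltr0n.
(* [k] weighs the coding costs against the energy, [M^-1] averages over the words. *)
pose kM := k * M^-1.
have kM0 : 0 < kM by exact: mulr_gt0.
pose phi x := (\int[QY]_y (LY (x, y) `^ (1 - s))%:E)%E.
pose psi x := (\int[QZ]_z (LZ (x, z) `^ (1 + s))%:E)%E.
pose al := pair_integral QY (fun p => LY p `^ (1 - s)) LY.
pose be := pair_integral QZ LZ LZ.
have mphi : measurable_fun [set: X] phi.
  apply: (@measurable_fun_fubini_tonelli_F _ _ _ _ R QY (fun p => (LY p `^ (1 - s))%:E)).
    by apply/measurable_EFinP; exact: measurable_L_powR.
  by move=> p; rewrite lee_fin powR_ge0.
have mpsi : measurable_fun [set: X] psi.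
  apply: (@measurable_fun_fubini_tonelli_F _ _ _ _ R QZ (fun p => (LZ p `^ (1 + s))%:E)).
    by apply/measurable_EFinP; exact: measurable_L_powR.
  by move=> p; rewrite lee_fin powR_ge0.
have phi0 x : (0 <= phi x)%E by apply: integral_ge0 => y _; rewrite lee_fin powR_ge0.
have psi0 x : (0 <= psi x)%E by apply: integral_ge0 => y _; rewrite lee_fin powR_ge0.
have mal : measurable_fun [set: X * X] al.
  apply: measurable_pair_integral => //; first exact: measurable_L_powR.
  - by move=> p; exact: powR_ge0.
  - by move=> p; exact: ltW.
have mbe : measurable_fun [set: X * X] be.
  by apply: measurable_pair_integral => // p; exact: ltW.
have al0 p : (0 <= al p)%E.
  by apply: pair_integral_ge0 => q; rewrite ?powR_ge0 ?ltW.
have be0 p : (0 <= be p)%E by apply: pair_integral_ge0 => q; rewrite ltW.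
have alE : (\int[mu]_x \int[mu]_x' al (x, x') = \int[mu]_x phi x)%E.
  apply: integral_pair_integral => //; first exact: measurable_L_powR.
  - by move=> p; exact: powR_ge0.
  - by move=> p; exact: ltW.
have beE : (\int[mu]_x \int[mu]_x' be (x, x') = 1)%E.
  rewrite integral_pair_integral//; last 2 first.
  - by move=> p; exact: ltW.
  - by move=> p; exact: ltW.
  by under eq_integral do rewrite LZ1; rewrite integral_cst_probability.
pose F (j : J) x := ((M^-1 * e x)%:E +
  ((kM * ((1 - s) * a%:R `^ s))%:E * phi x + (kM * (M `^ (- s) / s))%:E * psi x))%E.
(* Decoding charges a pair only when the keys agree; covering charges every pair. *)
pose w (j l : J) := (if l.2 == j.2 then (kM * (s * a%:R `^ (s - 1)))%:E else 0)%E.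
pose H (j l : J) p := (w j l * al p + (kM * M^-1)%:E * be p)%E.
have c10 : 0 <= kM * ((1 - s) * a%:R `^ s).
  by rewrite !mulr_ge0 ?powR_ge0 ?subr_ge0 ?ltW.
have c20 : 0 <= kM * (M `^ (- s) / s) by rewrite !mulr_ge0 ?powR_ge0 ?invr_ge0 ?ltW.
have c30 : 0 <= kM * (s * a%:R `^ (s - 1)) by rewrite !mulr_ge0 ?powR_ge0 ?ltW.
have c40 : 0 <= kM * M^-1 by rewrite mulr_ge0 ?ltW.
have mme : measurable_fun [set: X] (fun x => (M^-1 * e x)%:E).
  by apply/measurable_EFinP; exact: measurable_funM.
have me0 x : (0 <= (M^-1 * e x)%:E)%E by rewrite lee_fin mulr_ge0// ltW.
have cphi0 x : (0 <= (kM * ((1 - s) * a%:R `^ s))%:E * phi x)%E.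
  by rewrite mule_ge0.
have cpsi0 x : (0 <= (kM * (M `^ (- s) / s))%:E * psi x)%E.
  by rewrite mule_ge0.
have mcphi : measurable_fun [set: X] (fun x => (kM * ((1 - s) * a%:R `^ s))%:E * phi x)%E.
  exact: measurable_funeM.
have mcpsi : measurable_fun [set: X] (fun x => (kM * (M `^ (- s) / s))%:E * psi x)%E.
  exact: measurable_funeM.
have w0 j l : (0 <= w j l)%E by rewrite /w; case: ifP.
have mwal j l : measurable_fun [set: X * X] (fun p => w j l * al p)%E.
  exact: measurable_funeM.
have mwbe : measurable_fun [set: X * X] (fun p => (kM * M^-1)%:E * be p)%E.
  exact: measurable_funeM.
have [||||c hc] := @select_pairwise _ X R mu J (index_enum J) F H
    (index_enum_uniq _).
- move=> j; apply: emeasurable_funD => //; exact: emeasurable_funD.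
- by move=> j x; rewrite !adde_ge0.
- by move=> j l; exact: emeasurable_funD.
- by move=> j l p; rewrite adde_ge0 ?mule_ge0.
have phiI0 : (0 <= \int[mu]_x phi x)%E by exact: integral_ge0.
have IF j : (\int[mu]_x F j x <= (M^-1 + (kM * ((1 - s) * a%:R `^ s) * mY +
    kM * (M `^ (- s) / s) * mZ))%:E)%E.
  rewrite ge0_integralD//; last 2 first.
  - by move=> x _; exact: adde_ge0.
  - exact: emeasurable_funD.
  rewrite ge0_integralD// !ge0_integralZl// !EFinD
    (EFinM _ mY) (EFinM _ mZ).
  apply: leeD; last first.
    by apply: leeD; exact: lee_wpmul2l.
  under eq_integral do rewrite EFinM.
  have meE : measurable_fun [set: X] (fun x => (e x)%:E) by exact/measurable_EFinP.
  have e0E x : (0 <= (e x)%:E)%E by rewrite lee_fin.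
  rewrite ge0_integralZl ?lee_fin ?(ltW Mi0)//.
  by rewrite -[leRHS]mule1 lee_wpmul2l// lee_fin ltW.
have IH j l : (\int[mu]_x \int[mu]_y H j l (x, y) =
    w j l * \int[mu]_x phi x + (kM * M^-1)%:E)%E.
  transitivity (\int[mu]_x (w j l * \int[mu]_y al (x, y) +
      (kM * M^-1)%:E * \int[mu]_y be (x, y)))%E.
    apply: eq_integral => x _; rewrite ge0_integralD//.
    - rewrite !ge0_integralZl//; exact: measurable_fun_pair2.
    - by move=> y _; rewrite mule_ge0.
    - by apply: measurable_funeM; exact: measurable_fun_pair2.
    - by move=> y _; rewrite mule_ge0.
    - by apply: measurable_funeM; exact: measurable_fun_pair2.
  rewrite ge0_integralD//.
  - rewrite !ge0_integralZl//.
    + by rewrite alE beE mule1.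
    + exact: measurable_fun_fubini_tonelli_F.
    + by move=> x _; exact: integral_ge0.
    + exact: measurable_fun_fubini_tonelli_F.
    + by move=> x _; exact: integral_ge0.
  - by move=> x _; rewrite mule_ge0 ?integral_ge0.
  - by apply: measurable_funeM; exact: measurable_fun_fubini_tonelli_F.
  - by move=> x _; rewrite mule_ge0 ?integral_ge0.
  - by apply: measurable_funeM; exact: measurable_fun_fubini_tonelli_F.
have IHs (j : J) : (\sum_(l | l != j) \int[mu]_x \int[mu]_y H j l (x, y) <=
    (a%:R * (kM * (s * a%:R `^ (s - 1))) * mY + kM)%:E)%E.
  (* Including the diagonal term [l = j] gives round counts: [a] words share the key of [j], and
     there are [M] words in all. *)
  apply: (@le_trans _ _ (\sum_l (w j l * \int[mu]_x phi x + (kM * M^-1)%:E))%E).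
    rewrite [leRHS](bigID (fun l => l != j))/=.
    rewrite (eq_bigr _ (fun l _ => IH j l)) leeDl// sume_ge0// => l _.
    by rewrite adde_ge0 ?mule_ge0 ?lee_fin.
  rewrite big_split/= EFinD leeD//.
    rewrite (eq_bigr (fun l : J => if l.2 == j.2 then (kM * (s * a%:R `^ (s - 1)))%:E *
       \int[mu]_x phi x else 0)%E); last first.
      by move=> l _; rewrite /w; case: ifP => _ //; rewrite mul0e.
    rewrite -big_mkcond/=.
    rewrite -(pair_big xpredT (fun k' => k' == j.2)
      (fun (m : 'I_a) (k' : 'I_b) => (kM * (s * a%:R `^ (s - 1)))%:E * \int[mu]_x phi x)%E)/=.
    under eq_bigr do rewrite big_pred1_eq.
    apply: (@le_trans _ _ (\sum_(m < a) (kM * (s * a%:R `^ (s - 1)) * mY)%:E)%E).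
      by apply: lee_sum => m _; rewrite [leRHS]EFinM; exact: lee_wpmul2l.
    rewrite sumEFin sumr_const card_ord lee_fin le_eqVlt; apply/orP; left.
    by apply/eqP; rewrite -[LHS]mulr_natl; ring.
  rewrite sumEFin sumr_const lee_fin.
  by rewrite -[leLHS]mulr_natr divfK// gt_eqF.
pose decj j := (((1 - s) * a%:R `^ s)%:E * phi (c j) +
  \sum_(l : J | l != j) (if l.2 == j.2 then (s * a%:R `^ (s - 1))%:E *
     al (c j, c l) else 0))%E.
pose covj j := ((M `^ (- s) / s)%:E * psi (c j) +
    \sum_(l | l != j) (M^-1)%:E * be (c j, c l))%E.
have decj0 j : (0 <= decj j)%E.
  apply: adde_ge0; last first.
    by apply: sume_ge0 => l _; case: ifP => // _; rewrite mule_ge0// lee_fin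
      !mulr_ge0 ?powR_ge0 ?ltW.
  by rewrite mule_ge0// lee_fin !mulr_ge0 ?powR_ge0 ?subr_ge0 ?ltW.
have covj0 j : (0 <= covj j)%E.
  apply: adde_ge0; last first.
    by apply: sume_ge0 => l _; rewrite mule_ge0// lee_fin ltW.
  by rewrite mule_ge0// lee_fin !mulr_ge0 ?powR_ge0 ?invr_ge0 ?ltW.
have FHE j : (F j (c j) + \sum_(l | l != j) H j l (c j, c l) =
    (M^-1 * e (c j))%:E + kM%:E * (decj j + covj j))%E.
  rewrite /F -addeA; congr (_ + _)%E.
  have Ed : (kM%:E * decj j = (kM * ((1 - s) * a%:R `^ s))%:E * phi (c j) +
      \sum_(l | l != j) w j l * al (c j, c l))%E.
    have g0 l : (0 <= if l.2 == j.2 then (s * a%:R `^ (s - 1))%:E *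
        al (c j, c l) else 0)%E.
      by case: ifP => // _; rewrite mule_ge0// lee_fin !mulr_ge0 ?powR_ge0 ?ltW.
    rewrite /decj ge0_muleDr; last 2 first.
    - by rewrite mule_ge0// lee_fin !mulr_ge0 ?powR_ge0 ?subr_ge0 ?ltW.
    - by apply: sume_ge0 => l _; exact: g0.
    rewrite muleA -EFinM ge0_sume_distrr//; congr (_ + _)%E.
    apply: eq_bigr => l _; rewrite /w; case: ifP => _; last by rewrite mule0 mul0e.
    by rewrite muleA -EFinM.
  have Ec : (kM%:E * covj j = (kM * (M `^ (- s) / s))%:E * psi (c j) +
      \sum_(l | l != j) (kM * M^-1)%:E * be (c j, c l))%E.
    rewrite /covj ge0_muleDr; last 2 first.
    - by rewrite mule_ge0// lee_fin !mulr_ge0 ?powR_ge0 ?invr_ge0 ?ltW.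
    - by apply: sume_ge0 => l _; rewrite mule_ge0// lee_fin ltW.
    rewrite muleA -EFinM ge0_sume_distrr; last first.
      by move=> l _; rewrite mule_ge0// lee_fin ltW.
    by congr (_ + _)%E; apply: eq_bigr => l _; rewrite muleA -EFinM.
  by rewrite [RHS]ge0_muleDr// Ed Ec big_split/= addeACA.
pose Se := M^-1 * \sum_j e (c j).
pose De := ((M^-1)%:E * \sum_j decj j)%E.
pose Co := (\int[QZ]_z (covering_cost LZ s c z)%:E)%E.
have CoE : (Co = (M^-1)%:E * \sum_j covj j)%E.
  by apply: integral_covering_cost => //; rewrite cardJ muln_gt0 a0.
have total : (Se%:E + k%:E * (De + Co) <= (1 + (k * eps + k))%:E)%E.
  have -> : (Se%:E + k%:E * (De + Co) =
      \sum_j F j (c j) + \sum_j \sum_(l | l != j) H j l (c j, c l))%E.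
    rewrite -big_split/=; under [RHS]eq_bigr do rewrite FHE.
    rewrite big_split/= sumEFin -mulr_sumr; congr (_ + _)%E.
    rewrite -ge0_sume_distrr; last by move=> j _; exact: adde_ge0.
    rewrite big_split/= CoE -ge0_muleDr; last 2 first.
    - by apply: sume_ge0 => j _.
    - by apply: sume_ge0 => j _.
    by rewrite muleA -EFinM.
  apply: (le_trans hc).
  apply: (@le_trans _ _ (\sum_(j : J) (M^-1 + (kM * ((1 - s) * a%:R `^ s) * mY +
    kM * (M `^ (- s) / s) * mZ) +
    (a%:R * (kM * (s * a%:R `^ (s - 1))) * mY + kM))%:E)%E).
    rewrite -big_split/=; apply: lee_sum => j _.
    by rewrite [leRHS]EFinD; apply: leeD; [exact: IF|exact: IHs].
  rewrite sumEFin sumr_const lee_fin le_eqVlt; apply/orP; left; apply/eqP.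
  (* With this the single costs, of weight [1 - s], and the pair costs of the [a] words, of weight
     [s], add up to one full power [s] of [a]. *)
  have aE : a%:R `^ s = a%:R * a%:R `^ (s - 1) by rewrite mulr_powRB1 ?ler0n.
  rewrite -[LHS]mulr_natl /eps aE /kM; field.
  by rewrite !gt_eqF.
have De0 : (0 <= De)%E.
  by apply: mule_ge0; [rewrite lee_fin ltW|apply: sume_ge0 => j _].
have Co1 : (1 <= Co)%E.
  apply: (@covering_cost_ge1 _ _ X Z) => //.
  by rewrite cardJ muln_gt0 a0.
have Co0 : (0 <= Co)%E by apply: le_trans Co1.
have NyDe : De != -oo%E by rewrite -ltNye (lt_le_trans _ De0).
have NyCo : Co != -oo%E by rewrite -ltNye (lt_le_trans _ Co0).
have Se0 : 0 <= Se by rewrite mulr_ge0 ?(ltW Mi0)// sumr_ge0.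
(* The bound [total] forces both costs to be finite, and the rest is real arithmetic. *)
have Defin : De \is a fin_num.
  rewrite ge0_fin_numE//; apply: contraT; rewrite -leNgt leye_eq => /eqP DeE.
  by move: total; rewrite DeE addye// gt0_muley ?lte_fin// addey.
have Cofin : Co \is a fin_num.
  rewrite ge0_fin_numE//; apply: contraT; rewrite -leNgt leye_eq => /eqP CoE'.
  by move: total; rewrite CoE' addey// gt0_muley ?lte_fin// addey.
have [D DE] : exists D, De = D%:E by exact/EFin_fin_numP.
have [C CE] : exists C, Co = C%:E by exact/EFin_fin_numP.
move: total De0 Co1.
rewrite DE CE -(EFinD D C) -(EFinM k) -EFinD !lee_fin => total D0 C1.
have kD0 : 0 <= k * D by rewrite mulr_ge0 ?(ltW k0).
(* The covering cost alone uses up the summand [k] of [total]. The remaining [1 + k * eps] bounds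
   the energy, [k] times the error and [k] times the covering excess. *)
have kC1 : k <= k * C by rewrite ler_peMr// ltW.
exists c; split.
- rewrite -/Se; lra.
- apply: (@le_trans _ _ De).
    apply: lee_wpmul2l; first by rewrite lee_fin ltW.
    by apply: lee_sum => j _; exact: decoding_cost_le.
  rewrite DE lee_fin -(ler_pM2l k0) mulrDr divff ?gt_eqF//.
  nra.
- rewrite -/Co CE lee_fin -(ler_pM2l k0).
  have : k * k^-1 = 1 by rewrite divff// gt_eqF.
  nra.
Qed.
End random_coding.

(** * Gaussian likelihood ratios *)

Section gaussian_density.
Context (R : realType).
Implicit Types v x m t : R.

(** Indexed by the variance rather than the standard deviation, because variances add under
    convolution. *)
Definition gauss v x : R := (Num.sqrt (v * pi *+ 2))^-1 * expR (- x ^+ 2 / (v *+ 2)).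

Lemma normal_pdf_gauss m v x : 0 < v -> normal_pdf m (Num.sqrt v) x = gauss v (x - m).
Proof.
move=> v0; rewrite normal_pdfE ?gt_eqF ?sqrtr_gt0//.
by rewrite /normal_peak /normal_fun /gauss sqr_sqrtr// ltW.
Qed.

Lemma gauss_gt0 v x : 0 < v -> 0 < gauss v x.
Proof.
move=> v0; rewrite mulr_gt0 ?expR_gt0// invr_gt0 sqrtr_gt0.
by rewrite pmulrn_lgt0// mulr_gt0// pi_gt0.
Qed.

Lemma measurable_gauss v : measurable_fun [set: R] (gauss v).
Proof.
apply: measurable_funM => //; apply: measurableT_comp => //.
apply: measurable_funM => //; apply: measurableT_comp => //.
Qed.

Lemma measurable_gauss_comp d (T : measurableType d) v (f : T -> R) :
  measurable_fun [set: T] f -> measurable_fun [set: T] (fun y => gauss v (f y)).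
Proof. by move=> mf; apply: (measurableT_comp (measurable_gauss v)). Qed.

Lemma integral_gauss v m : 0 < v ->
  (\int[lebesgue_measure]_x (gauss v (x - m))%:E = 1)%E.
Proof.
move=> v0; rewrite -(integral_normal_pdf m (Num.sqrt v)).
by apply: eq_integral => x _; rewrite normal_pdf_gauss.
Qed.

(** Completing the square. With [s] the state and [x] equal to [a * s] plus noise, the joint density
    is the marginal of [x] times the conditional density of [s] given [x], centred at the linear
    estimate of [s]. *)
Lemma gauss_mul a T w x s : 0 < T -> 0 < w ->
  gauss T s * gauss w (x - a * s) =
  gauss (a ^+ 2 * T + w) x *
    gauss (T * w / (a ^+ 2 * T + w)) (s - a * T * x / (a ^+ 2 * T + w)).
Proof.
move=> T0 w0; set v := a ^+ 2 * T + w.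
have v0 : 0 < v by rewrite ltr_wpDl// mulr_ge0 ?sqr_ge0 ?ltW.
have pi0 : 0 < pi :> R := pi_gt0 R.
rewrite /gauss mulrACA [RHS]mulrACA -!expRD -!invfM -!sqrtrM; last 2 first.
- by rewrite mulrn_wge0// mulr_ge0 ?ltW// divr_gt0 ?mulr_gt0.
- by rewrite mulrn_wge0// mulr_ge0 ?ltW.
congr (_ * expR _).
- congr ((Num.sqrt _)^-1); field; exact: lt0r_neq0.
- rewrite /v; field; rewrite !lt0r_neq0//.
Qed.

Lemma integral_gauss_convolution a T w x : 0 < T -> 0 < w ->
  (\int[lebesgue_measure]_s (gauss T s * gauss w (x - a * s))%:E =
   (gauss (a ^+ 2 * T + w) x)%:E)%E.
Proof.
move=> T0 w0; set v := a ^+ 2 * T + w.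
have v0 : 0 < v by rewrite ltr_wpDl// mulr_ge0 ?sqr_ge0 ?ltW.
under eq_integral do rewrite gauss_mul// -/v EFinM.
rewrite ge0_integralZl//.
- by rewrite integral_gauss ?mule1// divr_gt0 ?mulr_gt0.
- apply/measurable_EFinP; apply: measurable_gauss_comp; exact: measurable_funB.
- by move=> y _; rewrite lee_fin ltW// gauss_gt0// divr_gt0 ?mulr_gt0.
- by rewrite lee_fin ltW// gauss_gt0.
Qed.

(** Tilting by a quadratic exponential only rescales the variance. Integrated, this is the
    chi-square transform: the inverse square root of [1 - t]. *)
Lemma expR_gauss t v x : 0 < v -> t < 1 ->
  expR (t * x ^+ 2 / (v *+ 2)) * gauss v x =
  (Num.sqrt (1 - t))^-1 * gauss (v / (1 - t)) x.
Proof.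
move=> v0 t1; have t10 : 0 < 1 - t by rewrite subr_gt0.
have pi0 : 0 < pi :> R := pi_gt0 R.
rewrite /gauss mulrCA -expRD mulrA -invfM -sqrtrM ?ltW//.
by congr ((Num.sqrt _)^-1 * expR _); field; rewrite ?lt0r_neq0.
Qed.

Lemma integral_expR_gauss t v m : 0 < v -> t < 1 ->
  (\int[lebesgue_measure]_x (expR (t * (x - m) ^+ 2 / (v *+ 2)) * gauss v (x - m))%:E =
   (Num.sqrt (1 - t))^-1%:E)%E.
Proof.
move=> v0 t1; have t10 : 0 < 1 - t by rewrite subr_gt0.
under eq_integral do rewrite expR_gauss// EFinM.
rewrite ge0_integralZl//.
- by rewrite integral_gauss ?mule1// divr_gt0.
- apply/measurable_EFinP; apply: measurable_gauss_comp; exact: measurable_funB.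
- by move=> y _; rewrite lee_fin ltW// gauss_gt0// divr_gt0.
Qed.

(* [lebesgue_measure] and [normal_prob] live on [measurableTypeR R], whose display
   differs from that of the canonical structure on [R]. *)
Definition to_realType (x : measurableTypeR R) : R := x.

Lemma measurable_to_realType : measurable_fun [set: measurableTypeR R] to_realType.
Proof. by move=> _ A mA; rewrite setTI. Qed.

HB.instance Definition _ := isMeasurableFun.Build _ _ _ _ _ measurable_to_realType.

Definition normal0 v : probability R R :=
  distribution (normal_prob (0 : R) (Num.sqrt v)) to_realType.

Lemma ge0_integral_normal0 v (f : R -> \bar R) : 0 < v ->
  measurable_fun [set: R] f -> (forall x, 0 <= f x)%E ->
  (\int[normal0 v]_x f x =
   \int[lebesgue_measure]_x (f x * (gauss v x)%:E))%E.
Proof.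
move=> v0 mf f0; rewrite ge0_integral_distribution//.
rewrite (@ge0_integral_density _ _ _ _ lebesgue_measure (normal_pdf 0 (Num.sqrt v)))//.
- by apply: eq_integral => x _; rewrite normal_pdf_gauss// subr0.
- exact: measurable_normal_pdf.
- by move=> x; exact: normal_pdf_ge0.
Qed.

Let measurable_shift (c : R) : measurable_fun [set: measurableTypeR R]
  (fun x : measurableTypeR R => x + c : measurableTypeR R).
Proof.
exact: (@measurable_funD _ (measurableTypeR R) R setT (fun x => x) (cst c)).
Qed.

Lemma lebesgue_measureD (c : R) (A : set R) : measurable A ->
  pushforward lebesgue_measure (fun x : measurableTypeR R => x + c : measurableTypeR R) A =
  lebesgue_measure A.
Proof.
move=> mA; have mc := measurable_shift c.
apply/esym/lebesgue_measure_unique => //= _ [[a b]] _ <-.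
rewrite /pushforward.
rewrite (_ : _ @^-1` _ = `]a - c, b - c]%classic); last first.
  by apply/seteqP; split => x /=; rewrite !in_itv/= ltrBlDr lerBrDr.
rewrite !lebesgue_measure_itv/= !lte_fin ltrD2r.
by rewrite -!EFinB; congr (if _ then _%:E else _); ring.
Qed.

Lemma ge0_integral_translation (c : R) (f : R -> \bar R) :
  measurable_fun [set: R] f -> (forall x, 0 <= f x)%E ->
  (\int[lebesgue_measure]_x f (x + c)%R = \int[lebesgue_measure]_x f x)%E.
Proof.
move=> mf f0.
have := @ge0_integral_pushforward _ _ (measurableTypeR R) (measurableTypeR R) R
  _ (measurable_shift c) lebesgue_measure setT f measurableT mf (fun y _ => f0 y).
rewrite preimage_setT => <-.
by apply: eq_measure_integral => A mA _; exact: lebesgue_measureD.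
Qed.

End gaussian_density.

(** * The additive Gaussian noise channel with Gaussian input *)

Section additive_gaussian_noise.
Context (R : realType) (P v : R).
Hypothesis P0 : 0 < P.
Hypothesis v0 : 0 < v.
Local Notation t := (P + v).
Let t0 : 0 < t. Proof. exact: addr_gt0. Qed.

Definition awgn_ratio (p : R * R) : R := gauss v (p.2 - p.1) / gauss t p.2.

Lemma awgn_ratio_gt0 p : 0 < awgn_ratio p.
Proof. by rewrite divr_gt0 ?gauss_gt0. Qed.

Lemma awgn_ratioE u z : awgn_ratio (u, z) * gauss t z = gauss v (z - u).
Proof. by rewrite /awgn_ratio divfK// gt_eqF// gauss_gt0. Qed.

Lemma measurable_gaussV : measurable_fun [set: R] (fun z => (gauss t z)^-1).
Proof.
have -> : (fun z => (gauss t z)^-1) = (fun z => gauss t z `^ (-1)).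
  by apply/funext => z; rewrite powR_inv1// ltW// gauss_gt0.
exact: (measurableT_comp (measurable_powR (-1)) (@measurable_gauss R t)).
Qed.

Lemma measurable_awgn_ratio : measurable_fun [set: R * R] awgn_ratio.
Proof.
apply: measurable_funM.
  by apply: measurable_gauss_comp; exact: measurable_funB.
exact: (measurableT_comp measurable_gaussV).
Qed.

Let mu : probability R R := normal0 P.
Let Q : probability R R := normal0 t.

Lemma ge0_integral_awgn_output u (f : R -> R) :
  measurable_fun [set: R] f -> (forall z, 0 <= f z) ->
  (\int[Q]_z (f z * awgn_ratio (u, z))%:E =
   \int[lebesgue_measure]_z (f z * gauss v (z - u))%:E)%E.
Proof.
move=> mf f0; rewrite ge0_integral_normal0//.
- by apply: eq_integral => z _; rewrite -EFinM -mulrA awgn_ratioE.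
- apply/measurable_EFinP; apply: measurable_funM => //.
  exact: measurable_fun_pair2 measurable_awgn_ratio.
- by move=> z; rewrite lee_fin mulr_ge0// ltW// awgn_ratio_gt0.
Qed.

Lemma integral_awgn_output u : (\int[Q]_z (awgn_ratio (u, z))%:E = 1)%E.
Proof.
under eq_integral do rewrite -[awgn_ratio _]mul1r.
rewrite ge0_integral_awgn_output//.
by under eq_integral do rewrite mul1r; exact: integral_gauss.
Qed.

(** In the variable [u], the numerator times the input density integrates by convolution to the
    output density, which is the denominator. *)
Lemma integral_awgn_input z : (\int[mu]_u (awgn_ratio (u, z))%:E = 1)%E.
Proof.
have mr : measurable_fun [set: R] (fun u => (awgn_ratio (u, z))%:E).
  by apply/measurable_EFinP; exact: measurable_fun_pair1 measurable_awgn_ratio.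
rewrite ge0_integral_normal0//; last first.
  by move=> u; rewrite lee_fin ltW// awgn_ratio_gt0.
have gz0 : 0 < (gauss t z)^-1 by rewrite invr_gt0 gauss_gt0.
transitivity (\int[lebesgue_measure]_u ((gauss t z)^-1%:E *
    (gauss P u * gauss v (z - 1 * u))%:E))%E.
  apply: eq_integral => u _; rewrite -!EFinM mul1r; congr EFin.
  by rewrite /awgn_ratio/=; ring.
rewrite ge0_integralZl//.
- rewrite integral_gauss_convolution// expr1n mul1r -EFinM mulVf//.
  by rewrite gt_eqF// gauss_gt0.
- apply/measurable_EFinP; apply: measurable_funM; first exact: measurable_gauss.
  apply: measurable_gauss_comp; apply: measurable_funB => //.
- by move=> u _; rewrite lee_fin mulr_ge0 ?ltW ?gauss_gt0.
- by rewrite lee_fin ltW.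
Qed.

(** The information density. Its constant term is the mutual information in nats; under the joint
    law each quadratic term has mean 1/2, so they cancel on average. *)
Lemma ln_awgn_ratio u z : ln (awgn_ratio (u, z)) =
  ln (t / v) / 2 + z ^+ 2 / (t *+ 2) - (z - u) ^+ 2 / (v *+ 2).
Proof.
have pi0 : 0 < pi :> R := pi_gt0 R.
apply: (@expR_inj R); rewrite lnK; last exact: awgn_ratio_gt0.
rewrite !expRD /awgn_ratio /gauss/= -[ln _ / 2]mulrC.
have -> : expR (2^-1 * ln (t / v)) = Num.sqrt (t / v).
  have tv0 : 0 < t / v by exact: divr_gt0.
  by rewrite -powR12_sqrt ?(ltW tv0)// /powR (gt_eqF tv0).
rewrite invfM -expRN mulrACA invrK.
have -> : (Num.sqrt (v * pi *+ 2))^-1 * Num.sqrt (t * pi *+ 2) = Num.sqrt (t / v).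
  rewrite -sqrtrV ?mulrn_wge0 ?mulr_ge0 ?ltW// -sqrtrM ?invr_ge0 ?mulrn_wge0 ?mulr_ge0 ?ltW//.
  by congr Num.sqrt; move: pi pi0 => q q0; field; rewrite ?lt0r_neq0.
rewrite -mulrA; congr (_ * _); rewrite mulrC; congr (expR _ * expR _).
  by rewrite mulNr opprK.
by rewrite mulNr.
Qed.

Let I := ln (t / v) / 2.

(* [L `^ s] is [expR (s * I)] times the product of two exponentials, one of the
   output and one of the noise, which AM-GM separates. *)
Lemma awgn_ratio_powR_le s u z : awgn_ratio (u, z) `^ (1 + s) <=
  expR (s * I) / 2 * (expR (2 * s * z ^+ 2 / (t *+ 2)) * awgn_ratio (u, z)) +
  expR (s * I) / 2 * (expR (- (2 * s) * (z - u) ^+ 2 / (v *+ 2)) * awgn_ratio (u, z)).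
Proof.
have r0 := awgn_ratio_gt0 (u, z).
rewrite powRD ?(gt_eqF r0) ?implybT// powRr1 ?(ltW r0)//.
set r := awgn_ratio _ in r0 *.
rewrite /powR (gt_eqF r0) ln_awgn_ratio -/I.
set A := z ^+ 2 / _; set B := (z - u) ^+ 2 / _.
rewrite -![in leRHS](mulrA _ (_ ^+ 2)) -/A -/B.
have -> : expR (s * (I + A - B)) = expR (s * I) * (expR (s * A) * expR (- s * B)).
  by rewrite -!expRD; congr expR; ring.
have -> : expR (2 * s * A) = expR (s * A) ^+ 2.
  by rewrite expr2 -expRD; congr expR; ring.
have -> : expR (- (2 * s) * B) = expR (- s * B) ^+ 2.
  by rewrite expr2 -expRD; congr expR; ring.
rewrite -subr_ge0.
rewrite (_ : _ - _ = r * (expR (s * I) / 2) * (expR (s * A) - expR (- s * B)) ^+ 2); last by field.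
by rewrite mulr_ge0 ?sqr_ge0// mulr_ge0 ?(ltW r0)// divr_ge0 ?expR_ge0.
Qed.

End additive_gaussian_noise.

Lemma ge0_integralZlD d (T : measurableType d) (R : realType)
    (m : {measure set T -> \bar R}) (c : R) (f g : T -> \bar R) : (0 <= c)%R ->
  measurable_fun [set: T] f -> measurable_fun [set: T] g ->
  (forall x, 0 <= f x)%E -> (forall x, 0 <= g x)%E ->
  (\int[m]_x (c%:E * f x + c%:E * g x) = c%:E * (\int[m]_x f x + \int[m]_x g x))%E.
Proof.
move=> c0 mf mg f0 g0.
under eq_integral do rewrite -ge0_muleDr//.
rewrite ge0_integralZl ?lee_fin//; first by rewrite ge0_integralD.
- exact: emeasurable_funD.
- by move=> x _; exact: adde_ge0.
Qed.

Section gaussian_moments.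
Context (R : realType).

(** By [w <= (1 + w ^+ 2) / 2] the inverse square roots are replaced by inverses, whose first-order
    terms cancel between [1 - x] and [1 + x]. The surviving second order, taken at [x = 2 * s], is
    the origin of the term [8 * s ^+ 2]. *)
Lemma half_sum_invsqrt_le (x : R) : - 2^-1 <= x -> x <= 2^-1 ->
  (Num.sqrt (1 - x))^-1 / 2 + (Num.sqrt (1 + x))^-1 / 2 <= expR (2 * x ^+ 2).
Proof.
move=> x1 x2.
have bound y : 0 < y -> (Num.sqrt y)^-1 <= (1 + y^-1) / 2.
  move=> y0; have -> : y^-1 = (Num.sqrt y)^-1 ^+ 2.
    by rewrite exprVn sqr_sqrtr// ltW.
  have := sqr_ge0 ((Num.sqrt y)^-1 - 1); move: (Num.sqrt y)^-1 => w; nra.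
have b1 : (Num.sqrt (1 - x))^-1 <= (1 + (1 - x)^-1) / 2 by apply: bound; lra.
have b2 : (Num.sqrt (1 + x))^-1 <= (1 + (1 + x)^-1) / 2 by apply: bound; lra.
have b3 : (1 - x)^-1 + (1 + x)^-1 <= 2 + 8 * x ^+ 2.
  have x20 : 0 < 1 - x ^+ 2 by nra.
  have -> : (1 - x)^-1 + (1 + x)^-1 = 2 / (1 - x ^+ 2).
    by field; rewrite !gt_eqF//; lra.
  rewrite ler_pdivrMr//.
  have := sqr_ge0 x; have : x ^+ 2 <= 4^-1 by nra.
  move: (x ^+ 2) => y; nra.
apply: le_trans (expR_ge1Dx _); lra.
Qed.

End gaussian_moments.

Section awgn_moment.
Context (R : realType) (P v : R).
Hypothesis P0 : 0 < P.
Hypothesis v0 : 0 < v.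
Local Notation t := (P + v).
Let t0 : 0 < t. Proof. exact: addr_gt0. Qed.
Let mu : probability R R := normal0 P.
Let Q : probability R R := normal0 t.
Local Notation r := (awgn_ratio P v).

(** After the AM-GM split both integrals are chi-square transforms. In one, averaging over the input
    leaves the output Gaussian of variance [t], with parameter [2 * s]; in the other, [z - u] is
    noise of variance [v] for each input [u], with parameter [- (2 * s)]. The receiver uses a
    negative exponent [s], the warden a positive one. *)
Lemma awgn_moment_le (s : R) : - 4^-1 <= s -> s <= 4^-1 ->
  (\int[mu]_u \int[Q]_z (r (u, z) `^ (1 + s))%:E <=
   (expR (s * (ln (t / v) / 2) + 8 * s ^+ 2))%:E)%E.
Proof.
move=> s1 s2; set I := ln (t / v) / 2.
pose c : R := expR (s * I) / 2.
have c0 : 0 <= c by rewrite divr_ge0 ?expR_ge0.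
pose f1 (z : R) : R := expR (2 * s * z ^+ 2 / (t *+ 2)).
pose f2 (u z : R) : R := expR (- (2 * s) * (z - u) ^+ 2 / (v *+ 2)).
have mr := measurable_awgn_ratio P0 v0.
have r0 p : 0 < r p by exact: awgn_ratio_gt0.
have f10 z : 0 <= f1 z by exact: expR_ge0.
have f20 u z : 0 <= f2 u z by exact: expR_ge0.
have mf1 : measurable_fun [set: R] f1.
  apply: measurableT_comp => //; apply: measurable_funM => //.
  exact: measurable_funM.
have mf2 : measurable_fun [set: R * R] (fun p => f2 p.1 p.2).
  apply: measurableT_comp => //; apply: measurable_funM => //.
  apply: measurable_funM => //; apply: measurable_funX.
  exact: measurable_funB.
have mf2u u : measurable_fun [set: R] (f2 u) by exact: measurable_fun_pair2 mf2.
pose g1 p := f1 p.2 * r p.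
pose g2 p := f2 p.1 p.2 * r p.
have mg1 : measurable_fun [set: R * R] g1.
  by apply: measurable_funM => //; apply: measurableT_comp.
have mg2 : measurable_fun [set: R * R] g2 by exact: measurable_funM.
have g10 p : 0 <= g1 p by rewrite mulr_ge0// ltW.
have g20 p : 0 <= g2 p by rewrite mulr_ge0// ltW.
have mG (g : R * R -> R) : measurable_fun [set: R * R] g -> (forall p, 0 <= g p) ->
    measurable_fun [set: R] (fun u => \int[Q]_z (g (u, z))%:E)%E.
  move=> mg g0; apply: (@measurable_fun_fubini_tonelli_F _ _ _ _ R Q (EFin \o g)).
  - exact/measurable_EFinP.
  - by move=> p; rewrite lee_fin.
have E1 : (\int[mu]_u \int[Q]_z (g1 (u, z))%:E = (Num.sqrt (1 - 2 * s))^-1%:E)%E.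
  rewrite (@fubini_tonelli _ _ _ _ R mu Q (EFin \o g1))//; last exact/measurable_EFinP.
  transitivity (\int[Q]_z (f1 z)%:E)%E.
    apply: eq_integral => z _; rewrite /g1/=.
    under eq_integral do rewrite EFinM.
    rewrite ge0_integralZl ?lee_fin//.
    - by rewrite integral_awgn_input// mule1.
    - by apply/measurable_EFinP; exact: measurable_fun_pair1 mr.
    - by move=> u _; rewrite lee_fin ltW.
  rewrite ge0_integral_normal0//; last exact/measurable_EFinP.
  have := @integral_expR_gauss R (2 * s) t 0 t0.
  move=> <-; last lra.
  by apply: eq_integral => z _; rewrite subr0.
have E2 : (\int[mu]_u \int[Q]_z (g2 (u, z))%:E = (Num.sqrt (1 + 2 * s))^-1%:E)%E.
  rewrite -[RHS](integral_cst_probability mu); apply: eq_integral => u _.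
  rewrite (@ge0_integral_awgn_output R P v P0 v0 u (f2 u))// integral_expR_gauss//; last lra.
  by rewrite opprK.
have mh : measurable_fun [set: R * R] (fun p => c * g1 p + c * g2 p).
  by apply: measurable_funD; exact: measurable_funM.
apply: (@le_trans _ _ (\int[mu]_u \int[Q]_z (c * g1 (u, z) + c * g2 (u, z))%:E)%E).
  apply: ge0_le_integral => //.
  - by move=> u _; apply: integral_ge0 => z _; rewrite lee_fin powR_ge0.
  - apply: (mG (fun p => r p `^ (1 + s))) => //; last by move=> p; exact: powR_ge0.
    exact: measurable_L_powR.
  - apply: (mG (fun p => c * g1 p + c * g2 p)) => //.
    by move=> p; rewrite addr_ge0// mulr_ge0.
  - move=> u _; apply: ge0_le_integral => //.
    + by move=> z _; rewrite lee_fin powR_ge0.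
    + apply/measurable_EFinP; apply: (measurableT_comp (measurable_powR _)).
      exact: measurable_fun_pair2 mr.
    + by apply/measurable_EFinP; exact: measurable_fun_pair2 mh.
    + by move=> z _; rewrite lee_fin awgn_ratio_powR_le.
pose G1 u := (\int[Q]_z (g1 (u, z))%:E)%E.
pose G2 u := (\int[Q]_z (g2 (u, z))%:E)%E.
have mG1 : measurable_fun [set: R] G1 by exact: mG.
have mG2 : measurable_fun [set: R] G2 by exact: mG.
have G10 u : (0 <= G1 u)%E by apply: integral_ge0 => z _; rewrite lee_fin.
have G20 u : (0 <= G2 u)%E by apply: integral_ge0 => z _; rewrite lee_fin.
have IE u : (\int[Q]_z (c * g1 (u, z) + c * g2 (u, z))%:E =
    c%:E * G1 u + c%:E * G2 u)%E.
  rewrite -ge0_muleDr//.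
  rewrite -(@ge0_integralZlD _ _ _ Q c (fun z => (g1 (u, z))%:E)
    (fun z => (g2 (u, z))%:E) c0).
  - by [].
  - by apply/measurable_EFinP; exact: (measurable_fun_pair2 u mg1).
  - by apply/measurable_EFinP; exact: (measurable_fun_pair2 u mg2).
  - by move=> z; rewrite lee_fin.
  - by move=> z; rewrite lee_fin.
rewrite (eq_integral (fun u => c%:E * G1 u + c%:E * G2 u)%E); last first.
  by move=> u _; exact: IE.
rewrite (ge0_integralZlD mu c0 mG1 mG2 G10 G20) [X in (X + _)%E]E1 [X in (_ + X)%E]E2.
rewrite -EFinD -EFinM lee_fin expRD /c -mulrA ler_pM2l ?expR_gt0//.
have := @half_sum_invsqrt_le R (2 * s).
rewrite mulrDr ![_^-1 * (Num.sqrt _)^-1]mulrC.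
have -> : 8 * s ^+ 2 = 2 * (2 * s) ^+ 2 by ring.
by apply; lra.
Qed.

End awgn_moment.

(** * Affine images and second moments of Gaussian laws *)

Section gaussian_laws.
Context (R : realType).

(** Translating the noise variable makes the output [z] the inner integration variable; exchanging
    the integrals leaves a Gaussian convolution in the state. *)
Lemma normal0_affine (a T w u : R) (A : set R) : 0 < T -> 0 < w -> measurable A ->
  ((normal0 T \x normal0 w) [set p : R * R | A (u + a * p.1 + p.2)%R] =
   \int[lebesgue_measure]_z (\1_A z * gauss (a ^+ 2 * T + w) (z - u))%:E)%E.
Proof.
move=> T0 w0 mA; set B := [set p | _].
pose phi (p : R * R) := u + a * p.1 + p.2.
have mphi : measurable_fun [set: R * R] phi.
  apply: measurable_funD => //; apply: measurable_funD => //.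
  exact: measurable_funM.
have mB : measurable B by rewrite -[B]setTI; exact: mphi.
have m1A : measurable_fun [set: R] (\1_A : R -> R) by exact: measurable_indic.
pose k (p : R * R) : R := gauss T p.1 * (\1_A p.2 * gauss w (p.2 - (u + a * p.1))).
have mk1 : measurable_fun [set: R * R]
    (fun p => \1_A p.2 * gauss w (p.2 - (u + a * p.1)) : R).
  apply: measurable_funM; first exact: (measurableT_comp m1A measurable_snd).
  apply: measurable_gauss_comp; apply: measurable_funB => //.
  apply: measurable_funD => //; exact: measurable_funM.
have k10 p : 0 <= \1_A p.2 * gauss w (p.2 - (u + a * p.1)).
  by rewrite mulr_ge0// ltW// gauss_gt0.
have mk : measurable_fun [set: R * R] k.
  apply: measurable_funM => //.
  exact: (measurableT_comp (@measurable_gauss R T) measurable_fst).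
have k0 p : 0 <= k p by rewrite mulr_ge0// ltW// gauss_gt0.
have mEs s : measurable_fun [set: R]
    (fun z => (\1_A z * gauss w (z - (u + a * s)) : R)%:E).
  by apply/measurable_EFinP; exact: (measurable_fun_pair2 s mk1).
have mkE : measurable_fun [set: R * R] (EFin \o k) by exact/measurable_EFinP.
pose TR := measurableTypeR R.
pose leb : {sigma_finite_measure set TR -> \bar R} := lebesgue_measure.
transitivity (\int[normal0 T \x normal0 w]_p (\1_B p : R)%:E)%E.
  by rewrite (integral_indic _ measurableT mB) setIT.
rewrite fubini_tonelli1//; last exact/measurable_EFinP/measurable_indic.
transitivity (\int[normal0 T]_s \int[leb]_z
    (\1_A z * gauss w (z - (u + a * s)))%:E)%E.
  apply: eq_integral => s _.
  have mBs : measurable_fun [set: R] (fun n => (\1_B (s, n) : R)%:E).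
    by apply/measurable_EFinP; exact: (measurable_fun_pair2 s (measurable_indic mB)).
  have Bs0 n : (0 <= (\1_B (s, n) : R)%:E)%E by rewrite lee_fin.
  rewrite /fubini_F (ge0_integral_normal0 w0 mBs Bs0).
  rewrite -(@ge0_integral_translation R (u + a * s)
    (fun z => (\1_A z * gauss w (z - (u + a * s)))%:E)); last 2 first.
  - exact: mEs.
  - by move=> z; rewrite lee_fin (k10 (s, z)).
  apply: eq_integral => n _; rewrite -EFinM addrK; congr ((_ * gauss _ _)%:E).
  rewrite !indicE; congr ((_ : bool)%:R).
  by apply/idP/idP; rewrite !inE /B/= [n + _]addrC.
rewrite ge0_integral_normal0//; last 2 first.
- apply: (@measurable_fun_fubini_tonelli_F _ _ TR TR R leb
    (fun p => (\1_A p.2 * gauss w (p.2 - (u + a * p.1)))%:E)).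
    exact/measurable_EFinP.
  by move=> p; rewrite lee_fin.
- by move=> s; apply: integral_ge0 => z _; rewrite lee_fin (k10 (s, z)).
transitivity (\int[leb]_s \int[leb]_z (k (s, z))%:E)%E.
  apply: eq_integral => s _; rewrite muleC -ge0_integralZl//.
  - exact: mEs.
  - by move=> z _; rewrite lee_fin (k10 (s, z)).
  - by rewrite lee_fin ltW// gauss_gt0.
rewrite (@fubini_tonelli _ _ TR TR R leb leb (EFin \o k))//.
apply: eq_integral => z _.
have v0 : 0 < a ^+ 2 * T + w by rewrite ltr_wpDl// mulr_ge0 ?sqr_ge0 ?ltW.
transitivity (\int[leb]_s ((\1_A z : R)%:E *
    (gauss T s * gauss w (z - u - a * s))%:E))%E.
  by apply: eq_integral => s _; rewrite -EFinM /k/= opprD addrA mulrCA.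
rewrite ge0_integralZl//.
- by rewrite integral_gauss_convolution// EFinM.
- have : measurable_fun [set: R] (fun s => (gauss T s * gauss w (z - u - a * s))%:E).
    apply/measurable_EFinP; apply: measurable_funM; first exact: measurable_gauss.
    apply: measurable_gauss_comp; apply: measurable_funB => //.
  exact.
- by move=> s _; rewrite lee_fin mulr_ge0 ?ltW ?gauss_gt0.
Qed.

Lemma ge0_integral_opp (f : R -> \bar R) :
  measurable_fun [set: R] f -> (forall x, 0 <= f x)%E ->
  (\int[lebesgue_measure]_x f (- x)%R = \int[lebesgue_measure]_x f x)%E.
Proof.
move=> mf f0.
have mN : measurable_fun [set: measurableTypeR R]
    (-%R : measurableTypeR R -> measurableTypeR R).
  exact: oppr_measurable.
have := @ge0_integral_pushforward _ _ (measurableTypeR R) (measurableTypeR R) R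
  _ mN lebesgue_measure setT f measurableT mf (fun y _ => f0 y).
rewrite preimage_setT => <-.
by apply: eq_measure_integral => A mA _; exact: lebesgue_measureN.
Qed.

(** Deduced from the exponential moment: [1 + y <= expR y] at [y = l * x ^+ 2 / (v *+ 2)] bounds the
    second moment by [v / (1 - l)], and [l] may be taken arbitrarily small. *)
Lemma normal0_second_moment (v : R) : 0 < v ->
  (\int[normal0 v]_x (x ^+ 2)%:E <= v%:E)%E.
Proof.
move=> v0.
have msq : measurable_fun [set: R] (fun x : R => (x ^+ 2)%:E).
  by apply/measurable_EFinP; exact: measurable_funX.
have bound (l : R) : 0 < l -> l < 1 ->
    (\int[normal0 v]_x (x ^+ 2)%:E <= (v / (1 - l))%:E)%E.
  move=> l0 l1.
  have c0 : 0 < v *+ 2 / l by rewrite divr_gt0// pmulrn_lgt0.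
  have me : measurable_fun [set: R] (fun x : R => (expR (l * x ^+ 2 / (v *+ 2)))%:E).
    apply/measurable_EFinP; apply: measurableT_comp => //.
    by apply: measurable_funM => //; exact: measurable_funM.
  have e1 : (\int[normal0 v]_x (expR (l * x ^+ 2 / (v *+ 2)))%:E =
      (Num.sqrt (1 - l))^-1%:E)%E.
    have ge x : (0 <= (expR (l * x ^+ 2 / (v *+ 2)))%:E)%E by rewrite lee_fin expR_ge0.
    rewrite (ge0_integral_normal0 v0 me ge) -(@integral_expR_gauss R l v 0 v0 l1).
    by apply: eq_integral => x _; rewrite subr0.
  have : (\int[normal0 v]_x (1 + (v *+ 2 / l)^-1%:E * (x ^+ 2)%:E) <=
      \int[normal0 v]_x (expR (l * x ^+ 2 / (v *+ 2)))%:E)%E.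
    apply: ge0_le_integral => //.
    - by move=> x _; rewrite -EFinM -EFinD lee_fin addr_ge0// mulr_ge0 ?sqr_ge0// invr_ge0 ltW.
    - by apply: emeasurable_funD => //; exact: measurable_funeM.
    - move=> x _; rewrite -EFinM -EFinD lee_fin.
      apply: le_trans (expR_ge1Dx _); rewrite lerD2l le_eqVlt; apply/orP; left.
      by apply/eqP; field; rewrite ?lt0r_neq0.
  rewrite e1 ge0_integralD//; last 2 first.
  - by move=> x _; rewrite -EFinM lee_fin mulr_ge0 ?sqr_ge0// invr_ge0 ltW.
  - exact: measurable_funeM.
  rewrite integral_cst_probability ge0_integralZl//; last 2 first.
  - by move=> x _; rewrite lee_fin sqr_ge0.
  - by rewrite lee_fin invr_ge0 ltW.
  have : (0 <= \int[normal0 v]_x (x ^+ 2)%:E)%E.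
    by apply: integral_ge0 => x _; rewrite lee_fin sqr_ge0.
  case: (integral _ _ _) => [m| |]//; last first.
    by rewrite gt0_muley ?lte_fin ?invr_gt0// addey.
  rewrite -EFinM -EFinD !lee_fin => m0 h.
  have y0 : 0 < 1 - l by rewrite subr_gt0.
  have hw : (Num.sqrt (1 - l))^-1 <= (1 + (1 - l)^-1) / 2.
    have -> : (1 - l)^-1 = (Num.sqrt (1 - l))^-1 ^+ 2.
      by rewrite exprVn sqr_sqrtr// ltW.
    have := sqr_ge0 ((Num.sqrt (1 - l))^-1 - 1).
    move: (Num.sqrt (1 - l))^-1 => w; nra.
  have : (v *+ 2 / l)^-1 * m <= (1 + (1 - l)^-1) / 2 - 1 by lra.
  rewrite mulrC ler_pdivrMr// => {}h.
  apply: (le_trans h); rewrite le_eqVlt; apply/orP; left; apply/eqP.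
  by field; rewrite ?lt0r_neq0.
(* The choice [l = e / (v + e)] makes [v / (1 - l)] equal to [v + e]. *)
apply/lee_addgt0Pr => e e0.
have l1 : e / (v + e) < 1 by rewrite ltr_pdivrMr ?addr_gt0// mul1r ltrDr.
have l0 : 0 < e / (v + e) by rewrite divr_gt0// addr_gt0.
apply: (le_trans (bound _ l0 l1)); rewrite -EFinD lee_fin.
have -> : v / (1 - e / (v + e)) = v + e by field; rewrite ?lt0r_neq0//; lra.
by [].
Qed.

(** The law is symmetric, and the integrands at [x] and [- x] average to [u ^+ 2 + g ^+ 2 * x ^+ 2].
    The cross term disappears without any integral of a signed function. *)
Lemma normal0_affine_second_moment (v u g : R) : 0 < v ->
  (\int[normal0 v]_x ((u - g * x) ^+ 2)%:E <= (u ^+ 2 + g ^+ 2 * v)%:E)%E.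
Proof.
move=> v0.
have mf (c : R) : measurable_fun [set: R] (fun x : R => ((u - c * x) ^+ 2)%:E).
  apply/measurable_EFinP; apply: measurable_funX; apply: measurable_funB => //.
have f0 (c : R) x : (0 <= ((u - c * x) ^+ 2)%:E)%E by rewrite lee_fin sqr_ge0.
have sym : (\int[normal0 v]_x ((u - g * x) ^+ 2)%:E =
    \int[normal0 v]_x ((u - (- g) * x) ^+ 2)%:E)%E.
  have mfg : measurable_fun [set: R]
      (fun x => ((u - g * x) ^+ 2)%:E * (gauss v x)%:E)%E.
    by apply: emeasurable_funM => //; apply/measurable_EFinP; exact: measurable_gauss.
  have fg0 x : (0 <= ((u - g * x) ^+ 2)%:E * (gauss v x)%:E)%E.
    by rewrite mule_ge0// lee_fin ltW// gauss_gt0.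
  rewrite (ge0_integral_normal0 v0 (mf g) (f0 g)).
  rewrite (ge0_integral_normal0 v0 (mf (- g)) (f0 (- g))).
  rewrite -(ge0_integral_opp mfg fg0).
  apply: eq_integral => x _.
  have -> : gauss v (- x) = gauss v x by rewrite /gauss sqrrN.
  by rewrite mulrN mulNr.
have msq : measurable_fun [set: R] (fun x : R => (x ^+ 2)%:E).
  by apply/measurable_EFinP; exact: measurable_funX.
have sq0 (x : R) : (0 <= (x ^+ 2)%:E)%E by rewrite lee_fin sqr_ge0.
have c0 : 0 <= 2 * g ^+ 2 by rewrite mulr_ge0 ?sqr_ge0.
have : (\int[normal0 v]_x ((u - g * x) ^+ 2)%:E +
    \int[normal0 v]_x ((u - g * x) ^+ 2)%:E <= (2 * (u ^+ 2 + g ^+ 2 * v))%:E)%E.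
  rewrite {2}sym -ge0_integralD//.
  have -> : (\int[normal0 v]_x (((u - g * x) ^+ 2)%:E + ((u - - g * x) ^+ 2)%:E) =
      \int[normal0 v]_x ((2 * u ^+ 2)%:E + (2 * g ^+ 2)%:E * (x ^+ 2)%:E))%E.
    by apply: eq_integral => x _; rewrite -EFinM -!EFinD; congr EFin; ring.
  have k1 (x : R) : (0 <= (2 * g ^+ 2)%:E * (x ^+ 2)%:E)%E.
    by rewrite mule_ge0 ?lee_fin ?sqr_ge0.
  have k2 : (0 <= (2 * u ^+ 2)%:E)%E by rewrite lee_fin mulr_ge0 ?sqr_ge0.
  have mk : measurable_fun [set: R] (fun x : R => (2 * g ^+ 2)%:E * (x ^+ 2)%:E)%E.
    exact: measurable_funeM.
  rewrite ge0_integralD//.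
  rewrite integral_cst_probability ge0_integralZl ?lee_fin//.
  rewrite mulrDr EFinD leeD2l// mulrA [leRHS]EFinM lee_wpmul2l ?lee_fin//.
  exact: normal0_second_moment.
have : (0 <= \int[normal0 v]_x ((u - g * x) ^+ 2)%:E)%E by exact: integral_ge0.
case: (integral _ _ _) => [m| |]//; rewrite -EFinD !lee_fin; lra.
Qed.
End gaussian_laws.

(** * Laws of memoryless channel outputs *)

Section density_measure.
Context d (T : measurableType d) (R : realType) (Q : {measure set T -> \bar R})
  (f : T -> R).
Hypothesis mf : measurable_fun [set: T] f.
Hypothesis f0 : forall x, 0 <= f x.
Local Open Scope ereal_scope.

(** Packaged as a measure so that uniqueness on boxes can compare it with the law of an output. *)
Definition density_measure (A : set T) : \bar R := \int[Q]_(x in A) (f x)%:E.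

Let density_measure0 : density_measure set0 = 0.
Proof. exact: integral_set0. Qed.

Let density_measure_ge0 A : 0 <= density_measure A.
Proof. by apply: integral_ge0 => x _; rewrite lee_fin. Qed.

Let density_measure_sigma_additive : semi_sigma_additive density_measure.
Proof.
move=> F mF tF mUF; rewrite /density_measure ge0_integral_bigcup//.
- by apply: is_cvg_ereal_nneg_natsum_cond => n _ _; exact: density_measure_ge0.
- by apply/measurable_EFinP; exact: measurable_funTS.
- by move=> x _; rewrite lee_fin.
Qed.

HB.instance Definition _ := isMeasure.Build _ _ _ density_measure
  density_measure0 density_measure_ge0 density_measure_sigma_additive.

Definition measure_of_density : {measure set T -> \bar R} := density_measure.

End density_measure.

Section law.
Context d d' (T : measurableType d) (U : measurableType d') (R : realType).
Context (P : probability T R) (f : T -> U) (mf : measurable_fun [set: T] f).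

Let f_isMeasurableFun := isMeasurableFun.Build _ _ _ _ _ mf.
Let f_mfun : {mfun T >-> U} := HB.pack f f_isMeasurableFun.

Definition law : probability U R := distribution P f_mfun.

Lemma lawE A : law A = P (f @^-1` A).
Proof. by []. Qed.

End law.

Section product_ratio.
Context dX dY (X : measurableType dX) (Y : measurableType dY) (R : realType).
Context (mu : probability X R) (Q : probability Y R) (L : X * Y -> R).
Hypothesis mL : measurable_fun [set: X * Y] L.
Hypothesis L0 : forall p, 0 < L p.

Definition product_ratio n (p : n.-tuple X * n.-tuple Y) : R :=
  \prod_(i < n) L (tnth p.1 i, tnth p.2 i).

Lemma product_ratio_gt0 n (p : n.-tuple X * n.-tuple Y) : 0 < product_ratio p.
Proof. exact: prodr_gt0. Qed.

Lemma measurable_product_ratio n :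
  measurable_fun [set: n.-tuple X * n.-tuple Y] (@product_ratio n).
Proof.
apply: measurable_prod => i _; apply: (measurableT_comp mL).
apply: measurable_fun_pair.
  exact: (measurableT_comp (measurable_tnth i) measurable_fst).
exact: (measurableT_comp (measurable_tnth i) measurable_snd).
Qed.

Let mL1 x : measurable_fun [set: Y] (fun y => (L (x, y))%:E).
Proof. by apply/measurable_EFinP; exact: measurable_fun_pair2. Qed.

Let mL2 y : measurable_fun [set: X] (fun x => (L (x, y))%:E).
Proof. by apply/measurable_EFinP; exact: measurable_fun_pair1. Qed.

Lemma integral_product_ratio_output n (x : n.-tuple X) :
  (forall x, \int[Q]_y (L (x, y))%:E = 1)%E ->
  (\int[pow_prob Q n]_y (product_ratio (x, y))%:E = 1)%E.
Proof.
move=> L1; under eq_integral do rewrite /product_ratio -prodEFin.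
rewrite (ge0_integral_pow_prob_prod Q (h := fun i y => (L (tnth x i, y))%:E))//=.
- by rewrite big1.
- by move=> i y; rewrite lee_fin ltW.
Qed.

Lemma integral_product_ratio_input n (y : n.-tuple Y) :
  (forall y, \int[mu]_x (L (x, y))%:E = 1)%E ->
  (\int[pow_prob mu n]_x (product_ratio (x, y))%:E = 1)%E.
Proof.
move=> L1; under eq_integral do rewrite /product_ratio -prodEFin.
rewrite (ge0_integral_pow_prob_prod mu (h := fun i x => (L (x, tnth y i))%:E))//=.
- by rewrite big1.
- by move=> i x; rewrite lee_fin ltW.
Qed.

Lemma product_ratio_moment_le n t m :
  (\int[mu]_x \int[Q]_y (L (x, y) `^ t)%:E <= m%:E)%E ->
  (\int[pow_prob mu n]_x \int[pow_prob Q n]_y (product_ratio (x, y) `^ t)%:E <=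
    (m ^+ n)%:E)%E.
Proof.
move=> Lm; pose g x := (\int[Q]_y (L (x, y) `^ t)%:E)%E.
have mLt : measurable_fun [set: X * Y] (fun p => L p `^ t).
  exact: measurable_L_powR.
have g0 x : (0 <= g x)%E by apply: integral_ge0 => y _; rewrite lee_fin powR_ge0.
have mg : measurable_fun [set: X] g.
  apply: (@measurable_fun_fubini_tonelli_F _ _ _ _ R Q (fun p => (L p `^ t)%:E)).
    exact/measurable_EFinP.
  by move=> p; rewrite lee_fin powR_ge0.
have powE (p : n.-tuple X * n.-tuple Y) :
    product_ratio p `^ t = \prod_(i < n) L (tnth p.1 i, tnth p.2 i) `^ t.
  rewrite /product_ratio; elim: (index_enum _) => [|i s IH].
    by rewrite !big_nil powR1.
  by rewrite !big_cons powRM ?ltW ?prodr_gt0// IH.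
have -> : (\int[pow_prob mu n]_x \int[pow_prob Q n]_y (product_ratio (x, y) `^ t)%:E =
    \int[pow_prob mu n]_x \prod_(i < n) g (tnth x i))%E.
  apply: eq_integral => x _; under eq_integral do rewrite powE -prodEFin.
  rewrite (ge0_integral_pow_prob_prod Q (h := fun i y => (L (tnth x i, y) `^ t)%:E))//=.
  - by move=> i; apply/measurable_EFinP; exact: (measurable_fun_pair2 (tnth x i) mLt).
  - by move=> i y; rewrite lee_fin powR_ge0.
rewrite (ge0_integral_pow_prob_prod mu (h := fun=> g))//=.
have : (0 <= \int[mu]_x g x)%E by exact: integral_ge0.
move: Lm; rewrite -/g.
case: (integral _ _ _) => [r| |]//; rewrite !lee_fin => rm r0.
by rewrite prodEFin prodr_const card_ord lee_fin lerXn2r// nnegrE// (le_trans r0).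
Qed.

End product_ratio.

Section product_channel.
Context dW dY (W : measurableType dW) (Y : measurableType dY) (R : realType).
Context (pi_ : probability W R) (Q : probability Y R).

(** Memorylessness: the single-letter densities multiply. Both sides are measures in [A] and agree
    on boxes, where everything factors. *)
Lemma pow_prob_pushforward n (phi : 'I_n -> W -> Y) (f : 'I_n -> Y -> R) :
  (forall i, measurable_fun [set: W] (phi i)) ->
  (forall i, measurable_fun [set: Y] (f i)) -> (forall i y, 0 <= f i y) ->
  (forall i A, measurable A ->
     pi_ (phi i @^-1` A) = \int[Q]_(y in A) (f i y)%:E)%E ->
  forall A, measurable A ->
  (pow_prob pi_ n ((fun t => [tuple phi i (tnth t i) | i < n]) @^-1` A) =
   \int[pow_prob Q n]_(y in A) (\prod_(i < n) f i (tnth y i))%:E)%E.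
Proof.
move=> mphi mf f0 phif.
pose Phi (t : n.-tuple W) : n.-tuple Y := [tuple phi i (tnth t i) | i < n].
have mPhi : measurable_fun [set: n.-tuple W] Phi.
  apply/measurable_fun_tnthP => i.
  rewrite (_ : _ \o _ = (fun t => phi i (tnth t i))).
    exact: (measurableT_comp (mphi i) (measurable_tnth i)).
  by apply/funext => t /=; rewrite tnth_mktuple.
pose F (y : n.-tuple Y) := \prod_(i < n) f i (tnth y i).
have mF : measurable_fun [set: n.-tuple Y] F.
  apply: measurable_prod => i _.
  exact: (measurableT_comp (mf i) (measurable_tnth i)).
have F0 y : 0 <= F y by exact: prodr_ge0.
move=> A mA; rewrite -[LHS](lawE _ mPhi).
apply: (@tuple_measure_unique _ Y measurable n _ _ _ R (law (pow_prob pi_ n) mPhi)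
  (measure_of_density (pow_prob Q n) mF F0)) => //.
- by rewrite sigma_algebra_id//; exact: sigma_algebra_measurable.
- by move=> B C mB mC; exact: measurableI.
- move=> B mB.
  have PhiB : Phi @^-1` box B = box (fun i => phi i @^-1` B i).
    apply/seteqP; split => t /= h i; last by rewrite tnth_mktuple; exact: h.
    by have := h i; rewrite tnth_mktuple.
  apply: (@etrans _ _ (pow_prob pi_ n (box (fun i => phi i @^-1` B i)))).
    by rewrite -PhiB.
  rewrite pow_prob_box; last by move=> i; rewrite -[X in measurable X]setTI; exact: mphi.
  under eq_bigr => i _ do rewrite phif//.
  rewrite [RHS]integral_mkcond.
  transitivity (\int[pow_prob Q n]_y \prod_(i < n)
      (\1_(B i) (tnth y i) * f i (tnth y i))%:E)%E.
    rewrite (ge0_integral_pow_prob_prod Q (h := fun i y => (\1_(B i) y * f i y)%:E)).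
    + apply: eq_bigr => i _; rewrite integral_mkcond; apply: eq_integral => y _.
      by rewrite patchE indicE; case: ifP; rewrite ?mul1r ?mul0r.
    + move=> i; apply/measurable_EFinP; apply: measurable_funM; last exact: mf.
      exact: measurable_indic.
    + by move=> i y; rewrite lee_fin mulr_ge0.
  apply: eq_integral => y _; rewrite prodEFin big_split/= patchE.
  case: ifPn => [|nB].
    rewrite inE => By; rewrite big1 ?mul1r// => i _.
    by rewrite indicE mem_set//; exact: By.
  have [i nBi] : exists i, ~ B i (tnth y i).
    by apply/existsNP => h; move/negP: nB; apply; rewrite inE.
  by rewrite (bigD1 i)//= indicE memNset// !mul0r.
- by rewrite (le_lt_trans (probability_le1 _ _)) ?ltry.
Qed.
End product_channel.

Section measure_law.
Context d d' (T : measurableType d) (U : measurableType d') (R : realType).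
Context (m : {measure set T -> \bar R}) (f : T -> U) (mf : measurable_fun [set: T] f).

(** For arbitrary measures, unlike [law]: it is applied to a probability restricted to an event. *)
Definition measure_law : {measure set U -> \bar R}.
Proof. by unshelve refine (pushforward m f : {measure set U -> \bar R}). Defined.

Lemma measure_lawE A : measure_law A = m (f @^-1` A).
Proof. by []. Qed.

Lemma integral_measure_law (g : U -> \bar R) :
  measurable_fun [set: U] g -> (forall y, 0 <= g y)%E ->
  (\int[measure_law]_y g y = \int[m]_x g (f x))%E.
Proof.
move=> mg g0; rewrite -[LHS]/(\int[pushforward m f]_y g y)%E.
by rewrite (@ge0_integral_pushforward _ _ T U R f mf m setT g).
Qed.

End measure_law.

Section partition.
Context d (T : measurableType d) (R : realType) (P : {measure set T -> \bar R}).
Context (J : finType) (j : T -> J).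
Hypothesis mj : forall i, measurable (j @^-1` [set i]).
Local Open Scope ereal_scope.

Lemma ge0_integral_partition (f : T -> \bar R) :
  measurable_fun [set: T] f -> (forall x, 0 <= f x) ->
  \int[P]_x f x = \sum_(i : J) \int[P]_(x in j @^-1` [set i]) f x.
Proof.
move=> mf f0.
under [RHS]eq_bigr do rewrite integral_mkcond.
rewrite -(@ge0_integral_sum _ _ _ P _ measurableT _ (fun i => f \_ (j @^-1` [set i]))).
- apply: eq_integral => x _; rewrite (bigD1 (j x))//= big1.
    by rewrite adde0 patchE mem_set.
  move=> i ij; rewrite patchE memNset// => /= jx.
  by move: ij; rewrite jx eqxx.
- by move=> i; apply/(measurable_restrictT _ (mj i)); exact: measurable_funTS.
- by move=> i x _; rewrite patchE; case: ifP.
Qed.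

Lemma measure_partition (A : set T) : measurable A ->
  P A = \sum_(i : J) P (j @^-1` [set i] `&` A).
Proof.
move=> mA; transitivity (\int[P]_x (\1_A x : R)%:E).
  by rewrite (integral_indic _ measurableT mA) setIT.
rewrite ge0_integral_partition.
- by apply: eq_bigr => i _; rewrite (integral_indic _ (mj i) mA) setIC.
- exact/measurable_EFinP/measurable_indic.
- by move=> x; rewrite lee_fin.
Qed.

End partition.

Section joint_law.
Context d (O : measurableType d) (R : realType) (P : probability O R).
Context (E : set O) (mE : measurable E) (n : nat) (S N : 'I_n -> O -> R).
Hypothesis mS : forall i, measurable_fun [set: O] (S i).
Hypothesis mN : forall i, measurable_fun [set: O] (N i).
Context (pS pN : probability R R).
Hypothesis indep : forall As An : 'I_n -> set R,
  (forall i, measurable (As i)) -> (forall i, measurable (An i)) ->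
  (P (E `&` \bigcap_i (S i @^-1` As i) `&` \bigcap_i (N i @^-1` An i)) =
   P E * \prod_(i < n) pS (As i) * \prod_(i < n) pN (An i))%E.

Definition joint (w : O) : n.-tuple (R * R) := [tuple (S i w, N i w) | i < n].

Lemma measurable_joint : measurable_fun [set: O] joint.
Proof.
apply/measurable_fun_tnthP => i.
rewrite (_ : _ \o _ = (fun w => (S i w, N i w))); first exact: measurable_fun_pair.
by apply/funext => w /=; rewrite tnth_mktuple.
Qed.

Let rectangles := [set C : set (R * R) |
  exists A B, [/\ measurable A, measurable B & C = A `*` B]].

(** Independence is given on product events only. As finite measures in [A], the image of [P]
    restricted to [E] and the scaled power law agree on boxes whose sides are rectangles, hence
    everywhere. *)
Lemma joint_law A : measurable A ->
  (P (E `&` joint @^-1` A) = P E * pow_prob (pS \x pN) n A)%E.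
Proof.
move=> mA.
have PE0 : 0 <= fine (P E) by apply: fine_ge0.
have PEE : (fine (P E))%:E = P E by rewrite fineK// fin_num_measure.
pose m1 := measure_law (mrestr P mE) measurable_joint.
pose m2 := mscale (NngNum PE0) (pow_prob (pS \x pN)%E n).
have -> : (P (E `&` joint @^-1` A) = m1 A)%E by rewrite setIC.
have m2E B : m2 B = (P E * pow_prob (pS \x pN) n B)%E by rewrite -PEE.
rewrite -m2E.
apply: (@tuple_measure_unique _ (R * R)%type rectangles n _ _ _ R m1 m2) => //.
- rewrite measurable_prod_measurableType; congr (<<s _ >>).
  apply/seteqP; split => [C [A1 mA1 [B1 mB1 <-]]|C [A1 [B1 [mA1 mB1 ->]]]].
    by exists A1, B1.
  by exists A1 => //; exists B1.
- by exists setT, setT; split => //; rewrite setXTT.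
- move=> _ _ [A1 [B1 [mA1 mB1 ->]]] [A2 [B2 [mA2 mB2 ->]]].
  exists (A1 `&` A2), (B1 `&` B2); split; [exact: measurableI..|].
  by apply/seteqP; split => -[x y] /= [] [] ? ? [] ? ?.
- move=> C rC.
  have {rC}/choice[F HF] i : exists AB : set R * set R,
      [/\ measurable AB.1, measurable AB.2 & C i = AB.1 `*` AB.2].
    by have [A1 [B1 H]] := rC i; exists (A1, B1).
  have CE i : C i = (F i).1 `*` (F i).2 by have [] := HF i.
  have mF1 i : measurable (F i).1 by have [] := HF i.
  have mF2 i : measurable (F i).2 by have [] := HF i.
  have mC i : measurable (C i) by rewrite CE; exact: measurableX.
  rewrite [RHS]m2E pow_prob_box//.
  transitivity (P (E `&` \bigcap_i (S i @^-1` (F i).1) `&`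
      \bigcap_i (N i @^-1` (F i).2))).
    rewrite /m1 measure_lawE /mrestr; congr (P _); apply/seteqP; split => w /=.
      move=> [h Ew]; split; first split => // i _ /=.
        by have := h i; rewrite CE tnth_mktuple => -[].
      by move=> i _ /=; have := h i; rewrite CE tnth_mktuple => -[].
    by move=> [[Ew h1] h2]; split => // i; rewrite CE tnth_mktuple; split;
      [exact: h1|exact: h2].
  rewrite indep// -muleA; congr (_ * _)%E.
  rewrite -big_split/=; apply: eq_bigr => i _.
  by rewrite CE product_measure1E.
- rewrite /m1 measure_lawE preimage_setT -[X in (X < _)%E]/(P (setT `&` E)) setTI.
  by rewrite (le_lt_trans (probability_le1 P mE)) ?ltry.
Qed.

Lemma ge0_integral_marginal (f : R -> \bar R) (i : 'I_n) :
  measurable_fun [set: R] f -> (forall x, 0 <= f x)%E ->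
  (\int[P]_(w in E) f (S i w) = P E * \int[pS]_x f x)%E.
Proof.
move=> mf f0.
have PE0 : 0 <= fine (P E) by apply: fine_ge0.
have PEE : (fine (P E))%:E = P E by rewrite fineK// fin_num_measure.
have mfS : measurable_fun [set: O] (fun w => f (S i w)).
  exact: (measurableT_comp mf (mS i)).
transitivity (\int[measure_law (mrestr P mE) (mS i)]_x f x)%E.
  rewrite integral_measure_law//.
  rewrite (@ge0_integral_density _ _ _ (mrestr P mE) P (\1_E))//.
  - rewrite [LHS]integral_mkcond; apply: eq_integral => w _.
    by rewrite patchE indicE; case: ifP; rewrite ?mule1 ?mule0.
  - move=> A mA; rewrite integral_indic// /mrestr setIC.
    by congr (P _); exact: setIC.
rewrite -PEE -[RHS](@ge0_integral_mscale _ _ _ pS setT measurableT (NngNum PE0) f)//.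
apply: eq_measure_integral => A mA _.
transitivity (P E * pS A)%E; last by rewrite -{1}PEE.
pose As j := if j == i then A else setT.
have -> : (pS A = \prod_(l < n) pS (As l))%E.
  rewrite (bigD1 i)//= /As eqxx big1 ?mule1// => l /negbTE ->.
  exact: probability_setT.
have indepS := indep (As := As) (An := fun=> setT).
rewrite -[RHS]mule1 -{2}(_ : \prod_(l < n) pN setT = 1)%E; last first.
  by rewrite big1// => l _; exact: probability_setT.
rewrite -indepS//; last by move=> l; rewrite /As; case: ifP.
congr (P _); apply/seteqP; split => w /=.
  move=> [Aw Ew]; split=> //; split=> // l _ /=.
  by rewrite /As; case: eqP => [->|].
move=> [[Ew h] _]; split => //.
by have := h i Logic.I; rewrite /= /As eqxx.
Qed.

End joint_law.

Lemma mule_prod_setT (R : realType) n (p q : probability R R) (x : \bar R) :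
  (x * \prod_(l < n) p setT * \prod_(l < n) q setT = x)%E.
Proof.
have e (r : probability R R) : (\prod_(l < n) r setT = 1)%E.
  by apply: big1 => l _; exact: probability_setT.
by rewrite (e p) (e q) !mule1.
Qed.

(** * Channel outputs given the message and the key *)

Section output_law.
Context d (O : measurableType d) (R : realType) (P : probability O R).
Context (J : finType) (j : O -> J).
Hypothesis mj : forall i, measurable (j @^-1` [set i]).
Local Notation M := (#|J|%:R : R).
Hypothesis J0 : (0 < #|J|)%N.
Context (n : nat) (S N : 'I_n -> O -> R) (T w g Ps v : R).
Hypothesis mS : forall i, measurable_fun [set: O] (S i).
Hypothesis mN : forall i, measurable_fun [set: O] (N i).
Hypothesis T0 : 0 < T.
Hypothesis w0 : 0 < w.
Hypothesis Ps0 : 0 < Ps.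
Hypothesis vE : v = (1 - g) ^+ 2 * T + w.
Hypothesis PvE : Ps + v = T + w.
Hypothesis indep : forall i (As An : 'I_n -> set R),
  (forall l, measurable (As l)) -> (forall l, measurable (An l)) ->
  (P (j @^-1` [set i] `&` \bigcap_l (S l @^-1` As l) `&` \bigcap_l (N l @^-1` An l)) =
   (M^-1)%:E * \prod_(l < n) normal0 T (As l) * \prod_(l < n) normal0 w (An l))%E.

Let v0 : 0 < v. Proof. by rewrite vE ltr_wpDl// mulr_ge0 ?sqr_ge0 ?ltW. Qed.
Let M0 : 0 < M. Proof. by rewrite ltr0n. Qed.

Lemma prob_index i : P (j @^-1` [set i]) = (M^-1)%:E.
Proof.
have := @indep i (fun=> setT) (fun=> setT) (fun=> measurableT) (fun=> measurableT).
move=> h; rewrite -(etrans h (mule_prod_setT n (normal0 T) (normal0 w) _)).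
by congr (P _); apply/seteqP; split => x /=; [move=> xi; split|move=> [[]]].
Qed.

Let indepE i (As An : 'I_n -> set R) :
  (forall l, measurable (As l)) -> (forall l, measurable (An l)) ->
  (P (j @^-1` [set i] `&` \bigcap_l (S l @^-1` As l) `&` \bigcap_l (N l @^-1` An l)) =
   P (j @^-1` [set i]) * \prod_(l < n) normal0 T (As l) * \prod_(l < n) normal0 w (An l))%E.
Proof. by move=> mA mB; rewrite prob_index indep. Qed.

Lemma memoryless_output_law i (phi : 'I_n -> R * R -> R) (q : probability R R)
    (f : 'I_n -> R -> R) A :
  (forall l, measurable_fun [set: R * R] (phi l)) ->
  (forall l, measurable_fun [set: R] (f l)) -> (forall l y, 0 <= f l y) ->
  (forall l B, measurable B ->
     (normal0 T \x normal0 w) (phi l @^-1` B) = \int[q]_(y in B) (f l y)%:E)%E ->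
  measurable A ->
  (P (j @^-1` [set i] `&` (fun o => [tuple phi l (S l o, N l o) | l < n]) @^-1` A) =
   (M^-1)%:E * \int[pow_prob q n]_(y in A) (\prod_(l < n) f l (tnth y l))%:E)%E.
Proof.
move=> mphi mf f0 phif mA.
pose Phi (t : n.-tuple (R * R)) : n.-tuple R := [tuple phi l (tnth t l) | l < n].
have mPhi : measurable_fun [set: n.-tuple (R * R)] Phi.
  apply/measurable_fun_tnthP => l.
  rewrite (_ : _ \o _ = (fun t => phi l (tnth t l))).
    exact: (measurableT_comp (mphi l) (measurable_tnth l)).
  by apply/funext => t /=; rewrite tnth_mktuple.
rewrite -(@pow_prob_pushforward _ _ (R * R)%type R R (normal0 T \x normal0 w)%E
  q n phi f mphi mf f0 phif A mA).
rewrite -(prob_index i).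
rewrite -(@joint_law _ O R P (j @^-1` [set i]) (mj i) n S N mS mN
  (normal0 T) (normal0 w) (@indepE i)); last first.
  by rewrite -[X in measurable X]setTI; exact: mPhi.
have E o : [tuple phi l (S l o, N l o) | l < n] = Phi (joint S N o).
  by apply: eq_from_tnth => l; rewrite !tnth_mktuple.
by congr (P (_ `&` _)); apply/seteqP; split => o /=; rewrite E.
Qed.

Definition channel_output (x : n.-tuple R) (o : O) : n.-tuple R :=
  [tuple tnth x i - g * S i o + S i o + N i o | i < n].

Local Notation Q := (pow_prob (normal0 (Ps + v)) n).
Local Notation L := (@product_ratio _ _ R R R (awgn_ratio Ps v) n).

(** Each output coordinate is [tnth x l] plus [(1 - g) * S l] plus noise, so by [vE] it is Gaussian
    around the codeword with variance [v], and its density against the reference law is the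
    ratio. *)
Lemma output_law i (x : n.-tuple R) A : measurable A ->
  (P (j @^-1` [set i] `&` channel_output x @^-1` A) =
   (M^-1)%:E * \int[Q]_(y in A) (L (x, y))%:E)%E.
Proof.
move=> mA.
pose phi i (p : R * R) : R := tnth x i + (1 - g) * p.1 + p.2.
have mphi l : measurable_fun [set: R * R] (phi l).
  apply: measurable_funD => //; apply: measurable_funD => //.
  exact: measurable_funM.
have mr := measurable_awgn_ratio Ps0 v0.
have -> : channel_output x = (fun o => [tuple phi l (S l o, N l o) | l < n]).
  apply/funext => o; apply: eq_from_tnth => l; rewrite !tnth_mktuple /phi/=.
  by ring.
apply: (@memoryless_output_law i phi (normal0 (Ps + v))
  (fun l y => awgn_ratio Ps v (tnth x l, y)) A mphi _ _ _ mA).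
- by move=> l; exact: (measurable_fun_pair2 (tnth x l) mr).
- by move=> l y; exact/ltW/awgn_ratio_gt0.
- move=> l B mB; apply: (etrans (@normal0_affine R (1 - g) T w (tnth x l) B T0 w0 mB)).
  rewrite -vE [RHS]integral_mkcond.
  rewrite -(@ge0_integral_awgn_output R Ps v Ps0 v0 (tnth x l) (\1_B)).
  + apply: eq_integral => y _; rewrite patchE indicE.
    by case: ifP; rewrite ?mul1r ?mul0r.
  + exact: measurable_indic.
  + by move=> y.
Qed.

(** The identity [PvE] enters here: the idle output variance [T + w] equals [Ps + v], so the
    reference law of the likelihood ratios is what is seen without transmission. *)
Lemma idle_output_law i A : measurable A ->
  (P (j @^-1` [set i] `&` (fun o => [tuple (S l o + N l o)%R | l < n]) @^-1` A) =
   (M^-1)%:E * Q A)%E.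
Proof.
move=> mA.
pose phi (l : 'I_n) (p : R * R) : R := p.1 + p.2.
have mphi l : measurable_fun [set: R * R] (phi l) by exact: measurable_funD.
have t0 : 0 < Ps + v by exact: addr_gt0.
have law1 (l : 'I_n) B : measurable B ->
    ((normal0 T \x normal0 w) (phi l @^-1` B) =
     \int[normal0 (Ps + v)]_(y in B) (1 : R)%:E)%E.
  move=> mB.
  have -> : phi l @^-1` B = [set p | B (0 + 1 * p.1 + p.2)].
    by apply/seteqP; split => p /=; rewrite /phi add0r mul1r.
  apply: (etrans (@normal0_affine R 1 T w 0 B T0 w0 mB)).
  rewrite expr1n mul1r -PvE [RHS]integral_mkcond.
  have mB1 : measurable_fun [set: R] (fun y => (\1_B y : R)%:E).
    exact/measurable_EFinP/measurable_indic.
  have B10 y : (0 <= (\1_B y : R)%:E)%E by rewrite lee_fin.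
  transitivity (\int[normal0 (Ps + v)]_y (\1_B y : R)%:E)%E.
    rewrite (ge0_integral_normal0 t0 mB1 B10).
    by apply: eq_integral => y _; rewrite subr0 EFinM.
  by apply: eq_integral => y _; rewrite patchE indicE; case: ifP.
apply: (etrans (@memoryless_output_law i phi (normal0 (Ps + v)) (fun _ _ => 1) A
  mphi (fun=> measurable_cst _) (fun _ _ => ler01) law1 mA)).
congr (_ * _)%E; under eq_integral do rewrite big1_eq.
by rewrite integral_cst// mul1e.
Qed.

Lemma prob_channel_output (x : J -> n.-tuple R) A : measurable A ->
  measurable ((fun o => channel_output (x (j o)) o) @^-1` A) ->
  (P ((fun o => channel_output (x (j o)) o) @^-1` A) =
  \int[Q]_(y in A) (mixture L x y)%:E)%E.
Proof.
move=> mA mXA; rewrite (measure_partition P mj)//.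
have mL := @measurable_product_ratio _ _ R R R _ (measurable_awgn_ratio Ps0 v0) n.
have L0 p : 0 <= L p by apply/ltW/product_ratio_gt0 => q; exact: awgn_ratio_gt0.
under [RHS]eq_integral do rewrite /mixture EFinM -sumEFin.
have mLx i : measurable_fun A (fun y => (L (x i, y))%:E).
  apply: measurable_funTS; apply/measurable_EFinP.
  exact: (measurable_fun_pair2 (x i) mL).
have mLs : measurable_fun A (fun y => \sum_i (L (x i, y))%:E)%E.
  exact: emeasurable_sum.
have L0E i y : (0 <= (L (x i, y))%:E)%E by rewrite lee_fin.
have Ls0 y : (0 <= \sum_i (L (x i, y))%:E)%E by exact: sume_ge0.
have Mi0 : (0 <= (M^-1)%:E)%E by rewrite lee_fin invr_ge0 ltW.
rewrite (ge0_integralZl _ mA mLs (fun y _ => Ls0 y) Mi0).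
rewrite (ge0_integral_sum _ mA mLx (fun i y _ => L0E i y)).
rewrite ge0_sume_distrr; last by move=> i _; apply: integral_ge0 => y _; rewrite lee_fin.
apply: eq_bigr => i _; rewrite -(output_law i (x i) mA).
by congr (P _); apply/seteqP; split => o /= [<-].
Qed.

Lemma prob_idle_output A : measurable A ->
  measurable ((fun o => [tuple (S l o + N l o)%R | l < n]) @^-1` A) ->
  (P ((fun o => [tuple (S l o + N l o)%R | l < n]) @^-1` A) = Q A)%E.
Proof.
move=> mA mXA; rewrite (measure_partition P mj)//.
rewrite (eq_bigr _ (fun i _ => idle_output_law i mA)).
rewrite -[RHS]mul1e -ge0_sume_distrl; last by move=> i _; rewrite lee_fin invr_ge0 ltW.
congr (_ * _)%E; rewrite sumEFin sumr_const.
have e : M^-1 *+ #|J| = 1 by rewrite -[LHS]mulr_natl divff// gt_eqF.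
by rewrite -[LHS]/((M^-1 *+ #|J|)%:E) e.
Qed.

End output_law.

(** * Codes built from codebooks *)

Section codebook_code.
Context (R : realType) (n a b : nat) (a0 : (0 < a)%N).
Context (L : n.-tuple R * n.-tuple R -> R).
Hypothesis mL : measurable_fun [set: n.-tuple R * n.-tuple R] L.
Context (g : R) (U : 'I_a * 'I_b -> n.-tuple R).

Definition codebook_enc (i : 'I_n) (m : 'I_a) (k : 'I_b) (s : n.-tuple R) (w : R) : R :=
  tnth (U (m, k)) i - g * tnth s i.

(** Maximum-likelihood decoding. The default [Ordinal a0] is returned when no message is strictly
    most likely; such an output is confused for every message. *)
Definition codebook_dec (y : n.-tuple R) (k : 'I_b) : 'I_a :=
  odflt (Ordinal a0) [pick m | [forall m', (m' != m) ==>
    (L (U (m', k), y) < L (U (m, k), y))]].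

Lemma codebook_causal (i : 'I_n) (m : 'I_a) (k : 'I_b) (s s' : n.-tuple R) (w : R) :
  (forall j : 'I_n, (j <= i)%N -> tnth s j = tnth s' j) ->
  codebook_enc i m k s w = codebook_enc i m k s' w.
Proof. by move=> ss'; rewrite /codebook_enc ss'. Qed.

Lemma measurable_codebook_enc i m k :
  measurable_fun [set: n.-tuple R * R] (fun p => codebook_enc i m k p.1 p.2).
Proof.
apply: measurable_funB => //; apply: measurable_funM => //.
exact: (measurableT_comp (measurable_tnth i) measurable_fst).
Qed.

(** The decoder depends on [y] only through the finite pattern of pairwise comparisons of likelihood
    ratios, each of which is a measurable event. *)
Lemma measurable_codebook_dec k m : measurable [set y | codebook_dec y k = m].
Proof.
pose pat y : {ffun 'I_a * 'I_a -> bool} :=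
  [ffun p => L (U (p.1, k), y) < L (U (p.2, k), y)].
pose D (p : {ffun 'I_a * 'I_a -> bool}) : 'I_a :=
  odflt (Ordinal a0) [pick m | [forall m', (m' != m) ==> p (m', m)]].
have decE y : codebook_dec y k = D (pat y).
  congr odflt; apply: eq_pick => m1 /=; apply: eq_forallb => m2.
  by rewrite ffunE.
rewrite (_ : [set y | _] = \bigcup_(p in [set p | D p = m]) [set y | pat y = p]).
  apply: fin_bigcup_measurable => [|p _]; first exact: finite_finset.
  rewrite (_ : [set y | _] = \bigcap_(q in [set: 'I_a * 'I_a])
      ((fun y => L (U (q.1, k), y) < L (U (q.2, k), y)) @^-1` [set p q])).
    apply: fin_bigcap_measurable => // q _.
    rewrite -[X in measurable X]setTI; apply: measurable_fun_ltr => //;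
      [exact: (measurable_fun_pair2 (U (q.1, k)) mL)|
       exact: (measurable_fun_pair2 (U (q.2, k)) mL)].
  apply/seteqP; split => y /=; first by move=> <- q _ /=; rewrite ffunE.
  by move=> h; apply/ffunP => q; rewrite ffunE; exact: h.
apply/seteqP; split => y /=; first by move=> <-; exists (pat y).
by move=> [p <- <-].
Qed.

Definition codebook_code : ccode R n a b :=
  CCode codebook_causal measurable_codebook_enc measurable_codebook_dec.

Lemma codebook_dec_confused y m k : codebook_dec y k <> m -> confused L U (m, k) y.
Proof.
apply: contra_notP => /= nconf.
have lt m' : m' != m -> L (U (m', k), y) < L (U (m, k), y).
  by move=> m'm; rewrite ltNge; apply/negP => h; apply: nconf; exists m'.
rewrite /codebook_dec; case: pickP => [m1 /forallP /= h|/(_ m)]; last first.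
  by move/negP => []; apply/forallP => m'; apply/implyP; exact: lt.
apply/eqP; apply: contraT => m1m.
have := h m; rewrite eq_sym m1m /= => /lt_trans /(_ (lt _ m1m)).
by rewrite ltxx.
Qed.

End codebook_code.

Section gmodel_index.
Context (R : realType) (T sig2 : R) (n a b : nat) (md : gmodel T sig2 n a b).

Definition gindex (w : gO md) : 'I_a * 'I_b := (gM md w, gK md w).

Lemma gindex_preimage i :
  gindex @^-1` [set i] = gM md @^-1` [set i.1] `&` gK md @^-1` [set i.2].
Proof.
case: i => m k; apply/seteqP; split => w; rewrite /gindex/=; first by case.
by move=> [-> ->].
Qed.

Lemma measurable_gindex i : measurable (gindex @^-1` [set i]).
Proof.
by rewrite gindex_preimage; apply: measurableI; [exact: gM_meas|exact: gK_meas].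
Qed.

Lemma normal0E (v : R) (A : set R) :
  normal0 v A = normal_prob (0 : R) (Num.sqrt v) (A : set (measurableTypeR R)).
Proof. by []. Qed.

Let prob_preimageT (f : gO md -> R) : gP md (f @^-1` setT) = 1%E.
Proof. by rewrite preimage_setT; exact: probability_setT. Qed.

Let prob_M_K i : (gP md (gM md @^-1` [set i.1]) * gP md (gK md @^-1` [set i.2]) =
  ((#|{: 'I_a * 'I_b}|%:R : R)^-1)%:E)%E.
Proof.
by rewrite gM_law gK_law card_prod !card_ord natrM invfM EFinM.
Qed.

Let mule_reorderY (m k w s y z c s' y' : \bar R) : (m * k = c -> w = 1 -> s = s' ->
  y = y' -> z = 1 -> m * k * w * s * y * z = c * s' * y')%E.
Proof. by move=> -> -> -> -> ->; rewrite !mule1. Qed.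

Let mule_reorderZ (m k w s y z c s' z' : \bar R) : (m * k = c -> w = 1 -> s = s' ->
  z = z' -> y = 1 -> m * k * w * s * y * z = c * s' * z')%E.
Proof. by move=> -> -> -> -> ->; rewrite !mule1. Qed.

Lemma gmodel_indepY i (As An : 'I_n -> set R) :
  (forall l, measurable (As l)) -> (forall l, measurable (An l)) ->
  (gP md (gindex @^-1` [set i] `&` \bigcap_l (gS md l @^-1` As l)
     `&` \bigcap_l (gNY md l @^-1` An l)) =
   ((#|{: 'I_a * 'I_b}|%:R : R)^-1)%:E * \prod_(l < n) normal0 T (As l) *
     \prod_(l < n) normal0 1 (An l))%E.
Proof.
move=> mAs mAn.
have eS : (\prod_(l < n) gP md (gS md l @^-1` As l) = \prod_(l < n) normal0 T (As l))%E.
  by apply: eq_bigr => l _; rewrite normal0E; exact: gS_law.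
have eN : (\prod_(l < n) gP md (gNY md l @^-1` An l) = \prod_(l < n) normal0 1 (An l))%E.
  by apply: eq_bigr => l _; rewrite normal0E sqrtr1; exact: gNY_law.
have e1 : (\prod_(l < n) gP md (gNZ md l @^-1` setT) = 1)%E.
  by apply: big1 => l _; exact: prob_preimageT.
have h := @g_indep _ _ _ _ _ _ md [set i.1] [set i.2] setT As An (fun=> setT)
  measurableT mAs mAn (fun=> measurableT).
apply: (etrans _ (etrans h (mule_reorderY (prob_M_K i) (prob_preimageT (gW md)) eS eN e1))).
rewrite gindex_preimage; congr (gP md _).
by apply/seteqP; split => w /=; [move=> [[[]]]|move=> [[[[[]]]]]].
Qed.

Lemma gmodel_indepZ i (As An : 'I_n -> set R) :
  (forall l, measurable (As l)) -> (forall l, measurable (An l)) ->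
  (gP md (gindex @^-1` [set i] `&` \bigcap_l (gS md l @^-1` As l)
     `&` \bigcap_l (gNZ md l @^-1` An l)) =
   ((#|{: 'I_a * 'I_b}|%:R : R)^-1)%:E * \prod_(l < n) normal0 T (As l) *
     \prod_(l < n) normal0 sig2 (An l))%E.
Proof.
move=> mAs mAn.
have eS : (\prod_(l < n) gP md (gS md l @^-1` As l) = \prod_(l < n) normal0 T (As l))%E.
  by apply: eq_bigr => l _; rewrite normal0E; exact: gS_law.
have eN : (\prod_(l < n) gP md (gNZ md l @^-1` An l) = \prod_(l < n) normal0 sig2 (An l))%E.
  by apply: eq_bigr => l _; rewrite normal0E; exact: gNZ_law.
have e1 : (\prod_(l < n) gP md (gNY md l @^-1` setT) = 1)%E.
  by apply: big1 => l _; exact: prob_preimageT.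
have h := @g_indep _ _ _ _ _ _ md [set i.1] [set i.2] setT As (fun=> setT) An
  measurableT mAs (fun=> measurableT) mAn.
apply: (etrans _ (etrans h (mule_reorderZ (prob_M_K i) (prob_preimageT (gW md)) eS eN e1))).
rewrite gindex_preimage; congr (gP md _).
by apply/seteqP; split => w /=; [move=> [[[]]]|move=> [[[[[]]]]]].
Qed.

End gmodel_index.

Lemma measurable_fun_indexed d d' (O : measurableType d) (Y : measurableType d')
    (J : finType) (j : O -> J) (f : J -> O -> Y) :
  (forall i, measurable (j @^-1` [set i])) ->
  (forall i, measurable_fun [set: O] (f i)) ->
  measurable_fun [set: O] (fun o => f (j o) o).
Proof.
move=> mj mf _ A mA; rewrite setTI.
rewrite (_ : _ @^-1` _ = \bigcup_(i in [set: J]) (j @^-1` [set i] `&` f i @^-1` A)).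
  apply: fin_bigcup_measurable => // i _; apply: measurableI => //.
  by rewrite -[X in measurable X]setTI; exact: mf.
apply/seteqP; split => o /=; first by exists (j o).
by move=> [i _ [<-]].
Qed.

Lemma measurable_channel_output d (O : measurableType d) (R : realType) n
    (S N : 'I_n -> O -> R) g x :
  (forall i, measurable_fun [set: O] (S i)) ->
  (forall i, measurable_fun [set: O] (N i)) ->
  measurable_fun [set: O] (channel_output S N g x).
Proof.
move=> mS mN; apply/measurable_fun_tnthP => l.
rewrite (_ : _ \o _ = (fun o => tnth x l - g * S l o + S l o + N l o)); last first.
  by apply/funext => o /=; rewrite tnth_mktuple.
apply: measurable_funD => //; apply: measurable_funD => //.
by apply: measurable_funB => //; exact: measurable_funM.
Qed.

(** * Power, error and divergence of a codebook code *)

Section code_performance.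
Context (R : realType) (T sig2 g Ps vY vZ : R) (n a b : nat).
Hypothesis T0 : 0 < T.
Hypothesis sig20 : 0 < sig2.
Hypothesis Ps0 : 0 < Ps.
Hypothesis vYE : vY = (1 - g) ^+ 2 * T + 1.
Hypothesis vZE : vZ = (1 - g) ^+ 2 * T + sig2.
Hypothesis PvZE : Ps + vZ = T + sig2.
Hypothesis a0 : (0 < a)%N.
Hypothesis b0 : (0 < b)%N.

Let vY0 : 0 < vY. Proof. by rewrite vYE ltr_wpDl// mulr_ge0 ?sqr_ge0 ?ltW. Qed.
Let vZ0 : 0 < vZ. Proof. by rewrite vZE ltr_wpDl// mulr_ge0 ?sqr_ge0 ?ltW. Qed.

Local Notation J := ('I_a * 'I_b)%type.
Local Notation M := (#|{: J}|%:R : R).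
Local Notation LY := (@product_ratio _ _ R R R (awgn_ratio Ps vY) n).
Local Notation LZ := (@product_ratio _ _ R R R (awgn_ratio Ps vZ) n).
Local Notation QY := (pow_prob (normal0 (Ps + vY)) n).
Local Notation QZ := (pow_prob (normal0 (Ps + vZ)) n).

Let J0 : (0 < #|{: J}|)%N. Proof. by rewrite card_prod !card_ord muln_gt0 a0. Qed.

Hypothesis mLY : measurable_fun [set: n.-tuple R * n.-tuple R] LY.

Let mLZ : measurable_fun [set: n.-tuple R * n.-tuple R] LZ.
Proof.
exact: (@measurable_product_ratio _ _ R R R _ (measurable_awgn_ratio Ps0 vZ0) n).
Qed.

Let LY0 p : 0 < LY p.
Proof. by apply: product_ratio_gt0 => q; exact: awgn_ratio_gt0. Qed.

Let LZ0 p : 0 < LZ p.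
Proof. by apply: product_ratio_gt0 => q; exact: awgn_ratio_gt0. Qed.

Context (U : J -> n.-tuple R) (md : gmodel T sig2 n a b).
Local Notation code := (codebook_code a0 mLY g U).
Local Notation P := (gP md).
Local Notation j := (@gindex R T sig2 n a b md).

Let mj := @measurable_gindex R T sig2 n a b md.

Lemma codebook_cY w : cY code w = channel_output (gS md) (gNY md) g (U (j w)) w.
Proof.
apply: eq_from_tnth => i; rewrite !tnth_mktuple /cX /= /codebook_enc.
by rewrite tnth_mktuple.
Qed.

Lemma codebook_cZ w : cZ code w = channel_output (gS md) (gNZ md) g (U (j w)) w.
Proof.
apply: eq_from_tnth => i; rewrite !tnth_mktuple /cX /= /codebook_enc.
by rewrite tnth_mktuple.
Qed.

(** Given index [i], the outputs decoded wrongly are confused, and the output law has density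
    [LY (U i, y)]; the index is uniform. *)
Lemma codebook_perr_le : (code_perr code md <=
  (M^-1)%:E * \sum_i \int[QY]_(y in confused LY U i) (LY (U i, y))%:E)%E.
Proof.
pose out := channel_output (gS md) (gNY md) g.
have mout x : measurable_fun [set: gO md] (out x).
  by apply: measurable_channel_output; [exact: gS_meas|exact: gNY_meas].
pose bad i : set (n.-tuple R) := [set y | codebook_dec a0 LY U y i.2 <> i.1].
have mbad i : measurable (bad i).
  by apply: measurableC; exact: measurable_codebook_dec.
have mEb i : measurable (j @^-1` [set i] `&` out (U i) @^-1` bad i).
  apply: measurableI; first exact: mj.
  by rewrite -[X in measurable X]setTI; exact: mout.
have errE : [set w | dec code (cY code w) (gK md w) != gM md w] =
    \bigcup_(i in [set: J]) (j @^-1` [set i] `&` out (U i) @^-1` bad i).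
  have err w : [set w | dec code (cY code w) (gK md w) != gM md w] w <->
      bad (j w) (out (U (j w)) w).
    by rewrite /out -codebook_cY; split => [/eqP|h]; [|apply/eqP].
  apply/seteqP; split => w; first by move=> /err h; exists (j w); [|split].
  by move=> [i _ [wi h]]; apply/err; rewrite wi.
rewrite /code_perr errE (measure_partition P mj); last first.
  by apply: fin_bigcup_measurable => // i _; exact: mEb.
rewrite ge0_sume_distrr; last first.
  by move=> i _; apply: integral_ge0 => y _; rewrite lee_fin ltW.
apply: lee_sum => i _.
have -> : j @^-1` [set i] `&` (\bigcup_(i in [set: J]) (j @^-1` [set i] `&` out (U i) @^-1` bad i)) =
    j @^-1` [set i] `&` out (U i) @^-1` bad i.
  apply/seteqP; split => w.
    move=> [wi [i' _ [wi' bi']]]; split; first exact: wi.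
    by have <- : i' = i by rewrite -wi'.
  by move=> [wi wb]; split; [exact: wi|exists i; [|split]].
have ol := output_law mj (@gS_meas _ _ _ _ _ _ md) (@gNY_meas _ _ _ _ _ _ md)
  T0 ltr01 Ps0 vYE (@gmodel_indepY R T sig2 n a b md) i (U i) (mbad i).
rewrite [leLHS]ol; apply: lee_wpmul2l; first by rewrite lee_fin invr_ge0.
apply: ge0_subset_integral => //.
- exact: measurable_confused.
- by apply: measurable_funTS; apply/measurable_EFinP; exact: (measurable_fun_pair2 (U i) mLY).
- by move=> y _; rewrite lee_fin ltW.
- by move=> y; case: (i) => m k; exact: codebook_dec_confused.
Qed.

(** The idle output has law [QZ] and the warden's output has density [mixture] against it, so
    [KL_bounds] applies with [covering_cost] as the majorant. *)
Lemma codebook_covertness_bounds (s c : R) : 0 < s -> s < 1 ->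
  (\int[QZ]_z (covering_cost LZ s U z)%:E <= (1 + c)%:E)%E ->
  (0 <= code_covertness code md <= c%:E)%E.
Proof.
move=> s0 s1 hc.
have mZ : measurable_fun [set: gO md] (cZ code (md:=md)).
  rewrite (_ : cZ _ (md:=md) = fun w => channel_output (gS md) (gNZ md) g (U (j w)) w).
    apply: (measurable_fun_indexed (f := fun i => channel_output (gS md) (gNZ md) g (U i))) => //.
    by move=> i; apply: measurable_channel_output; [exact: gS_meas|exact: gNZ_meas].
  by apply/funext => w; exact: codebook_cZ.
have mZ0 : measurable_fun [set: gO md] (@cZ0 R T sig2 n a b md).
  apply/measurable_fun_tnthP => l.
  rewrite (_ : _ \o _ = (fun o => gS md l o + gNZ md l o)).
    by apply: measurable_funD; [exact: gS_meas|exact: gNZ_meas].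
  by apply/funext => o /=; rewrite tnth_mktuple.
pose PZ := law (gP md) mZ; pose PZ0 := law (gP md) mZ0.
have mpre (f : gO md -> n.-tuple R) A : measurable_fun [set: gO md] f ->
    measurable A -> measurable (f @^-1` A).
  by move=> mf mA; rewrite -[X in measurable X]setTI; exact: mf.
have PZ0E A : measurable A -> PZ0 A = QZ A.
  move=> mA; exact: (prob_idle_output mj J0 (@gS_meas _ _ _ _ _ _ md)
    (@gNZ_meas _ _ _ _ _ _ md) T0 sig20 Ps0 vZE PvZE
    (@gmodel_indepZ R T sig2 n a b md) mA (mpre _ _ mZ0 mA)).
have PZ0_int (f : n.-tuple R -> \bar R) A : measurable A ->
    (\int[PZ0]_(z in A) f z = \int[QZ]_(z in A) f z)%E.
  by move=> mA; apply: eq_measure_integral => B mB _; exact: PZ0E.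
have cZE : cZ code (md:=md) =
    fun w => channel_output (gS md) (gNZ md) g (U (j w)) w.
  by apply/funext => w; exact: codebook_cZ.
have PZE A : measurable A -> PZ A = (\int[PZ0]_(z in A) (mixture LZ U z)%:E)%E.
  move=> mA; rewrite PZ0_int//.
  have mXA := mpre _ _ mZ mA; rewrite cZE in mXA.
  apply: etrans (prob_channel_output mj J0 (@gS_meas _ _ _ _ _ _ md)
    (@gNZ_meas _ _ _ _ _ _ md) T0 sig20 Ps0 vZE
    (@gmodel_indepZ R T sig2 n a b md) mA mXA).
  by rewrite -cZE.
apply: (@KL_bounds _ _ R PZ PZ0 (mixture LZ U) (covering_cost LZ s U) c).
- exact: probability_setT.
- exact: probability_setT.
- split => //.
  + exact: measurable_mixture.
  + by move=> z; apply/ltW/mixture_gt0.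
- by move=> z; apply: mixture_gt0.
- exact: measurable_covering_cost.
- by move=> z; apply: covering_cost_ge0.
- by move=> z; apply: mixture_le_covering_cost.
- by rewrite PZ0_int.
Qed.

(** Given the index the word is constant and the state is centred with variance [T], so the
    cancellation adds [g ^+ 2 * T] to the energy of the word. *)
Lemma codebook_power_le : (code_power code md <=
  (M^-1 * \sum_i (n%:R^-1 * \sum_(l < n) tnth (U i) l ^+ 2) + g ^+ 2 * T)%:E)%E.
Proof.
have M0 : 0 < M by rewrite ltr0n.
pose x l i w : R := (tnth (U i) l - g * gS md l w) ^+ 2.
have mx l i : measurable_fun [set: gO md] (x l i).
  apply: measurable_funX; apply: measurable_funB => //.
  by apply: measurable_funM => //; exact: gS_meas.
pose f i w : R := n%:R^-1 * \sum_(l < n) x l i w.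
have mf i : measurable_fun [set: gO md] (f i).
  by apply: measurable_funM => //; exact: measurable_sum.
have f0 i w : 0 <= f i w.
  by rewrite mulr_ge0 ?invr_ge0// sumr_ge0// => l _; exact: sqr_ge0.
have -> : code_power code md = (\int[gP md]_w (f (j w) w)%:E)%E.
  apply: eq_integral => w _; congr (_ * _)%:E; apply: eq_bigr => l _.
  by rewrite /cX /= /codebook_enc tnth_mktuple.
have mfj : measurable_fun [set: gO md] (fun w => (f (j w) w)%:E).
  by apply/measurable_EFinP; exact: (measurable_fun_indexed mj mf).
rewrite (ge0_integral_partition (gP md) mj mfj); last by move=> w; rewrite lee_fin.
have bound i : (\int[gP md]_(w in j @^-1` [set i]) (f (j w) w)%:E <=
    (M^-1 * (n%:R^-1 * \sum_(l < n) tnth (U i) l ^+ 2 + g ^+ 2 * T))%:E)%E.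
  have PE : gP md (j @^-1` [set i]) = (M^-1)%:E.
    exact: (prob_index (@gmodel_indepY R T sig2 n a b md) i).
  have indepE (As An : 'I_n -> set R) :
      (forall l, measurable (As l)) -> (forall l, measurable (An l)) ->
      (gP md (j @^-1` [set i] `&` \bigcap_l (gS md l @^-1` As l)
        `&` \bigcap_l (gNY md l @^-1` An l)) = gP md (j @^-1` [set i]) *
      \prod_(l < n) normal0 T (As l) * \prod_(l < n) normal0 1 (An l))%E.
    move=> mAs mAn; apply: (etrans (gmodel_indepY md i mAs mAn)).
    by congr (_ * _ * _)%E; exact: esym.
  have marg l : (\int[gP md]_(w in j @^-1` [set i]) (x l i w)%:E =
      gP md (j @^-1` [set i]) *
      \int[normal0 T]_y ((tnth (U i) l - g * y) ^+ 2)%:E)%E.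
    apply: (@ge0_integral_marginal _ _ _ _ _ (mj i) n (gS md) (gNY md)
      (@gS_meas _ _ _ _ _ _ md) (normal0 T) (normal0 1) indepE
      (fun y => ((tnth (U i) l - g * y) ^+ 2)%:E) l).
      apply/measurable_EFinP; apply: measurable_funX; exact: measurable_funB.
    by move=> y; rewrite lee_fin sqr_ge0.
  have mxE l : measurable_fun (j @^-1` [set i]) (fun w => (x l i w)%:E).
    by apply: measurable_funTS; apply/measurable_EFinP.
  have x0E l w : (0 <= (x l i w)%:E)%E by rewrite lee_fin sqr_ge0.
  have -> : (\int[gP md]_(w in j @^-1` [set i]) (f (j w) w)%:E =
      \int[gP md]_(w in j @^-1` [set i])
        ((n%:R^-1)%:E * \sum_(l < n) (x l i w)%:E))%E.
    apply: eq_integral => w; rewrite inE => -> .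
    by rewrite /f EFinM -sumEFin.
  have ms : measurable_fun (j @^-1` [set i]) (fun w => \sum_(l < n) (x l i w)%:E)%E.
    exact: emeasurable_sum.
  have ni0 : (0 <= (n%:R^-1 : R)%:E)%E by rewrite lee_fin invr_ge0.
  have s0E w : (0 <= \sum_(l < n) (x l i w)%:E)%E by exact: sume_ge0.
  rewrite (ge0_integralZl _ (mj i) ms (fun w _ => s0E w) ni0).
  rewrite (ge0_integral_sum _ (mj i) mxE (fun l w _ => x0E l w)).
  apply: (@le_trans _ _ ((n%:R^-1)%:E * \sum_(l < n)
      (M^-1 * (tnth (U i) l ^+ 2 + g ^+ 2 * T))%:E)%E).
    apply: lee_wpmul2l => //; apply: lee_sum => l _.
    rewrite marg PE [leRHS]EFinM; apply: lee_wpmul2l.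
      by rewrite lee_fin invr_ge0.
    exact: normal0_affine_second_moment.
  rewrite sumEFin -EFinM lee_fin -mulr_sumr big_split/= sumr_const card_ord.
  rewrite mulrCA ler_pM2l ?invr_gt0// mulrDr lerD2l.
  (* At [n = 0] the factor [n%:R^-1] is [0] and the averaged state energy vanishes. *)
  have [->|n0] := posnP n; first by rewrite mulr0n mulr0 mulr_ge0 ?sqr_ge0 ?ltW.
  have e : n%:R^-1 *+ n = 1 :> R by rewrite -[LHS]mulr_natr mulVf// pnatr_eq0 -lt0n.
  by rewrite mulrnAr -mulrnAl e mul1r.
apply: (@le_trans _ _ (\sum_i (M^-1 * (n%:R^-1 * \sum_(l < n) tnth (U i) l ^+ 2 +
    g ^+ 2 * T))%:E)%E).
  by apply: lee_sum => i _; exact: bound.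
rewrite sumEFin lee_fin -[leLHS]mulr_sumr big_split/= mulrDr lerD2l sumr_const.
have e : M^-1 *+ #|{: J}| = 1 by rewrite -[LHS]mulr_natr mulVf// gt_eqF.
by rewrite mulrnAr -mulrnAl e mul1r.
Qed.

End code_performance.

Section existence.
Context (R : realType) (T sig2 g Ps vY vZ : R) (n a b : nat).
Hypothesis T0 : 0 < T.
Hypothesis sig20 : 0 < sig2.
Hypothesis Ps0 : 0 < Ps.
Hypothesis vYE : vY = (1 - g) ^+ 2 * T + 1.
Hypothesis vZE : vZ = (1 - g) ^+ 2 * T + sig2.
Hypothesis PvZE : Ps + vZ = T + sig2.
Hypothesis a0 : (0 < a)%N.
Hypothesis b0 : (0 < b)%N.

Let vY0 : 0 < vY. Proof. by rewrite vYE ltr_wpDl// mulr_ge0 ?sqr_ge0 ?ltW. Qed.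
Let vZ0 : 0 < vZ. Proof. by rewrite vZE ltr_wpDl// mulr_ge0 ?sqr_ge0 ?ltW. Qed.

(** The code precedes the model [md]: it is selected through integrals against Gaussian product
    laws, which bound its performance in every model. *)
Lemma exists_good_code (s k : R) : 0 < s -> s <= 4^-1 -> 0 < k ->
  let IY := ln ((Ps + vY) / vY) / 2 in
  let IZ := ln ((Ps + vZ) / vZ) / 2 in
  let eps := a%:R `^ s * expR (- s * IY + 8 * s ^+ 2) ^+ n +
    (a * b)%:R `^ (- s) / s * expR (s * IZ + 8 * s ^+ 2) ^+ n in
  exists c : ccode R n a b, forall md : gmodel T sig2 n a b,
  [/\ (code_power c md <= (Ps * (1 + k * eps) + g ^+ 2 * T)%:E)%E,
      (0 <= code_perr c md <= (k^-1 + eps)%:E)%E &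
      (0 <= code_covertness c md <= (k^-1 + eps)%:E)%E].
Proof.
move=> s0 s4 k0 IY IZ eps.
have s1 : s < 1 by lra.
have mrY := measurable_awgn_ratio Ps0 vY0.
have mrZ := measurable_awgn_ratio Ps0 vZ0.
have rY0 := awgn_ratio_gt0 Ps0 vY0.
have rZ0 := awgn_ratio_gt0 Ps0 vZ0.
pose LY := @product_ratio _ _ R R R (awgn_ratio Ps vY) n.
pose LZ := @product_ratio _ _ R R R (awgn_ratio Ps vZ) n.
(* Energy per symbol divided by [Ps], so that its mean is at most 1 as [random_coding] expects. *)
pose e (u : n.-tuple R) : R := Ps^-1 * (n%:R^-1 * \sum_(l < n) tnth u l ^+ 2).
have cardJ : #|{: 'I_a * 'I_b}| = (a * b)%N by rewrite card_prod !card_ord.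
have mLY : measurable_fun [set: n.-tuple R * n.-tuple R] LY.
  exact: (@measurable_product_ratio _ _ R R R _ mrY n).
have mLZ : measurable_fun [set: n.-tuple R * n.-tuple R] LZ.
  exact: (@measurable_product_ratio _ _ R R R _ mrZ n).
have LY0 p : 0 < LY p by exact: product_ratio_gt0.
have LZ0 p : 0 < LZ p by exact: product_ratio_gt0.
have msum : measurable_fun [set: n.-tuple R] (fun u => \sum_(l < n) tnth u l ^+ 2 : R).
  by apply: measurable_sum => l; apply: measurable_funX; exact: measurable_tnth.
have me : measurable_fun [set: n.-tuple R] e.
  by apply: measurable_funM => //; exact: measurable_funM.
have sum0 (u : n.-tuple R) : 0 <= \sum_(l < n) tnth u l ^+ 2.
  by apply: sumr_ge0 => l _; exact: sqr_ge0.
have e0 u : 0 <= e u by rewrite !mulr_ge0 ?invr_ge0 ?(ltW Ps0).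
have mue : (\int[pow_prob (normal0 Ps) n]_u (e u)%:E <= 1)%E.
  have msq : measurable_fun [set: R] (fun x : R => (x ^+ 2)%:E).
    by apply/measurable_EFinP; exact: measurable_funX.
  have sq0 (x : R) : (0 <= (x ^+ 2)%:E)%E by rewrite lee_fin sqr_ge0.
  have msumE : measurable_fun [set: n.-tuple R]
      (fun u => (\sum_(l < n) tnth u l ^+ 2 : R)%:E) by exact/measurable_EFinP.
  have c0 : 0 <= Ps^-1 * n%:R^-1 by rewrite mulr_ge0 ?invr_ge0 ?(ltW Ps0).
  have eE u : (e u)%:E = ((Ps^-1 * n%:R^-1)%:E * \sum_(l < n) (tnth u l ^+ 2)%:E)%E.
    by rewrite sumEFin -EFinM -mulrA.
  have mt l : measurable_fun [set: n.-tuple R] (fun u => (tnth u l ^+ 2)%:E).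
    by apply/measurable_EFinP; apply: measurable_funX; exact: measurable_tnth.
  have t0 l (u : n.-tuple R) : (0 <= (tnth u l ^+ 2)%:E)%E by rewrite lee_fin sqr_ge0.
  have ts0 (u : n.-tuple R) : (0 <= \sum_(l < n) (tnth u l ^+ 2)%:E)%E by exact: sume_ge0.
  have mts : measurable_fun [set: n.-tuple R] (fun u => \sum_(l < n) (tnth u l ^+ 2)%:E)%E.
    exact: emeasurable_sum.
  have c0E : (0 <= (Ps^-1 * n%:R^-1)%:E)%E by rewrite lee_fin.
  rewrite (eq_integral _ _ (fun u _ => eE u)).
  rewrite (ge0_integralZl _ measurableT mts (fun u _ => ts0 u) c0E).
  rewrite (ge0_integral_sum _ measurableT mt (fun l u _ => t0 l u)).
  apply: (@le_trans _ _ ((Ps^-1 * n%:R^-1)%:E * \sum_(l < n) Ps%:E)%E).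
    apply: lee_wpmul2l => //; apply: lee_sum => l _.
    apply: le_trans (normal0_second_moment Ps0).
    by rewrite (ge0_integral_pow_prob_tnth (normal0 Ps) l msq sq0).
  rewrite sumEFin -EFinM lee_fin sumr_const card_ord -[X in _ * X]mulr_natr.
  have [->|n0] := posnP n; first by rewrite !mulr0.
  by rewrite mulrACA mulVf ?gt_eqF// mul1r mulVf// pnatr_eq0 -lt0n.
have LY1 (y : n.-tuple R) : (\int[pow_prob (normal0 Ps) n]_u (LY (u, y))%:E = 1)%E.
  apply: integral_product_ratio_input => //.
  by move=> z; exact: integral_awgn_input.
have LZ1 (y : n.-tuple R) : (\int[pow_prob (normal0 Ps) n]_u (LZ (u, y))%:E = 1)%E.
  apply: integral_product_ratio_input => //.
  by move=> z; exact: integral_awgn_input.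
have LZo (u : n.-tuple R) : (\int[pow_prob (normal0 (Ps + vZ)) n]_y (LZ (u, y))%:E = 1)%E.
  apply: integral_product_ratio_output => //.
  by move=> z; exact: integral_awgn_output.
have momY : (\int[normal0 Ps]_u \int[normal0 (Ps + vY)]_z
    (awgn_ratio Ps vY (u, z) `^ (1 - s))%:E <=
    (expR (- s * IY + 8 * s ^+ 2))%:E)%E.
  have := awgn_moment_le Ps0 vY0 (s := - s); rewrite sqrrN; apply; lra.
have momZ : (\int[normal0 Ps]_u \int[normal0 (Ps + vZ)]_z
    (awgn_ratio Ps vZ (u, z) `^ (1 + s))%:E <=
    (expR (s * IZ + 8 * s ^+ 2))%:E)%E.
  by apply: awgn_moment_le => //; lra.
have mY := @product_ratio_moment_le _ _ R R R (normal0 Ps) (normal0 (Ps + vY)) _ mrY rY0 n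
  (1 - s) (expR (- s * IY + 8 * s ^+ 2)).
have mZ := @product_ratio_moment_le _ _ R R R (normal0 Ps) (normal0 (Ps + vZ)) _ mrZ rZ0 n
  (1 + s) (expR (s * IZ + 8 * s ^+ 2)).
have {}mY := mY momY.
have {}mZ := mZ momZ.
rewrite -cardJ in eps *.
have [U [U1 U2 U3]] := random_coding mLY mLZ LY0 LZ0 LZo LY1 LZ1 me e0 mue s0 s1 mY mZ a0 b0 k0.
exists (codebook_code a0 mLY g U) => md.
have cp := codebook_power_le g T0 a0 b0 mLY U md.
have ce := codebook_perr_le T0 Ps0 vYE a0 mLY U md.
have cc := codebook_covertness_bounds T0 sig20 Ps0 vZE PvZE a0 b0 mLY md s0 s1 U3.
split.
- apply: (le_trans cp); rewrite lee_fin lerD2r -ler_pdivrMl//.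
  apply: le_trans U1; rewrite mulrCA ler_wpM2l ?invr_ge0//.
  by rewrite mulr_sumr.
- by apply/andP; split; [exact: measure_ge0|exact: (le_trans ce U2)].
- exact: cc.
Qed.

End existence.

(** * Asymptotics *)

Lemma le_limn_esup (R : realType) (u v : (\bar R)^nat) :
  (forall n, (u n <= v n)%E) -> (limn_esup u <= limn_esup v)%E.
Proof.
move=> uv; apply: le_ereal_inf_tmp => _ [V VF <-].
apply: (@le_trans _ _ (ereal_sup (u @` V))).
  by apply: ereal_inf_lbound; exists V.
apply: ge_ereal_sup => _ [n Vn <-]; apply: (le_trans (uv n)).
by apply: ereal_sup_ubound; exists n.
Qed.

Lemma powR2_expR (R : realType) (x : R) : 2 `^ x = expR (x * ln 2).
Proof. by rewrite -[2 in LHS]lnK ?posrE// -expRM mulrC. Qed.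

Lemma msize_itv (R : realType) n (r : R) :
  expR (n%:R * r * ln 2) <= (msize n r)%:R < expR (n%:R * r * ln 2) + 1.
Proof.
rewrite -powR2_expR /msize; set x := 2 `^ _.
have c0 : 0 <= Num.ceil x.
  by rewrite ceil_ge0 (lt_le_trans (ltrN10 _))// powR_ge0.
rewrite natr_absz ger0_norm// ceil_ge/=.
by have := ceilB1_lt x; rewrite intrD mulrN1z ltrBlDr.
Qed.

Lemma msize_gt0 (R : realType) n (r : R) : (0 < msize n r)%N.
Proof.
have /andP[h _] := msize_itv n r.
by rewrite -(ltr0n R) (lt_le_trans _ h)// expR_gt0.
Qed.

(** Rounding up costs less than 1, which is at most the exponential because [r] is nonnegative;
    hence the factor 2. *)
Lemma msize_le (R : realType) n (r : R) : 0 <= r ->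
  (msize n r)%:R <= 2 * expR (n%:R * r * ln 2).
Proof.
move=> r0; have /andP[_ /ltW h] := msize_itv n r.
apply: (le_trans h); rewrite [leRHS]mulr_natl [leRHS]mulr2n lerD2l -[leLHS]expR0 ler_expR.
have l2 : 0 <= ln 2 :> R by rewrite ln_ge0// ler1n.
by rewrite !mulr_ge0.
Qed.

(* Both exponents fall short of the thresholds by [D]; the second-order term
   [8 * s ^+ 2] eats at most half of the resulting gain [s * D]. *)
Lemma coding_error_le (R : realType) n (r RK IY IZ D s : R) :
  0 <= r -> 0 < s -> s <= 1 -> 16 * s <= D ->
  r * ln 2 <= IY - D -> IZ + D <= (r + RK) * ln 2 ->
  (msize n r)%:R `^ s * expR (- s * IY + 8 * s ^+ 2) ^+ n +
    (msize n r * msize n RK)%:R `^ (- s) / s * expR (s * IZ + 8 * s ^+ 2) ^+ n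
  <= (2 + s^-1) * (expR (- (s * D / 4)) ^+ n) ^+ 2.
Proof.
move=> r0 s0 s1 sD rY rZ; rewrite [leRHS]mulrDl.
have n0 : 0 <= n%:R :> R by [].
have qE : (expR (- (s * D / 4)) ^+ n) ^+ 2 = expR (n%:R * (- (s * D / 2))).
  by rewrite exprAC -expRM_natl [RHS]expRM_natl; congr (expR _ ^+ _); field.
have ss : 8 * s ^+ 2 <= s * D / 2 by rewrite expr2; nra.
apply: lerD.
- apply: (@le_trans _ _ (2 * expR (s * (n%:R * r * ln 2)) * expR (- s * IY + 8 * s ^+ 2) ^+ n)).
    rewrite ler_wpM2r ?exprn_ge0 ?expR_ge0//.
    apply: (@le_trans _ _ ((2 * expR (n%:R * r * ln 2)) `^ s)).
      apply: (ge0_ler_powR (ltW s0)); last exact: msize_le.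
        by rewrite nnegrE.
      by rewrite nnegrE mulr_ge0 ?expR_ge0.
    rewrite powRM ?expR_ge0// -expRM [X in expR X]mulrC ler_wpM2r ?expR_ge0//.
    by rewrite ler1_powR// ler1n.
  rewrite -mulrA ler_pM2l// qE -expRM_natl -expRD ler_expR.
  rewrite (_ : s * _ = n%:R * (s * (r * ln 2))); last by ring.
  by rewrite -mulrDr ler_wpM2l//; nra.
- rewrite -[leLHS]mulrA [leLHS]mulrC -[leLHS]mulrA.
  have a0 := msize_gt0 n r; have b0 := msize_gt0 n RK.
  rewrite ler_pM2l ?invr_gt0//.
  apply: (@le_trans _ _ (expR (- s * (n%:R * (r + RK) * ln 2)) *
      expR (s * IZ + 8 * s ^+ 2) ^+ n)).
    rewrite mulrC ler_wpM2r ?exprn_ge0 ?expR_ge0//.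
    (* The exponent is negative, so the lower bounds on both sizes are used; they hold for [RK] of
       either sign. *)
    rewrite powRN mulNr expRN lef_pV2 ?posrE ?expR_gt0 ?powR_gt0 ?ltr0n ?muln_gt0 ?a0//.
    rewrite [X in expR X]mulrC expRM ge0_ler_powR ?nnegrE ?expR_ge0//; first exact: ltW.
    have /andP[ha _] := msize_itv n r; have /andP[hb _] := msize_itv n RK.
    by rewrite mulrDr mulrDl expRD natrM ler_pM ?expR_ge0.
  rewrite qE -expRM_natl -expRD ler_expR.
  rewrite (_ : - s * _ = n%:R * (- s * ((r + RK) * ln 2))); last by ring.
  by rewrite -mulrDr ler_wpM2l//; nra.
Qed.

(** [coding_error_le] bounds the mean cost [eps] by [C] times the square of [x ^+ n]. Taking for [k]
    the inverse of [x ^+ n] balances the two demands: the energy excess [k * eps] and the bound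
    [k^-1 + eps] on error and divergence are both of order [x ^+ n]. *)
Lemma achievable_c_below (R : realType) (T sig2 Pw RK g Ps vY vZ D r : R) :
  0 < T -> 0 < sig2 -> 0 < Ps ->
  vY = (1 - g) ^+ 2 * T + 1 -> vZ = (1 - g) ^+ 2 * T + sig2 ->
  Ps + vZ = T + sig2 -> Ps + g ^+ 2 * T <= Pw ->
  0 < D -> 0 <= r -> r * ln 2 <= ln ((Ps + vY) / vY) / 2 - D ->
  ln ((Ps + vZ) / vZ) / 2 + D <= (r + RK) * ln 2 ->
  achievable_c T sig2 Pw RK r.
Proof.
move=> T0 sig20 Ps0 vYE vZE PvZE PsPw D0 r0 rY rZ.
(* [4^-1] is the range of the moment bound; [D / 16] keeps the second-order term below half of the
   gain. *)
pose s := Num.min 4^-1 (D / 16).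
have s0 : 0 < s by rewrite /s lt_min invr_gt0 divr_gt0// ltr0n.
have s4 : s <= 4^-1 by rewrite /s ge_min lexx.
have sD : 16 * s <= D by rewrite mulrC -ler_pdivlMr// /s ge_min lexx orbT.
have s1 : s <= 1 by lra.
pose x := expR (- (s * D / 4)).
have x0 : 0 < x by exact: expR_gt0.
have x1 : x < 1 by rewrite -expR0 ltr_expR oppr_lt0 divr_gt0 ?mulr_gt0.
pose C := 2 + s^-1.
have C0 : 0 <= C by rewrite addr_ge0// invr_ge0 ltW.
have [c cP] : {c : forall n, ccode R n (msize n r) (msize n RK) |
    forall n (md : gmodel T sig2 n (msize n r) (msize n RK)),
    [/\ (code_power (c n) md <= (Ps * (1 + C * x ^+ n) + g ^+ 2 * T)%:E)%E,
        (0 <= code_perr (c n) md <= ((1 + C) * x ^+ n)%:E)%E &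
        (0 <= code_covertness (c n) md <= ((1 + C) * x ^+ n)%:E)%E]}.
  suff ex n : exists cn : ccode R n (msize n r) (msize n RK),
      forall md : gmodel T sig2 n (msize n r) (msize n RK),
      [/\ (code_power cn md <= (Ps * (1 + C * x ^+ n) + g ^+ 2 * T)%:E)%E,
        (0 <= code_perr cn md <= ((1 + C) * x ^+ n)%:E)%E &
        (0 <= code_covertness cn md <= ((1 + C) * x ^+ n)%:E)%E].
    by exists (fun n => projT1 (cid (ex n))) => n; exact: (projT2 (cid (ex n))).
  have xn0 : 0 < x ^+ n by exact: exprn_gt0.
  have k0 : 0 < (x ^+ n)^-1 by rewrite invr_gt0.
  have epsle := coding_error_le n r0 s0 s1 sD rY rZ.
  have [cn cnP] := exists_good_code n T0 sig20 Ps0 vYE vZE PvZE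
    (msize_gt0 n r) (msize_gt0 n RK) s0 s4 k0.
  rewrite invrK in cnP; move: epsle cnP; set eps := (X in X <= _) => epsle cnP.
  have errle : x ^+ n + eps <= (1 + C) * x ^+ n.
    rewrite mulrDl mul1r lerD2l (le_trans epsle)// expr2 mulrA ler_piMr//.
      by rewrite mulr_ge0// ltW.
    by rewrite exprn_ile1// ltW.
  exists cn => md; have [h1 /andP[h20 h2] /andP[h30 h3]] := cnP md; split.
  - apply: (le_trans h1); rewrite lee_fin lerD2r ler_pM2l// lerD2l.
    by rewrite ler_pdivrMl// (le_trans epsle)// expr2 mulrCA.
  - by rewrite h20 (le_trans h2)// lee_fin.
  - by rewrite h30 (le_trans h3)// lee_fin.
have xn_cvg : (x ^+ n)@[n --> \oo] --> (0 : R).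
  by apply: cvg_expr; rewrite gtr0_norm.
have err_cvg : ((1 + C) * x ^+ n)%:E @[n --> \oo] --> 0%E.
  apply: cvg_EFin; first exact: nearW.
  rewrite -[X in _ --> X](mulr0 (1 + C)); exact: cvgMr.
exists c => md; split.
- apply: (@le_trans _ _ (limn_esup (fun n => (Ps * (1 + C * x ^+ n) + g ^+ 2 * T)%:E))).
    by apply: le_limn_esup => n; have [] := cP n (md n).
  have pc : (Ps * (1 + C * x ^+ n) + g ^+ 2 * T)%:E @[n --> \oo] --> (Ps + g ^+ 2 * T)%:E.
    apply: cvg_EFin; first exact: nearW.
    apply: cvgD; last exact: cvg_cst.
    rewrite -[X in _ --> X]mulr1; apply: cvgMr.
    rewrite -[X in _ --> X]addr0; apply: cvgD; first exact: cvg_cst.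
    by rewrite -[X in _ --> X](mulr0 C); exact: cvgMr.
  by have [_ ->] := cvg_limn_einf_sup pc; rewrite lee_fin.
- apply: (squeeze_cvge _ (cvg_cst 0%E) err_cvg); apply: nearW => n.
  by have [_ ] := cP n (md n).
- apply: (squeeze_cvge _ (cvg_cst 0%E) err_cvg); apply: nearW => n.
  by have [_ _] := cP n (md n).
Qed.

(** The capacity is a supremum, so for every [e > 0] an achievable rate within [e] of the target
    suffices. Rates are compared in nats, after multiplication by [ln 2]. *)
Theorem theorem5 (R : realType) (T sig2 Pw RK : R) :
  0 < T -> 0 < sig2 -> 0 < Pw ->
  let gam := Num.min 1 (Pw / (2 * T)) in
  let Ts := (1 - gam) ^+ 2 * T in
  let Ps := T - Ts in
  RK > 2^-1 * log2 (1 + Ps / (Ts + sig2)) - 2^-1 * log2 (1 + Ps / (Ts + 1)) ->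
  (covert_capacity_c T sig2 Pw RK >= (2^-1 * log2 (1 + Ps / (Ts + 1)))%:E)%E.
Proof.
move=> T0 sig20 Pw0 gam Ts Ps.
have gam0 : 0 < gam by rewrite /gam lt_min ltr01 divr_gt0// mulr_gt0.
have gam1 : gam <= 1 by rewrite /gam ge_min lexx.
have gamP : 2 * T * gam <= Pw.
  by rewrite mulrC -ler_pdivlMr ?mulr_gt0// /gam ge_min lexx orbT.
have Ts0 : 0 <= Ts by rewrite mulr_ge0 ?sqr_ge0 ?ltW.
have PsE : Ps = T * gam * (2 - gam) by rewrite /Ps /Ts; ring.
have Ps0 : 0 < Ps.
  by rewrite PsE; apply: mulr_gt0; [exact: mulr_gt0|lra].
have PsPw : Ps + gam ^+ 2 * T <= Pw.
  by rewrite (_ : _ + _ = 2 * T * gam)// PsE; ring.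
have ratioE v : 0 < v -> 1 + Ps / (Ts + v) = (Ps + (Ts + v)) / (Ts + v).
  move=> v0; rewrite [RHS]mulrDl divff; first exact: addrC.
  by rewrite gt_eqF// ltr_wpDl.
rewrite !ratioE//.
have ln2 : 0 < ln 2 :> R by rewrite ln_gt0// ltr1n.
pose IY := ln ((Ps + (Ts + 1)) / (Ts + 1)) / 2.
pose IZ := ln ((Ps + (Ts + sig2)) / (Ts + sig2)) / 2.
have rateE x : 2^-1 * log2 x = ln x / 2 / ln 2 :> R by rewrite /log2; ring.
rewrite !rateE -/IY -/IZ => hRK.
have IY0 : 0 < IY.
  have v0 : 0 < Ts + 1 by exact: ltr_wpDl.
  by rewrite divr_gt0// ln_gt0// ltr_pdivlMr// mul1r ltrDr.
have gap0 : 0 < RK * ln 2 + IY - IZ.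
  move: hRK; rewrite -mulrBl ltr_pdivrMr//; lra.
apply/lee_addgt0Pr => e e0.
(* The three bounds on the back-off [D]: the rate stays within [e] of the target, it is nonnegative,
   and half of the key gap is left so that [(r + RK) * ln 2] still exceeds [IZ] by [D]. *)
pose D := Num.min (e * ln 2) (Num.min IY ((RK * ln 2 + IY - IZ) / 2)).
have D0 : 0 < D by rewrite !lt_min IY0 mulr_gt0// divr_gt0.
have De : D <= e * ln 2 by rewrite /D ge_min lexx.
have DY : D <= IY by rewrite /D !ge_min lexx orbT.
have DZ : D <= (RK * ln 2 + IY - IZ) / 2 by rewrite /D !ge_min lexx !orbT.
pose r := (IY - D) / ln 2.
have r2 : r * ln 2 = IY - D by rewrite /r divfK// gt_eqF.
apply: (@le_trans _ _ (r + e)%:E).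
  by rewrite lee_fin ler_pdivrMr// mulrDl r2; lra.
rewrite EFinD leeD2r//; apply: ereal_sup_ubound; exists r => //=.
apply: (@achievable_c_below _ T sig2 Pw RK gam Ps (Ts + 1) (Ts + sig2) D) => //.
- by rewrite /Ps addrA subrK.
- by apply: divr_ge0; [rewrite subr_ge0|exact: ltW].
- by rewrite r2.
- by rewrite [leRHS]mulrDl r2 -/IZ; lra.
Qed.
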